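(* Let $\mathcal Z:\mathbb D_\epsilon^\star\to\mathbb R^3$ be a conformal parametrization of an embedded minimal end of catenoid type without umbilic points. If $\widetilde{\mathcal Z}:\mathbb D_\epsilon^\star\to\mathbb R^3$ is a minimal surface and $(\mathcal Z,\widetilde{\mathcal Z})$ is Ribaucour integrable, then $\widetilde{\mathcal Z}$ is an embedded minimal end of catenoid type with the same limiting value of the Gauss map as $\mathcal Z$.
   Context: $\mathbb D_\epsilon\subset\mathbb C$ is the open disk of radius $\epsilon$ centered at $0$ and $\mathbb D_\epsilon^\star=\mathbb D_\epsilon\setminus\{0\}$. An embedded minimal end of catenoid type is a conformal minimal immersion of $\mathbb D_\epsilon^\star$ which is complete at $0$, has finite total curvature (so its Gauss map extends to $0$), is embedded near $0$ and is asymptotic to an end of a catenoid (non-zero logarithmic growth); up to a rigid motion, a homothety and a change of conformal parameter, it has Weierstrass data $g(z)=z\,\eta_1(z)$, $\omega=z^{-2}\eta_2(z)\,dz$ with $\eta_1,\eta_2$ holomorphic at $0$, $\eta_i(0)=1$. A pair of minimal immersions $(\mathcal Z,\widetilde{\mathcal Z})$ with Gauss maps $\mathcal N,\widetilde{\mathcal N}$ is Ribaucour integrable if $\mathcal N\neq\widetilde{\mathcal N}$ everywhere, there is a smooth $\tau$ with $\mathcal Z+\tau\mathcal N=\widetilde{\mathcal Z}+\tau\widetilde{\mathcal N}$, and $\Re\int_\gamma\frac{d\widetilde{\mathcal G}}{\widetilde{\mathcal G}-\mathcal G}=0$ for every loop $\gamma$, with $\mathcal G=\Pi\circ\mathcal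 N$, $\widetilde{\mathcal G}=\Pi\circ\widetilde{\mathcal N}$, $\Pi$ stereographic projection (equivalently the smooth 1-form $\frac{\langle d\widetilde{\mathcal N},\mathcal N\rangle}{1-\langle\mathcal N,\widetilde{\mathcal N}\rangle}$ is exact). For minimal surfaces it is understood, as in the classical theory, that the pair is given by smooth functions $\rho,\phi$ ($\tau=-\phi/\rho$) satisfying, for some real constant $c\ne0$, $d\rho=\langle\nabla^m\phi,d\mathcal N\rangle$, $\mathrm{Hess}(\phi)=c\rho\,I^m+(\rho-c\phi)II^m$, $|\nabla^m\phi|^2=-\rho^2+2c\rho\phi$, with $\widetilde{\mathcal Z}=\mathcal Z-\frac1{c\rho}(\nabla^m\phi+\rho\mathcal N)$ and $\widetilde{\mathcal N}=\mathcal N-\frac1{c\phi}(\nabla^m\phi+\rho\mathcal N)$, where $\nabla^m,\mathrm{Hess}$ refer to the first fundamental form $I^m$ of $\mathcal Z$ and $II^m=-\langle d\mathcal Z,d\mathcal N\rangle$. *)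

(* Defs.v *)
From Stdlib Require Import Reals.
From Coquelicot Require Import Coquelicot.
Open Scope R_scope.

(** * Euclidean 3-space *)

Definition vec : Type := (R * R * R)%type.

Definition x1 (p : vec) : R := fst (fst p).
Definition x2 (p : vec) : R := snd (fst p).
Definition x3 (p : vec) : R := snd p.

Definition dot (p q : vec) : R := x1 p * x1 q + x2 p * x2 q + x3 p * x3 q.

Definition norm3 (p : vec) : R := sqrt (dot p p).

Definition cross (p q : vec) : vec :=
  (x2 p * x3 q - x3 p * x2 q,
   x3 p * x1 q - x1 p * x3 q,
   x1 p * x2 q - x2 p * x1 q).

(** Possibly orientation-reversing: the two unit normals of a catenoid are
    interchanged only by improper isometries, and whether an end is of catenoid
    type must not depend on the choice of the normal. *)
Definition rigid_motion (T : vec -> vec) : Prop :=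
  forall p q, norm3 (minus (T p) (T q)) = norm3 (minus p q).

(** * Calculus on plane domains *)

Definition punctured_disk (eps : R) (z : C) : Prop := 0 < Cmod z < eps.

Definition pd1 (f : C -> R) (z : C) : R := Derive (fun t => f (t, Im z)) (Re z).
Definition pd2 (f : C -> R) (z : C) : R := Derive (fun t => f (Re z, t)) (Im z).

(** [diff f z v] and [vdiff X z v] are the differentials at [z] applied to the
    tangent vector [v] of the parameter plane. *)
Definition diff (f : C -> R) (z v : C) : R := pd1 f z * Re v + pd2 f z * Im v.

Definition vdiff (X : C -> vec) (z v : C) : vec :=
  (diff (fun w => x1 (X w)) z v,
   diff (fun w => x2 (X w)) z v,
   diff (fun w => x3 (X w)) z v).

Definition e1 : C := (1, 0).
Definition e2 : C := (0, 1).

(** For open [U] this is C^infinity on [U]. *)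
Definition smooth_on (U : C -> Prop) (f : C -> R) : Prop :=
  forall (n : nat) (z : C), U z -> ex_diff_n (fun x y => f (x, y)) n (Re z) (Im z).

Definition vsmooth_on (U : C -> Prop) (X : C -> vec) : Prop :=
  smooth_on U (fun z => x1 (X z)) /\
  smooth_on U (fun z => x2 (X z)) /\
  smooth_on U (fun z => x3 (X z)).

Definition C1_on (D : R -> Prop) (f : R -> R) : Prop :=
  forall t, D t -> ex_derive f t /\ continuous (Derive f) t.

Definition C1_path_on (D : R -> Prop) (gam : R -> C) : Prop :=
  C1_on D (fun t => Re (gam t)) /\ C1_on D (fun t => Im (gam t)).

Definition path_derive (gam : R -> C) (t : R) : C :=
  (Derive (fun s => Re (gam s)) t, Derive (fun s => Im (gam s)) t).

Definition path_speed (c : R -> vec) (t : R) : R :=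
  sqrt (Derive (fun s => x1 (c s)) t ^ 2
        + Derive (fun s => x2 (c s)) t ^ 2
        + Derive (fun s => x3 (c s)) t ^ 2).

(** * Parametrized surfaces *)

Definition first_form (X : C -> vec) (z u v : C) : R :=
  dot (vdiff X z u) (vdiff X z v).

Definition det_first (X : C -> vec) (z : C) : R :=
  first_form X z e1 e1 * first_form X z e2 e2 - first_form X z e1 e2 ^ 2.

Definition area_density (X : C -> vec) (z : C) : R := sqrt (det_first X z).

Definition gauss_map (X : C -> vec) (z : C) : vec :=
  let n := cross (vdiff X z e1) (vdiff X z e2) in scal (/ norm3 n) n.

Definition second_form (X : C -> vec) (z u v : C) : R :=
  - dot (vdiff X z u) (vdiff (gauss_map X) z v).

Definition mean_curvature (X : C -> vec) (z : C) : R :=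
  (first_form X z e2 e2 * second_form X z e1 e1
   - 2 * first_form X z e1 e2 * second_form X z e1 e2
   + first_form X z e1 e1 * second_form X z e2 e2) / (2 * det_first X z).

Definition gauss_curvature (X : C -> vec) (z : C) : R :=
  (second_form X z e1 e1 * second_form X z e2 e2 - second_form X z e1 e2 ^ 2)
  / det_first X z.

Definition umbilic (X : C -> vec) (z : C) : Prop :=
  exists mu : R, forall u v : C, second_form X z u v = mu * first_form X z u v.

(** The gradient for the metric [first_form X], as a tangent vector in R^3. *)
Definition grad (X : C -> vec) (f : C -> R) (z : C) : vec :=
  plus
    (scal ((first_form X z e2 e2 * pd1 f z - first_form X z e1 e2 * pd2 f z)
           / det_first X z) (vdiff X z e1))
    (scal ((first_form X z e1 e1 * pd2 f z - first_form X z e1 e2 * pd1 f z)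
           / det_first X z) (vdiff X z e2)).

(** The Levi-Civita connection of the induced metric is the tangential part of
    the derivative in R^3; pairing with the tangent vector [vdiff X z v] makes
    the projection unnecessary. *)
Definition hess (X : C -> vec) (f : C -> R) (z u v : C) : R :=
  dot (vdiff (grad X f) z u) (vdiff X z v).

Definition immersion_on (U : C -> Prop) (X : C -> vec) : Prop :=
  vsmooth_on U X /\ forall z, U z -> det_first X z <> 0.

Definition minimal_immersion_on (U : C -> Prop) (X : C -> vec) : Prop :=
  immersion_on U X /\ forall z, U z -> mean_curvature X z = 0.

Definition conformal_on (U : C -> Prop) (X : C -> vec) : Prop :=
  forall z, U z ->
    first_form X z e1 e1 = first_form X z e2 e2 /\ first_form X z e1 e2 = 0.

(** * Embedded minimal ends of catenoid type *)

(** Every path in the punctured disk tending to [0] has infinite length. *)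
Definition complete_at_0 (eps : R) (X : C -> vec) : Prop :=
  forall gam : R -> C,
    C1_path_on (fun t => 0 <= t) gam ->
    (forall t, 0 <= t -> punctured_disk eps (gam t)) ->
    filterlim gam (Rbar_locally p_infty) (locally (RtoC 0)) ->
    is_lim (fun t => RInt (path_speed (fun s => X (gam s))) 0 t) p_infty p_infty.

(** An end is a germ at [0], so only the total curvature of a small punctured
    disk matters; it is computed in polar coordinates as the supremum over the
    annuli [s <= |z| <= delta]. *)
Definition finite_total_curvature_at_0 (eps : R) (X : C -> vec) : Prop :=
  exists delta M : R, 0 < delta < eps /\
    forall s, 0 < s < delta ->
      RInt (fun r =>
        RInt (fun theta =>
          let z : C := (r * cos theta, r * sin theta) in
          Rabs (gauss_curvature X z) * area_density X z * r)
        0 (2 * PI)) s delta <= M.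

(** Injective with continuous inverse. *)
Definition homeo_onto_image (U : C -> Prop) (X : C -> vec) : Prop :=
  (forall z w, U z -> U w -> X z = X w -> z = w) /\
  (forall z, U z -> forall e, 0 < e -> exists d, 0 < d /\
     forall w, U w -> norm3 (minus (X w) (X z)) < d -> Cmod (Cminus w z) < e).

Definition embedded_near_0 (eps : R) (X : C -> vec) : Prop :=
  exists delta, 0 < delta < eps /\ homeo_onto_image (punctured_disk delta) X.

(** Conformal parametrization of the catenoid by the punctured plane
    (Weierstrass data [g = -w], [omega = - dw / w^2]); the ends are at [0] and
    at infinity, and are exchanged by an isometry of R^3. *)
Definition catenoid (w : C) : vec :=
  (cosh (ln (Cmod w)) * (Re w / Cmod w),
   cosh (ln (Cmod w)) * (Im w / Cmod w),
   ln (Cmod w)).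

Definition conformal_change (w : C -> C) : Prop :=
  w (RtoC 0) = RtoC 0 /\
  locally (RtoC 0) (fun z => @ex_derive C_AbsRing C_NormedModule w z) /\
  exists a : C, a <> RtoC 0 /\
    @is_derive C_AbsRing C_NormedModule w (RtoC 0) a.

(** Up to a rigid motion, a homothety and a change of conformal parameter, the
    distance to the catenoid end tends to [0].  In particular the logarithmic
    growth is non-zero. *)
Definition asymptotic_to_catenoid (X : C -> vec) : Prop :=
  exists (T : vec -> vec) (r : R) (w : C -> C),
    rigid_motion T /\ 0 < r /\ conformal_change w /\
    filterlim (fun z => norm3 (minus (X z) (T (scal r (catenoid (w z))))))
      (locally' (RtoC 0)) (locally 0).

Record catenoid_type_end (eps : R) (X : C -> vec) : Prop := {
  cte_minimal : minimal_immersion_on (punctured_disk eps) X;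
  cte_conformal : conformal_on (punctured_disk eps) X;
  cte_complete : complete_at_0 eps X;
  cte_curvature : finite_total_curvature_at_0 eps X;
  cte_embedded : embedded_near_0 eps X;
  cte_asymptotic : asymptotic_to_catenoid X
}.

Definition gauss_limit (X : C -> vec) (nu : vec) : Prop :=
  filterlim (gauss_map X) (locally' (RtoC 0)) (locally nu).

(** * Ribaucour integrable pairs *)

Definition stereo (p : vec) : C := (x1 p / (1 - x3 p), x2 p / (1 - x3 p)).

Definition sgauss (X : C -> vec) (z : C) : C := stereo (gauss_map X z).

Definition C1_loop_in (U : C -> Prop) (gam : R -> C) : Prop :=
  C1_path_on (fun t => 0 <= t <= 1) gam /\
  (forall t, 0 <= t <= 1 -> U (gam t)) /\
  gam 0 = gam 1.

(** [Re \int_gamma dG~ / (G~ - G)] *)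
Definition real_period (G Gt : C -> C) (gam : R -> C) : R :=
  RInt (fun t =>
    Re (Cdiv (path_derive (fun s => Gt (gam s)) t)
             (Cminus (Gt (gam t)) (G (gam t))))) 0 1.

(** The form has to be integrated where [G] and [G~] are both finite. This loses
    no loop: at a pole of [G] it extends by zero, and at a pole of [G~] it has an
    integer residue, hence no real period. *)
Definition finite_gauss (X : C -> vec) (z : C) : Prop := x3 (gauss_map X z) <> 1.

Definition periods_vanish (U : C -> Prop) (Z Zt : C -> vec) : Prop :=
  forall gam : R -> C,
    C1_loop_in (fun z => U z /\ finite_gauss Z z /\ finite_gauss Zt z) gam ->
    real_period (sgauss Z) (sgauss Zt) gam = 0.

Record ribaucour_data (U : C -> Prop) (Z Zt : C -> vec)
    (c : R) (rho phi : C -> R) : Prop := {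
  rd_c : c <> 0;
  rd_rho_smooth : smooth_on U rho;
  rd_phi_smooth : smooth_on U phi;
  rd_rho_neq0 : forall z, U z -> rho z <> 0;
  rd_phi_neq0 : forall z, U z -> phi z <> 0;
  rd_drho : forall z v, U z ->
    diff rho z v = dot (grad Z phi z) (vdiff (gauss_map Z) z v);
  rd_hess : forall z u v, U z ->
    hess Z phi z u v
    = c * rho z * first_form Z z u v
      + (rho z - c * phi z) * second_form Z z u v;
  rd_norm : forall z, U z ->
    dot (grad Z phi z) (grad Z phi z) = - rho z ^ 2 + 2 * c * rho z * phi z;
  rd_surface : forall z, U z ->
    Zt z = minus (Z z)
             (scal (1 / (c * rho z))
                (plus (grad Z phi z) (scal (rho z) (gauss_map Z z))));
  rd_gauss : forall z, U z ->
    gauss_map Zt z = minus (gauss_map Z z)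
             (scal (1 / (c * phi z))
                (plus (grad Z phi z) (scal (rho z) (gauss_map Z z))))
}.

Definition ribaucour_integrable (U : C -> Prop) (Z Zt : C -> vec) : Prop :=
  (forall z, U z -> gauss_map Z z <> gauss_map Zt z) /\
  (exists tau : C -> R,
     smooth_on U tau /\
     (forall z, U z ->
        plus (Z z) (scal (tau z) (gauss_map Z z))
        = plus (Zt z) (scal (tau z) (gauss_map Zt z))) /\
     exists (c : R) (rho phi : C -> R),
       ribaucour_data U Z Zt c rho phi /\
       forall z, U z -> tau z = - phi z / rho z) /\
  periods_vanish U Z Zt.

(* Main.v *)
Require Import Defs.
From Stdlib Require Import Reals Lra Lia.
From Coquelicot Require Import Coquelicot.
Open Scope R_scope.

(** Write [W = grad phi + rho N] and [V = c (Zt - Z) = - W / rho].  The Ribaucour equations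
    say that [<V, N> = -1], [c dZt = - |V|^2 dN / 2 + <V, dN> V] and that [Nt] is the image of
    [N] under the reflection in the plane orthogonal to [V].  In terms of stereographic Gauss
    maps [g] and [gt], [V] is determined by [g] and [u = 1 / (gt - g)], and the system becomes
    the Riccati equation [u' = g' u^2 - (c / 2) f], where [f dz] and [g] are the Weierstrass
    data of [Z].  At a catenoid end [g] has a simple zero and [f] a double pole.  A solution
    [u] without poles in the punctured disk is then [O(1/z)]: Cauchy's estimate bounds [u'] by
    a small multiple of [|u|^2] near a point where [|u|] is relatively large, against the
    equation.  Hence [z u] has a limit [p0], a root of a quadratic equation that excludes the
    degenerate values.  Since [Zt] is an explicit expression in [Z], [g] and [u], its
    coordinates have the poles and logarithms of a catenoid with the same axis. *)

(** The obstacle is the puncture: [Zt] is controlled only away from it, so even the order of growth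
    of [u] has to be won from the equation. The quadratic equation is [p0 + l p0^2 - (c / 2) m = 0],
    where [l] and [m] are the limits of [g'] and [z^2 f], both nonzero. It excludes [p0 = 0], so
    that [|V|] grows like [1 / |z|]. With [w ~ al z] the conformal parameter and [r] the size of the
    catenoid, it also excludes [p0 = - c r / (2 al)], the value at which the poles of [Z] and
    [V / c] would cancel in [Zt = Z + V / c]. The growth of [V] settles the Gauss map, because
    [|Nt - N| = 2 / |V|], and the total curvature, whose density is [4 c^2 E / |V|^4] with [E] the
    conformal factor of [Z]. The surviving horizontal pole gives embeddedness. The axial component
    of [V] has a limit, so the height of [Zt] keeps the logarithm of [Z], whence completeness.
    Holomorphic functions carry a continuous derivative, and Cauchy's theory is obtained by
    differentiating circle integrals in a parameter. *)

Lemma C_eq (z w : C) : Re z = Re w -> Im z = Im w -> z = w.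
Proof. destruct z, w; simpl; intros -> ->; reflexivity. Qed.

Lemma Re_plus (z w : C) : Re (z + w)%C = Re z + Re w. Proof. reflexivity. Qed.
Lemma Im_plus (z w : C) : Im (z + w)%C = Im z + Im w. Proof. reflexivity. Qed.
Lemma Re_opp (z : C) : Re (- z)%C = - Re z. Proof. reflexivity. Qed.
Lemma Im_opp (z : C) : Im (- z)%C = - Im z. Proof. reflexivity. Qed.
Lemma Re_minus (z w : C) : Re (z - w)%C = Re z - Re w. Proof. reflexivity. Qed.
Lemma Im_minus (z w : C) : Im (z - w)%C = Im z - Im w. Proof. reflexivity. Qed.
Lemma Re_mult (z w : C) : Re (z * w)%C = Re z * Re w - Im z * Im w.
Proof. reflexivity. Qed.
Lemma Im_mult (z w : C) : Im (z * w)%C = Re z * Im w + Im z * Re w.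
Proof. reflexivity. Qed.
Lemma Re_conj (z : C) : Re (Cconj z) = Re z. Proof. reflexivity. Qed.
Lemma Im_conj (z : C) : Im (Cconj z) = - Im z. Proof. reflexivity. Qed.
Lemma Re_RtoC (x : R) : Re (RtoC x) = x. Proof. reflexivity. Qed.
Lemma Im_RtoC (x : R) : Im (RtoC x) = 0. Proof. reflexivity. Qed.
Lemma Re_Ci : Re Ci = 0. Proof. reflexivity. Qed.
Lemma Im_Ci : Im Ci = 1. Proof. reflexivity. Qed.
Lemma Re_pair (x y : R) : Re (x, y) = x. Proof. reflexivity. Qed.
Lemma Im_pair (x y : R) : Im (x, y) = y. Proof. reflexivity. Qed.

#[local] Hint Rewrite Re_plus Im_plus Re_minus Im_minus Re_opp Im_opp Re_mult Im_mult
  Re_conj Im_conj Re_RtoC Im_RtoC Re_Ci Im_Ci Re_pair Im_pair : csimp.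

Ltac Csimp := autorewrite with csimp.

Lemma Cmod_minus_sym (z w : C) : Cmod (z - w)%C = Cmod (w - z)%C.
Proof. rewrite <- Cmod_opp. f_equal. ring. Qed.

Lemma Cmod_minus_triangle (x y z : C) :
  Cmod (x - z)%C <= Cmod (x - y)%C + Cmod (y - z)%C.
Proof. replace (x - z)%C with ((x - y) + (y - z))%C by ring. apply Cmod_triangle. Qed.

Lemma Cmod_rev_triangle (z w : C) : Cmod z - Cmod w <= Cmod (z - w)%C.
Proof.
  assert (H := Cmod_triangle (z - w)%C w).
  replace (z - w + w)%C with z in H by ring. lra.
Qed.

Lemma im_le_Cmod (c : C) : Rabs (Im c) <= Cmod c.
Proof. apply Rle_trans with (2 := Rmax_Cmod c). apply Rmax_r. Qed.

Lemma Cmod_le_Re_Im (c : C) : Cmod c <= Rabs (Re c) + Rabs (Im c).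
Proof.
  replace c with (RtoC (Re c) + Ci * RtoC (Im c))%C at 1
    by (apply C_eq; Csimp; ring).
  eapply Rle_trans; [apply Cmod_triangle|].
  rewrite Cmod_mult, Cmod_Ci, !Cmod_R. lra.
Qed.

Lemma Cmod_minus_eq_0 (z w : C) : Cmod (z - w)%C = 0 -> z = w.
Proof.
  intros H. apply Cmod_eq_0 in H. replace z with ((z - w) + w)%C by ring.
  rewrite H. ring.
Qed.

(** * Limits of complex functions *)

(** The value at [z] is left out, so that one notion serves for difference quotients and for
    functions that matter only off the puncture. *)
Definition limC (F : C -> C) (z l : C) : Prop :=
  forall e, 0 < e -> exists d, 0 < d /\
    forall w, 0 < Cmod (w - z)%C < d -> Cmod (F w - l)%C < e.

Definition contC (F : C -> C) (z : C) : Prop := limC F z (F z).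

Lemma limC_ext (F G : C -> C) (z l : C) (d : R) :
  0 < d -> (forall w, 0 < Cmod (w - z)%C < d -> F w = G w) ->
  limC F z l -> limC G z l.
Proof.
  intros Hd HE HF e He. destruct (HF e He) as [d' [Hd' H]].
  exists (Rmin d d'). split; [now apply Rmin_pos|].
  intros w Hw. rewrite <- HE.
  - apply H. split; [apply Hw|]. eapply Rlt_le_trans; [apply Hw|apply Rmin_r].
  - split; [apply Hw|]. eapply Rlt_le_trans; [apply Hw|apply Rmin_l].
Qed.

Lemma limC_unique (F : C -> C) (z l l' : C) : limC F z l -> limC F z l' -> l = l'.
Proof.
  intros H H'. apply Cmod_minus_eq_0.
  destruct (Req_dec (Cmod (l - l')%C) 0) as [E|E]; [exact E|exfalso].
  assert (P : 0 < Cmod (l - l')%C / 2) by (assert (Q := Cmod_ge_0 (l - l')%C); lra).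
  destruct (H _ P) as [d [Hd H1]]. destruct (H' _ P) as [d' [Hd' H2]].
  set (w := (z + RtoC (Rmin d d' / 2))%C).
  assert (Hm : 0 < Rmin d d') by now apply Rmin_pos.
  assert (Hw : Cmod (w - z)%C = Rmin d d' / 2).
  { replace (w - z)%C with (RtoC (Rmin d d' / 2)) by (unfold w; ring).
    rewrite Cmod_R. apply Rabs_pos_eq. lra. }
  assert (A1 := Rmin_l d d'). assert (A2 := Rmin_r d d').
  assert (B1 := H1 w). assert (B2 := H2 w). rewrite Hw in B1, B2.
  specialize (B1 ltac:(lra)). specialize (B2 ltac:(lra)).
  assert (T := Cmod_minus_triangle l (F w) l'). rewrite (Cmod_minus_sym l (F w)) in T. lra.
Qed.

Lemma limC_const (c z : C) : limC (fun _ => c) z c.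
Proof.
  intros e He. exists 1. split; [lra|]. intros w _.
  replace (c - c)%C with (RtoC 0) by ring. now rewrite Cmod_0.
Qed.

Lemma limC_id (z : C) : limC (fun w => w) z z.
Proof. intros e He. exists e. split; [lra|]. intros w H. apply H. Qed.

Lemma limC_plus (F G : C -> C) (z l m : C) :
  limC F z l -> limC G z m -> limC (fun w => F w + G w)%C z (l + m)%C.
Proof.
  intros HF HG e He.
  destruct (HF (e / 2) ltac:(lra)) as [d [Hd H]].
  destruct (HG (e / 2) ltac:(lra)) as [d' [Hd' H']].
  exists (Rmin d d'). split; [now apply Rmin_pos|]. intros w Hw.
  assert (A1 := Rmin_l d d'). assert (A2 := Rmin_r d d').
  replace (F w + G w - (l + m))%C with ((F w - l) + (G w - m))%C by ring.
  eapply Rle_lt_trans; [apply Cmod_triangle|].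
  assert (B1 := H w ltac:(split; lra)). assert (B2 := H' w ltac:(split; lra)). lra.
Qed.

Lemma limC_bounded (F : C -> C) (z l : C) :
  limC F z l -> exists d, 0 < d /\
    forall w, 0 < Cmod (w - z)%C < d -> Cmod (F w) < Cmod l + 1.
Proof.
  intros H. destruct (H 1 Rlt_0_1) as [d [Hd H']]. exists d. split; [exact Hd|].
  intros w Hw. assert (B := H' w Hw). assert (T := Cmod_rev_triangle (F w) l). lra.
Qed.

Lemma limC_0_mult_bounded (F G : C -> C) (z : C) (M d : R) :
  0 < d -> (forall w, 0 < Cmod (w - z)%C < d -> Cmod (G w) <= M) ->
  limC F z 0 -> limC (fun w => F w * G w)%C z 0.
Proof.
  intros Hd HG HF e He.
  assert (HM : 0 < Rabs M + 1) by (assert (Q := Rabs_pos M); lra).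
  destruct (HF (e / (Rabs M + 1)) ltac:(now apply Rdiv_lt_0_compat)) as [d' [Hd' H]].
  exists (Rmin d d'). split; [now apply Rmin_pos|]. intros w Hw.
  assert (A1 := Rmin_l d d'). assert (A2 := Rmin_r d d').
  assert (B1 := H w ltac:(split; lra)). assert (B2 := HG w ltac:(split; lra)).
  replace (F w - 0)%C with (F w) in B1 by ring.
  replace (F w * G w - 0)%C with (F w * G w)%C by ring. rewrite Cmod_mult.
  assert (Cmod (G w) <= Rabs M + 1) by (assert (Q := Rle_abs M); lra).
  assert (P1 := Cmod_ge_0 (F w)). assert (P2 := Cmod_ge_0 (G w)).
  apply Rle_lt_trans with (Cmod (F w) * (Rabs M + 1)).
  - apply Rmult_le_compat_l; assumption.
  - apply Rlt_le_trans with (e / (Rabs M + 1) * (Rabs M + 1)).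
    + now apply Rmult_lt_compat_r.
    + right. field. lra.
Qed.

Lemma limC_0_minus (F : C -> C) (z l : C) :
  limC F z l <-> limC (fun w => F w - l)%C z 0.
Proof.
  split; intros H e He; destruct (H e He) as [d [Hd H']]; exists d; (split; [exact Hd|]);
  intros w Hw; specialize (H' w Hw).
  - now replace (F w - l - 0)%C with (F w - l)%C by ring.
  - now replace (F w - l - 0)%C with (F w - l)%C in H' by ring.
Qed.

Lemma limC_mult (F G : C -> C) (z l m : C) :
  limC F z l -> limC G z m -> limC (fun w => F w * G w)%C z (l * m)%C.
Proof.
  intros HF HG. destruct (limC_bounded _ _ _ HG) as [d [Hd HB]].
  assert (HF0 := proj1 (limC_0_minus _ _ _) HF).
  assert (HG0 := proj1 (limC_0_minus _ _ _) HG).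
  assert (H1 := limC_0_mult_bounded _ G z _ d Hd (fun w Hw => Rlt_le _ _ (HB w Hw)) HF0).
  assert (H2 := limC_0_mult_bounded _ (fun _ => l) z (Cmod l) 1 Rlt_0_1
                 (fun w _ => Rle_refl _) HG0).
  apply limC_0_minus.
  assert (H3 := limC_plus _ _ _ _ _ H1 H2).
  replace (0 + 0)%C with (RtoC 0) in H3 by ring.
  eapply limC_ext; [apply Rlt_0_1| |exact H3]. intros w _; simpl. ring.
Qed.

Lemma limC_opp (F : C -> C) (z l : C) : limC F z l -> limC (fun w => - F w)%C z (- l)%C.
Proof.
  intros H e He. destruct (H e He) as [d [Hd H']]. exists d. split; [exact Hd|].
  intros w Hw. replace (- F w - - l)%C with (- (F w - l))%C by ring.
  rewrite Cmod_opp. now apply H'.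
Qed.

Lemma limC_minus (F G : C -> C) (z l m : C) :
  limC F z l -> limC G z m -> limC (fun w => F w - G w)%C z (l - m)%C.
Proof. intros H1 H2. apply limC_plus; [exact H1|now apply limC_opp]. Qed.

Lemma limC_conj (F : C -> C) (z l : C) :
  limC F z l -> limC (fun w => Cconj (F w)) z (Cconj l).
Proof.
  intros H e He. destruct (H e He) as [d [Hd H']]. exists d. split; [exact Hd|].
  intros w Hw. replace (Cconj (F w) - Cconj l)%C with (Cconj (F w - l)%C)
    by (apply C_eq; Csimp; ring).
  rewrite Cmod_conj. now apply H'.
Qed.

Lemma limC_apart (F : C -> C) (z l : C) : limC F z l -> l <> 0 ->
  exists d, 0 < d /\ forall w, 0 < Cmod (w - z)%C < d -> Cmod l / 2 < Cmod (F w).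
Proof.
  intros H Hl. assert (Pl : 0 < Cmod l) by now apply Cmod_gt_0.
  destruct (H (Cmod l / 2) ltac:(lra)) as [d [Hd H']]. exists d. split; [exact Hd|].
  intros w Hw. specialize (H' w Hw). rewrite Cmod_minus_sym in H'.
  assert (T := Cmod_rev_triangle l (F w)). lra.
Qed.

Lemma limC_inv (F : C -> C) (z l : C) :
  limC F z l -> l <> 0 -> limC (fun w => / F w)%C z (/ l)%C.
Proof.
  intros H Hl. destruct (limC_apart _ _ _ H Hl) as [d [Hd HA]].
  assert (Pl : 0 < Cmod l) by now apply Cmod_gt_0.
  apply limC_0_minus.
  assert (H0 := limC_opp _ _ _ (proj1 (limC_0_minus _ _ _) H)).
  replace (- 0)%C with (RtoC 0) in H0 by ring.
  assert (NZ : forall w, 0 < Cmod (w - z)%C < d -> F w <> 0).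
  { intros w Hw. apply Cmod_gt_0. specialize (HA w Hw). lra. }
  apply limC_ext with (d := d)
    (F := fun w => (- (F w - l) * (/ F w * / l))%C); [exact Hd| |].
  - intros w Hw. field. split; [exact Hl|now apply NZ].
  - apply limC_0_mult_bounded with (M := 2 / Cmod l * / Cmod l) (d := d); [exact Hd| |exact H0].
    intros w Hw. specialize (HA w Hw). rewrite Cmod_mult, !Cmod_inv; auto.
    apply Rmult_le_compat_r; [left; now apply Rinv_0_lt_compat|].
    unfold Rdiv. replace (2 * / Cmod l) with (/ (Cmod l / 2)) by (field; lra).
    apply Rinv_le_contravar; lra.
Qed.

Lemma limC_div (F G : C -> C) (z l m : C) :
  limC F z l -> limC G z m -> m <> 0 -> limC (fun w => F w / G w)%C z (l / m)%C.
Proof. intros. apply limC_mult; [assumption|now apply limC_inv]. Qed.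

Lemma limC_Cmod_le (F G : C -> C) (z : C) (d M : R) :
  0 < d -> (forall w, 0 < Cmod (w - z)%C < d -> Cmod (F w) <= M * Cmod (G w)) ->
  limC G z 0 -> limC F z 0.
Proof.
  intros Hd HF HG e He.
  assert (HM : 0 < Rabs M + 1) by (assert (Q := Rabs_pos M); lra).
  destruct (HG (e / (Rabs M + 1)) ltac:(now apply Rdiv_lt_0_compat)) as [d' [Hd' H]].
  exists (Rmin d d'). split; [now apply Rmin_pos|]. intros w Hw.
  assert (A1 := Rmin_l d d'). assert (A2 := Rmin_r d d').
  assert (B1 := H w ltac:(split; lra)). assert (B2 := HF w ltac:(split; lra)).
  replace (G w - 0)%C with (G w) in B1 by ring.
  replace (F w - 0)%C with (F w) by ring.
  assert (P1 := Cmod_ge_0 (G w)).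
  assert (M * Cmod (G w) <= (Rabs M + 1) * Cmod (G w)).
  { apply Rmult_le_compat_r; [exact P1|]. assert (Q := Rle_abs M); lra. }
  assert ((Rabs M + 1) * Cmod (G w) < (Rabs M + 1) * (e / (Rabs M + 1)))
    by now apply Rmult_lt_compat_l.
  replace ((Rabs M + 1) * (e / (Rabs M + 1))) with e in H1 by (field; lra). lra.
Qed.

Lemma limC_Re (F : C -> C) (z l : C) :
  limC F z l -> limC (fun w => RtoC (Re (F w))) z (RtoC (Re l)).
Proof.
  intros H e He. destruct (H e He) as [d [Hd H']]. exists d. split; [exact Hd|].
  intros w Hw. rewrite <- RtoC_minus, Cmod_R.
  eapply Rle_lt_trans; [apply (re_le_Cmod (F w - l)%C)|]. now apply H'.
Qed.

Lemma limC_real_comp (f : R -> R) (F : C -> R) (z : C) (l : R) :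
  limC (fun w => RtoC (F w)) z (RtoC l) -> continuity_pt f l ->
  limC (fun w => RtoC (f (F w))) z (RtoC (f l)).
Proof.
  intros H Hf e He. destruct (Hf e He) as [a [Ha Hf']].
  destruct (H a Ha) as [d [Hd H']]. exists d. split; [exact Hd|].
  intros w Hw. specialize (H' w Hw).
  rewrite <- RtoC_minus, Cmod_R in *.
  destruct (Req_dec (F w) l) as [->|N].
  - unfold Rminus. rewrite Rplus_opp_r, Rabs_R0. exact He.
  - apply (Hf' (F w)). split; [|exact H']. split; [exact I|congruence].
Qed.

Lemma limC_Cmod (F : C -> C) (z l : C) :
  limC F z l -> limC (fun w => RtoC (Cmod (F w))) z (RtoC (Cmod l)).
Proof.
  intros H e He. destruct (H e He) as [d [Hd H']]. exists d. split; [exact Hd|].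
  intros w Hw. specialize (H' w Hw). rewrite <- RtoC_minus, Cmod_R.
  eapply Rle_lt_trans; [|exact H'].
  assert (T1 := Cmod_rev_triangle (F w) l). assert (T2 := Cmod_rev_triangle l (F w)).
  rewrite (Cmod_minus_sym l) in T2. apply Rabs_le. lra.
Qed.

Lemma contC_ball (F : C -> C) (z : C) (e : R) :
  contC F z -> 0 < e -> exists d, 0 < d /\
    forall w, Cmod (w - z)%C < d -> Cmod (F w - F z)%C < e.
Proof.
  intros H He. destruct (H e He) as [d [Hd H']]. exists d. split; [exact Hd|].
  intros w Hw. destruct (Req_dec (Cmod (w - z)%C) 0) as [E|E].
  - apply Cmod_minus_eq_0 in E. subst w.
    replace (F z - F z)%C with (RtoC 0) by ring. now rewrite Cmod_0.
  - apply H'. assert (Q := Cmod_ge_0 (w - z)%C). lra.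
Qed.

Lemma contC_comp (F G : C -> C) (z : C) :
  contC G z -> contC F (G z) -> contC (fun w => F (G w)) z.
Proof.
  intros HG HF e He. destruct (contC_ball _ _ _ HF He) as [d [Hd H]].
  destruct (contC_ball _ _ _ HG Hd) as [d' [Hd' H']]. exists d'.
  split; [exact Hd'|]. intros w Hw. apply H, H', Hw.
Qed.

Lemma contC_const (c z : C) : contC (fun _ => c) z.
Proof. apply limC_const. Qed.

Lemma contC_ext (F G : C -> C) (z : C) (d : R) :
  0 < d -> (forall w, Cmod (w - z)%C < d -> F w = G w) -> contC F z -> contC G z.
Proof.
  intros Hd HE H. unfold contC. rewrite <- HE.
  - apply limC_ext with (F := F) (d := d); auto. intros w Hw. apply HE, Hw.
  - replace (z - z)%C with (RtoC 0) by ring. now rewrite Cmod_0.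
Qed.

Lemma contC_2d (F : C -> C) (z : C) : contC F z ->
  continuity_2d_pt (fun x y => Re (F (x, y))) (Re z) (Im z) /\
  continuity_2d_pt (fun x y => Im (F (x, y))) (Re z) (Im z).
Proof.
  intros H; split; intros e; destruct (contC_ball _ _ _ H (cond_pos e)) as [d [Hd H']];
  assert (Hd2 : 0 < d / 2) by lra; exists (mkposreal _ Hd2); simpl; intros u v Hu Hv.
  all: assert (B : Cmod (F (u, v) - F z)%C < e)
   by (apply H'; eapply Rle_lt_trans; [apply Cmod_le_Re_Im|];
       change (Rabs (u - Re z) + Rabs (v - Im z) < d); lra).
  all: replace (F (Re z, Im z)) with (F z) by (f_equal; apply C_eq; reflexivity).
  - eapply Rle_lt_trans; [apply (re_le_Cmod (F (u, v) - F z)%C)|exact B].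
  - eapply Rle_lt_trans; [apply (im_le_Cmod (F (u, v) - F z)%C)|exact B].
Qed.

Lemma contC_of_2d (F : C -> R) (z : C) :
  continuity_2d_pt (fun x y => F (x, y)) (Re z) (Im z) ->
  contC (fun w => RtoC (F w)) z.
Proof.
  intros H e He. destruct (H (mkposreal e He)) as [d H']. exists d.
  split; [apply cond_pos|]. intros w Hw. rewrite <- RtoC_minus, Cmod_R.
  specialize (H' (Re w) (Im w)). simpl in H'.
  replace (F w) with (F (Re w, Im w)) by (f_equal; apply C_eq; reflexivity).
  replace (F z) with (F (Re z, Im z)) by (f_equal; apply C_eq; reflexivity).
  apply H'.
  - eapply Rle_lt_trans; [apply (re_le_Cmod (w - z)%C)|apply Hw].
  - eapply Rle_lt_trans; [apply (im_le_Cmod (w - z)%C)|apply Hw].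
Qed.

Lemma contC_pair (F G : C -> R) (z : C) :
  contC (fun w => RtoC (F w)) z -> contC (fun w => RtoC (G w)) z ->
  contC (fun w => (F w, G w)) z.
Proof.
  intros HF HG.
  apply contC_ext with (d := 1) (F := fun w => (RtoC (F w) + Ci * RtoC (G w))%C); [lra| |].
  - intros w _. apply C_eq; Csimp; ring.
  - apply limC_plus; [exact HF|]. apply limC_mult; [apply limC_const|exact HG].
Qed.

(** * Complex and real derivatives *)

Definition cdiff (F : C -> C) (z l : C) : Prop :=
  limC (fun w => (F w - F z) / (w - z))%C z l.

Definition rdiff (h : C -> R) (z : C) (a b : R) : Prop :=
  differentiable_pt_lim (fun x y => h (x, y)) (Re z) (Im z) a b.

Definition pdiff (gam : R -> C) (t : R) (l : C) : Prop :=
  is_derive (fun s => Re (gam s)) t (Re l) /\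
  is_derive (fun s => Im (gam s)) t (Im l).

Lemma Cmod_gt_0_neq (z w : C) : 0 < Cmod (w - z)%C -> (w - z)%C <> 0.
Proof. apply Cmod_gt_0. Qed.

Lemma cdiff_eq (F : C -> C) (z l m : C) : cdiff F z l -> l = m -> cdiff F z m.
Proof. intros H <-; exact H. Qed.

Lemma cdiff_ext (F G : C -> C) (z l : C) (d : R) :
  0 < d -> (forall w, Cmod (w - z)%C < d -> F w = G w) -> cdiff F z l -> cdiff G z l.
Proof.
  intros Hd HE. apply limC_ext with (1 := Hd). intros w Hw.
  rewrite HE by apply Hw. rewrite (HE z); [reflexivity|].
  replace (z - z)%C with (RtoC 0) by ring. now rewrite Cmod_0.
Qed.

Lemma cdiff_contC (F : C -> C) (z l : C) : cdiff F z l -> contC F z.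
Proof.
  intros H.
  assert (H1 := limC_mult _ _ _ _ _ H (limC_minus _ _ _ _ _ (limC_id z) (limC_const z z))).
  assert (H2 := limC_plus _ _ _ _ _ H1 (limC_const (F z) z)).
  replace (l * (z - z) + F z)%C with (F z) in H2 by ring.
  eapply limC_ext; [apply Rlt_0_1| |exact H2]. intros w Hw; simpl. field.
  now apply Cmod_gt_0_neq.
Qed.

Lemma cdiff_const (c z : C) : cdiff (fun _ => c) z 0.
Proof.
  eapply limC_ext; [apply Rlt_0_1| |apply (limC_const 0 z)].
  intros w Hw; simpl. field. now apply Cmod_gt_0_neq.
Qed.

Lemma cdiff_id (z : C) : cdiff (fun w => w) z 1.
Proof.
  eapply limC_ext; [apply Rlt_0_1| |apply (limC_const 1 z)].
  intros w Hw; simpl. field. now apply Cmod_gt_0_neq.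
Qed.

Lemma cdiff_plus (F G : C -> C) (z l m : C) :
  cdiff F z l -> cdiff G z m -> cdiff (fun w => F w + G w)%C z (l + m)%C.
Proof.
  intros HF HG. eapply limC_ext; [apply Rlt_0_1| |apply (limC_plus _ _ _ _ _ HF HG)].
  intros w Hw; simpl. field. now apply Cmod_gt_0_neq.
Qed.

Lemma cdiff_mult (F G : C -> C) (z l m : C) :
  cdiff F z l -> cdiff G z m -> cdiff (fun w => F w * G w)%C z (l * G z + F z * m)%C.
Proof.
  intros HF HG.
  assert (H1 := limC_mult _ _ _ _ _ HF (cdiff_contC _ _ _ HG)).
  assert (H2 := limC_mult _ _ _ _ _ (limC_const (F z) z) HG).
  eapply limC_ext; [apply Rlt_0_1| |apply (limC_plus _ _ _ _ _ H1 H2)].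
  intros w Hw; simpl. field. now apply Cmod_gt_0_neq.
Qed.

Lemma cdiff_scal (F : C -> C) (c z l : C) :
  cdiff F z l -> cdiff (fun w => c * F w)%C z (c * l)%C.
Proof.
  intros H. eapply cdiff_eq; [apply cdiff_mult; [apply cdiff_const|exact H]|]. cbv beta. ring.
Qed.

Lemma contC_neq_0 (F : C -> C) (z : C) : contC F z -> F z <> 0 ->
  exists d, 0 < d /\ forall w, Cmod (w - z)%C < d -> F w <> 0.
Proof.
  intros H Hz. assert (P : 0 < Cmod (F z)) by now apply Cmod_gt_0.
  destruct (contC_ball _ _ _ H P) as [d [Hd H']]. exists d. split; [exact Hd|].
  intros w Hw E. specialize (H' w Hw). rewrite E in H'.
  replace (0 - F z)%C with (- F z)%C in H' by ring. rewrite Cmod_opp in H'. lra.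
Qed.

Lemma cdiff_inv (F : C -> C) (z l : C) :
  cdiff F z l -> F z <> 0 -> cdiff (fun w => / F w)%C z (- l / (F z * F z))%C.
Proof.
  intros H Hz.
  destruct (contC_neq_0 _ _ (cdiff_contC _ _ _ H) Hz) as [d [Hd HN]].
  assert (H1 := limC_inv _ _ _ (cdiff_contC _ _ _ H) Hz).
  assert (H2 := limC_mult _ _ _ _ _ (limC_mult _ _ _ _ _ (limC_opp _ _ _ H) H1)
     (limC_const (/ F z)%C z)).
  replace (- l / (F z * F z))%C with (- l * / F z * / F z)%C by (field; exact Hz).
  eapply limC_ext; [exact Hd| |exact H2].
  intros w Hw; simpl. field. repeat split; auto; first [apply HN, Hw | now apply Cmod_gt_0_neq].
Qed.

Lemma cdiff_div (F G : C -> C) (z l m : C) :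
  cdiff F z l -> cdiff G z m -> G z <> 0 ->
  cdiff (fun w => F w / G w)%C z ((l * G z - F z * m) / (G z * G z))%C.
Proof.
  intros HF HG Hz.
  eapply cdiff_eq; [apply cdiff_mult; [exact HF|apply cdiff_inv; [exact HG|exact Hz]]|].
  cbv beta; field. exact Hz.
Qed.

Lemma cdiff_bound (F : C -> C) (z l : C) (e : R) : cdiff F z l -> 0 < e ->
  exists d, 0 < d /\ forall w, Cmod (w - z)%C < d ->
    Cmod (F w - F z - l * (w - z))%C <= e * Cmod (w - z)%C.
Proof.
  intros H He. destruct (H e He) as [d [Hd H']]. exists d. split; [exact Hd|].
  intros w Hw. destruct (Req_dec (Cmod (w - z)%C) 0) as [E|E].
  - rewrite E. apply Cmod_minus_eq_0 in E. subst w.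
    replace (F z - F z - l * (z - z))%C with (RtoC 0) by ring. rewrite Cmod_0. lra.
  - assert (P : 0 < Cmod (w - z)%C) by (assert (Q := Cmod_ge_0 (w - z)%C); lra).
    assert (N := Cmod_gt_0_neq _ _ P).
    replace (F w - F z - l * (w - z))%C
      with (((F w - F z) / (w - z) - l) * (w - z))%C by (field; exact N).
    rewrite Cmod_mult. apply Rmult_le_compat_r; [lra|]. left. apply H'. lra.
Qed.

Lemma cdiff_of_bound (F : C -> C) (z l : C) :
  (forall e, 0 < e -> exists d, 0 < d /\ forall w, Cmod (w - z)%C < d ->
    Cmod (F w - F z - l * (w - z))%C <= e * Cmod (w - z)%C) -> cdiff F z l.
Proof.
  intros H e He. destruct (H (e / 2) ltac:(lra)) as [d [Hd H']].
  exists d. split; [exact Hd|]. intros w Hw.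
  assert (N := Cmod_gt_0_neq _ _ (proj1 Hw)).
  replace ((F w - F z) / (w - z) - l)%C
    with ((F w - F z - l * (w - z)) * / (w - z))%C by (field; exact N).
  rewrite Cmod_mult, Cmod_inv by exact N.
  apply Rle_lt_trans with (e / 2 * Cmod (w - z)%C * / Cmod (w - z)%C).
  - apply Rmult_le_compat_r; [left; apply Rinv_0_lt_compat, Hw|]. apply H', Hw.
  - field_simplify; lra.
Qed.

(** Multiplication by [l] is the real matrix with rows [(Re l, - Im l)] and [(Im l, Re l)]: these
    are the Cauchy-Riemann equations. *)
Lemma cdiff_rdiff (F : C -> C) (z l : C) : cdiff F z l ->
  rdiff (fun w => Re (F w)) z (Re l) (- Im l) /\ rdiff (fun w => Im (F w)) z (Im l) (Re l).
Proof.
  intros H.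
  (* Real differentiability is measured in the maximum norm, and the modulus is at most [sqrt 2]
     times that norm. *)
  assert (S2 : 0 < sqrt 2) by (apply sqrt_lt_R0; lra).
  split; intros e;
  destruct (cdiff_bound _ _ _ (e / sqrt 2) H
     ltac:(apply Rdiv_lt_0_compat; [apply cond_pos|exact S2])) as [d [Hd H']];
  assert (Hd2 : 0 < d / 2) by lra; exists (mkposreal _ Hd2); simpl; intros u v Hu Hv.
  all: assert (B := H' (u, v)).
  all: assert (P : Cmod ((u, v) - z)%C < d)
   by (eapply Rle_lt_trans; [apply Cmod_le_Re_Im|];
       change (Rabs (u - Re z) + Rabs (v - Im z) < d); lra).
  all: specialize (B P).
  all: assert (M := Cmod_2Rmax ((u, v) - z)%C).
  all: change (fst ((u, v) - z)%C) with (u - Re z) in M;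
       change (snd ((u, v) - z)%C) with (v - Im z) in M.
  all: replace (F (Re z, Im z)) with (F z) by (f_equal; apply C_eq; reflexivity).
  all: apply Rle_trans with (e / sqrt 2 * Cmod ((u, v) - z)%C).
  all: try (apply Rle_trans with
     (e / sqrt 2 * (sqrt 2 * Rmax (Rabs (u - Re z)) (Rabs (v - Im z))));
     [apply Rmult_le_compat_l; [left; apply Rdiv_lt_0_compat; [apply cond_pos|exact S2]|exact M]
     |right; field; lra]).
  - eapply Rle_trans; [|exact B]. eapply Rle_trans; [|apply re_le_Cmod].
    right. f_equal. Csimp. ring.
  - eapply Rle_trans; [|exact B]. eapply Rle_trans; [|apply im_le_Cmod].
    right. f_equal. Csimp. ring.
Qed.

Lemma cdiff_of_rdiff (F : C -> C) (z l : C) :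
  rdiff (fun w => Re (F w)) z (Re l) (- Im l) -> rdiff (fun w => Im (F w)) z (Im l) (Re l) ->
  cdiff F z l.
Proof.
  intros H1 H2. apply cdiff_of_bound. intros e He.
  assert (He2 : 0 < e / 2) by lra.
  destruct (H1 (mkposreal _ He2)) as [d1 B1]. destruct (H2 (mkposreal _ He2)) as [d2 B2].
  exists (Rmin d1 d2). split; [apply Rmin_pos; apply cond_pos|]. intros w Hw.
  assert (A1 := Rmin_l d1 d2). assert (A2 := Rmin_r d1 d2).
  assert (R1 := re_le_Cmod (w - z)%C). assert (R2 := im_le_Cmod (w - z)%C).
  rewrite Re_minus in R1. rewrite Im_minus in R2.
  specialize (B1 (Re w) (Im w) ltac:(lra) ltac:(lra)).
  specialize (B2 (Re w) (Im w) ltac:(lra) ltac:(lra)). simpl in B1, B2.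
  replace (F (Re z, Im z)) with (F z) in B1, B2 by (f_equal; apply C_eq; reflexivity).
  replace (F (Re w, Im w)) with (F w) in B1, B2 by (f_equal; apply C_eq; reflexivity).
  assert (M := Rmax_Cmod (w - z)%C).
  change (fst (w - z)%C) with (Re w - Re z) in M;
  change (snd (w - z)%C) with (Im w - Im z) in M.
  eapply Rle_trans; [apply Cmod_le_Re_Im|].
  replace (Re (F w - F z - l * (w - z))%C) with
    (Re (F w) - Re (F z) - (Re l * (Re w - Re z) + - Im l * (Im w - Im z)))
    by (Csimp; ring).
  replace (Im (F w - F z - l * (w - z))%C) with
    (Im (F w) - Im (F z) - (Im l * (Re w - Re z) + Re l * (Im w - Im z)))
    by (Csimp; ring).
  apply (Rmult_le_compat_l (e / 2)) in M; lra.
Qed.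

Lemma rdiff_comp (h : C -> R) (gam : R -> C) (t a b : R) (m : C) :
  rdiff h (gam t) a b -> pdiff gam t m ->
  is_derive (fun s => h (gam s)) t (a * Re m + b * Im m).
Proof.
  intros H [H1 H2]. apply is_derive_Reals.
  apply is_derive_Reals in H1. apply is_derive_Reals in H2.
  assert (D := derivable_pt_lim_comp_2d (fun x y => h (x, y)) _ _ _ _ _ _ _ H H1 H2).
  simpl in D. eapply derivable_pt_lim_ext; [|exact D]. intros s; simpl.
  f_equal. apply C_eq; reflexivity.
Qed.

Lemma pdiff_comp (F : C -> C) (gam : R -> C) (t : R) (l m : C) :
  cdiff F (gam t) l -> pdiff gam t m -> pdiff (fun s => F (gam s)) t (l * m)%C.
Proof.
  intros H Hg. destruct (cdiff_rdiff _ _ _ H) as [H1 H2]. split.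
  - assert (D := rdiff_comp _ _ _ _ _ _ H1 Hg). simpl in D. eapply is_derive_ext; [reflexivity|].
    replace (Re (l * m)%C) with (Re l * Re m + - Im l * Im m) by (Csimp; ring). exact D.
  - assert (D := rdiff_comp _ _ _ _ _ _ H2 Hg). simpl in D.
    replace (Im (l * m)%C) with (Im l * Re m + Re l * Im m) by (Csimp; ring). exact D.
Qed.

Lemma pdiff_eq (gam : R -> C) (t : R) (l m : C) : pdiff gam t l -> l = m -> pdiff gam t m.
Proof. intros H <-; exact H. Qed.

Lemma pdiff_unique (gam : R -> C) (t : R) (l m : C) : pdiff gam t l -> pdiff gam t m -> l = m.
Proof.
  intros [H1 H2] [H3 H4]. apply C_eq.
  - rewrite <- (is_derive_unique _ _ _ H1). apply is_derive_unique, H3.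
  - rewrite <- (is_derive_unique _ _ _ H2). apply is_derive_unique, H4.
Qed.

Lemma pdiff_ext_loc (g1 g2 : R -> C) (t : R) (l : C) :
  locally t (fun s => g1 s = g2 s) -> pdiff g1 t l -> pdiff g2 t l.
Proof.
  intros H [H1 H2]. split.
  - apply (is_derive_ext_loc (fun s => Re (g1 s))); [|exact H1].
    eapply filter_imp; [|exact H]. intros s E; simpl in *; now rewrite E.
  - apply (is_derive_ext_loc (fun s => Im (g1 s))); [|exact H2].
    eapply filter_imp; [|exact H]. intros s E; simpl in *; now rewrite E.
Qed.

Lemma pdiff_const (c : C) (t : R) : pdiff (fun _ => c) t 0.
Proof. split; apply (is_derive_const (V := R_NormedModule)). Qed.

Lemma pdiff_RtoC (f : R -> R) (t l : R) : is_derive f t l -> pdiff (fun s => RtoC (f s)) t l.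
Proof. intros H; split; simpl; [exact H|apply (is_derive_const (V := R_NormedModule))]. Qed.

Lemma pdiff_plus (g1 g2 : R -> C) (t : R) (l m : C) :
  pdiff g1 t l -> pdiff g2 t m -> pdiff (fun s => g1 s + g2 s)%C t (l + m)%C.
Proof.
  intros [H1 H2] [H3 H4]. split.
  - exact (is_derive_plus _ _ _ _ _ H1 H3).
  - exact (is_derive_plus _ _ _ _ _ H2 H4).
Qed.

Lemma pdiff_opp (g1 : R -> C) (t : R) (l : C) :
  pdiff g1 t l -> pdiff (fun s => - g1 s)%C t (- l)%C.
Proof. intros [H1 H2]. split; [exact (is_derive_opp _ _ _ H1)|exact (is_derive_opp _ _ _ H2)]. Qed.

Lemma pdiff_minus (g1 g2 : R -> C) (t : R) (l m : C) :
  pdiff g1 t l -> pdiff g2 t m -> pdiff (fun s => g1 s - g2 s)%C t (l - m)%C.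
Proof. intros H1 H2. apply pdiff_plus; [exact H1|now apply pdiff_opp]. Qed.

Lemma pdiff_conj (g1 : R -> C) (t : R) (l : C) :
  pdiff g1 t l -> pdiff (fun s => Cconj (g1 s)) t (Cconj l).
Proof. intros [H1 H2]. split; [exact H1|exact (is_derive_opp _ _ _ H2)]. Qed.

Lemma is_derive_mult_R (f g : R -> R) (t a b : R) :
  is_derive f t a -> is_derive g t b ->
  is_derive (fun s => f s * g s) t (a * g t + f t * b).
Proof. intros H1 H2. exact (is_derive_mult f g t a b H1 H2 Rmult_comm). Qed.

Lemma pdiff_mult (g1 g2 : R -> C) (t : R) (l m : C) :
  pdiff g1 t l -> pdiff g2 t m ->
  pdiff (fun s => g1 s * g2 s)%C t (l * g2 t + g1 t * m)%C.
Proof.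
  intros [H1 H2] [H3 H4]. split.
  - replace (Re (l * g2 t + g1 t * m)%C) with
      ((Re l * Re (g2 t) + Re (g1 t) * Re m) - (Im l * Im (g2 t) + Im (g1 t) * Im m))
      by (Csimp; ring).
    exact (is_derive_minus _ _ _ _ _ (is_derive_mult_R _ _ _ _ _ H1 H3)
             (is_derive_mult_R _ _ _ _ _ H2 H4)).
  - replace (Im (l * g2 t + g1 t * m)%C) with
      ((Re l * Im (g2 t) + Re (g1 t) * Im m) + (Im l * Re (g2 t) + Im (g1 t) * Re m))
      by (Csimp; ring).
    exact (is_derive_plus _ _ _ _ _ (is_derive_mult_R _ _ _ _ _ H1 H4)
             (is_derive_mult_R _ _ _ _ _ H2 H3)).
Qed.

Lemma pdiff_inv (g1 : R -> C) (t : R) (l : C) :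
  pdiff g1 t l -> g1 t <> 0 -> pdiff (fun s => / g1 s)%C t (- l / (g1 t * g1 t))%C.
Proof.
  intros H N. eapply pdiff_eq.
  - apply (pdiff_comp Cinv g1 t); [|exact H].
    apply (cdiff_inv (fun w => w)); [apply cdiff_id|exact N].
  - field. exact N.
Qed.

Lemma pdiff_div (g1 g2 : R -> C) (t : R) (l m : C) :
  pdiff g1 t l -> pdiff g2 t m -> g2 t <> 0 ->
  pdiff (fun s => g1 s / g2 s)%C t ((l * g2 t - g1 t * m) / (g2 t * g2 t))%C.
Proof.
  intros H1 H2 N. eapply pdiff_eq; [apply pdiff_mult; [exact H1|now apply pdiff_inv; [exact H2|]]|].
  cbv beta; field. exact N.
Qed.

Lemma cdiff_is_derive (F : C -> C) (z l : C) :
  cdiff F z l <-> @is_derive C_AbsRing C_NormedModule F z l.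
Proof.
  split.
  - intros H. split; [apply is_linear_scal_l|].
    intros x Hx.
    apply (is_filter_lim_locally_unique (V := AbsRing_NormedModule C_AbsRing)) in Hx.
    subst x. intros e.
    destruct (cdiff_bound _ _ _ e H (cond_pos e)) as [d [Hd H']].
    exists (mkposreal d Hd). intros w Hw.
    change (Cmod (F w - F z - (w - z) * l)%C <= e * Cmod (w - z)%C).
    rewrite (Cmult_comm (w - z)%C). apply H'. exact Hw.
  - intros [_ H]. apply cdiff_of_bound. intros e He.
    specialize (H z (fun P HP => HP) (mkposreal e He)). destruct H as [d H].
    exists d. split; [apply cond_pos|]. intros w Hw.
    specialize (H w Hw).
    change (Cmod (F w - F z - (w - z) * l)%C <= e * Cmod (w - z)%C) in H.
    rewrite (Cmult_comm (w - z)%C) in H. exact H.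
Qed.

(** Continuity of [dF] is what differentiation under the integral sign and the fundamental theorem
    of calculus require in the proof of Cauchy's formula. *)
Definition hol (U : C -> Prop) (F dF : C -> C) : Prop :=
  forall z, U z -> cdiff F z (dF z) /\ contC dF z.

Definition openC (U : C -> Prop) : Prop :=
  forall z, U z -> exists d, 0 < d /\ forall w, Cmod (w - z)%C < d -> U w.

(** [F] is [2 dh/dz = h_x - i h_y]; its holomorphy encodes the harmonicity of [h]. *)
Definition harm (U : C -> Prop) (h : C -> R) (F : C -> C) : Prop :=
  (exists dF, hol U F dF) /\ forall z, U z -> rdiff h z (Re (F z)) (- Im (F z)).

Lemma hol_sub (U W : C -> Prop) (F dF : C -> C) :
  (forall z, W z -> U z) -> hol U F dF -> hol W F dF.
Proof. intros H H' z Hz. apply H', H, Hz. Qed.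

Lemma contC_plus (F G : C -> C) (z : C) :
  contC F z -> contC G z -> contC (fun w => F w + G w)%C z.
Proof. apply limC_plus. Qed.
Lemma contC_minus (F G : C -> C) (z : C) :
  contC F z -> contC G z -> contC (fun w => F w - G w)%C z.
Proof. apply limC_minus. Qed.
Lemma contC_mult (F G : C -> C) (z : C) :
  contC F z -> contC G z -> contC (fun w => F w * G w)%C z.
Proof. apply limC_mult. Qed.
Lemma contC_div (F G : C -> C) (z : C) :
  contC F z -> contC G z -> G z <> 0 -> contC (fun w => F w / G w)%C z.
Proof. apply limC_div. Qed.
Lemma contC_inv (F : C -> C) (z : C) :
  contC F z -> F z <> 0 -> contC (fun w => / F w)%C z.
Proof. apply limC_inv. Qed.
Lemma contC_Re (F : C -> C) (z : C) : contC F z -> contC (fun w => RtoC (Re (F w))) z.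
Proof. apply limC_Re. Qed.
Lemma contC_conj (F : C -> C) (z : C) : contC F z -> contC (fun w => Cconj (F w)) z.
Proof. apply limC_conj. Qed.

Lemma hol_plus (U : C -> Prop) (F dF G dG : C -> C) : hol U F dF -> hol U G dG ->
  hol U (fun z => F z + G z)%C (fun z => dF z + dG z)%C.
Proof.
  intros HF HG z Hz. destruct (HF z Hz), (HG z Hz).
  split; [now apply cdiff_plus|now apply contC_plus].
Qed.

Lemma hol_scal (U : C -> Prop) (c : C) (F dF : C -> C) : hol U F dF ->
  hol U (fun z => c * F z)%C (fun z => c * dF z)%C.
Proof.
  intros HF z Hz. destruct (HF z Hz).
  split; [now apply cdiff_scal|apply contC_mult; [apply contC_const|assumption]].
Qed.

Lemma hol_mult (U : C -> Prop) (F dF G dG : C -> C) : hol U F dF -> hol U G dG ->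
  hol U (fun z => F z * G z)%C (fun z => dF z * G z + F z * dG z)%C.
Proof.
  intros HF HG z Hz. destruct (HF z Hz) as [A1 A2], (HG z Hz) as [B1 B2].
  split; [now apply cdiff_mult|].
  apply contC_plus; apply contC_mult; try assumption; eapply cdiff_contC; eassumption.
Qed.

Lemma hol_div (U : C -> Prop) (F dF G dG : C -> C) : hol U F dF -> hol U G dG ->
  (forall z, U z -> G z <> 0) ->
  hol U (fun z => F z / G z)%C (fun z => (dF z * G z - F z * dG z) / (G z * G z))%C.
Proof.
  intros HF HG HN z Hz. destruct (HF z Hz) as [A1 A2], (HG z Hz) as [B1 B2].
  split; [now apply cdiff_div; [| |apply HN]|].
  assert (CF := cdiff_contC _ _ _ A1). assert (CG := cdiff_contC _ _ _ B1).
  apply contC_div.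
  - apply contC_minus; now apply contC_mult.
  - now apply contC_mult.
  - intros E. apply (HN z Hz). assert (E' := f_equal Cmod E).
    rewrite Cmod_mult, Cmod_0 in E'. apply Cmod_eq_0. nra.
Qed.

Lemma hol_id (U : C -> Prop) : hol U (fun z => z) (fun _ => RtoC 1).
Proof. intros z _. split; [apply cdiff_id|apply contC_const]. Qed.

Lemma hol_const (U : C -> Prop) (c : C) : hol U (fun z => c) (fun _ => RtoC 0).
Proof. intros z _. split; [apply cdiff_const|apply contC_const]. Qed.

(** * Cauchy's formula *)

Definition CInt (F : R -> C) : C :=
  (RInt (fun t => Re (F t)) 0 (2 * PI), RInt (fun t => Im (F t)) 0 (2 * PI)).

Definition ccont (F : R -> C) : Prop :=
  forall t, continuous (fun s => Re (F s)) t /\ continuous (fun s => Im (F s)) t.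

Definition jcont (K : R -> R -> C) (s t : R) : Prop :=
  contC (fun p => K (Re p) (Im p)) (s, t).

Lemma jcont_2d (K : R -> R -> C) (s t : R) : jcont K s t ->
  continuity_2d_pt (fun x y => Re (K x y)) s t /\
  continuity_2d_pt (fun x y => Im (K x y)) s t.
Proof. intros H. exact (contC_2d _ _ H). Qed.

Lemma continuity_2d_section (f : R -> R -> R) (s t : R) :
  continuity_2d_pt f s t -> continuous (f s) t.
Proof.
  intros H. apply filterlim_locally. intros e. destruct (H e) as [d H'].
  exists d. intros y Hy. apply H'; [|exact Hy].
  unfold Rminus. rewrite Rplus_opp_r, Rabs_R0. apply cond_pos.
Qed.

Lemma jcont_ccont (K : R -> R -> C) (s : R) : (forall t, jcont K s t) -> ccont (K s).
Proof.
  intros H t. destruct (jcont_2d _ _ _ (H t)) as [H1 H2].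
  split.
  - exact (continuity_2d_section (fun x y => Re (K x y)) s t H1).
  - exact (continuity_2d_section (fun x y => Im (K x y)) s t H2).
Qed.

Lemma two_PI_pos : 0 < 2 * PI.
Proof. assert (H := PI_RGT_0). lra. Qed.

Lemma ccont_ex_RInt (F : R -> C) (a b : R) : ccont F ->
  ex_RInt (fun t => Re (F t)) a b /\ ex_RInt (fun t => Im (F t)) a b.
Proof.
  intros H. split; apply (ex_RInt_continuous (V := R_CompleteNormedModule));
  intros z _; destruct (H z); assumption.
Qed.

Lemma CInt_ext (F G : R -> C) : (forall t, F t = G t) -> CInt F = CInt G.
Proof. intros H. unfold CInt. f_equal; apply RInt_ext; intros x _; now rewrite H. Qed.

Lemma CInt_plus (F G : R -> C) : ccont F -> ccont G ->
  CInt (fun t => F t + G t)%C = (CInt F + CInt G)%C.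
Proof.
  intros HF HG. destruct (ccont_ex_RInt F 0 (2 * PI) HF), (ccont_ex_RInt G 0 (2 * PI) HG).
  apply C_eq; simpl.
  - exact (RInt_plus (V := R_CompleteNormedModule) _ _ _ _ H H1).
  - exact (RInt_plus (V := R_CompleteNormedModule) _ _ _ _ H0 H2).
Qed.

Lemma ccont_plus (F G : R -> C) : ccont F -> ccont G -> ccont (fun t => F t + G t)%C.
Proof.
  intros HF HG t. destruct (HF t), (HG t). split; simpl.
  - exact (continuous_plus (V := R_NormedModule) _ _ _ H H1).
  - exact (continuous_plus (V := R_NormedModule) _ _ _ H0 H2).
Qed.

Lemma ccont_const (c : C) : ccont (fun _ => c).
Proof. intros t; split; apply continuous_const. Qed.

Lemma ccont_ext (F G : R -> C) : (forall t, F t = G t) -> ccont F -> ccont G.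
Proof.
  intros H HF t. destruct (HF t) as [H1 H2].
  split.
  - apply (continuous_ext (fun s => Re (F s))); [intros s; now rewrite H|exact H1].
  - apply (continuous_ext (fun s => Im (F s))); [intros s; now rewrite H|exact H2].
Qed.

Lemma ccont_mult (F G : R -> C) : ccont F -> ccont G -> ccont (fun t => F t * G t)%C.
Proof.
  intros HF HG t. destruct (HF t), (HG t). split; simpl.
  - apply (continuous_minus (V := R_NormedModule));
    apply (continuous_mult (K := R_AbsRing)); assumption.
  - apply (continuous_plus (V := R_NormedModule));
    apply (continuous_mult (K := R_AbsRing)); assumption.
Qed.

Lemma RInt_lin (f g : R -> R) (a b x y : R) : ex_RInt f a b -> ex_RInt g a b ->
  RInt (fun t => x * f t + y * g t) a b = x * RInt f a b + y * RInt g a b.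
Proof.
  intros Hf Hg.
  assert (H1 := RInt_scal (V := R_CompleteNormedModule) f a b x Hf).
  assert (H2 := RInt_scal (V := R_CompleteNormedModule) g a b y Hg).
  assert (H3 := RInt_plus (V := R_CompleteNormedModule) (fun t => scal x (f t))
    (fun t => scal y (g t)) a b (ex_RInt_scal (V := R_NormedModule) _ _ _ _ Hf)
    (ex_RInt_scal (V := R_NormedModule) _ _ _ _ Hg)).
  etransitivity; [exact H3|]. exact (f_equal2 Rplus H1 H2).
Qed.

Lemma CInt_scal (F : R -> C) (c : C) : ccont F ->
  CInt (fun t => c * F t)%C = (c * CInt F)%C.
Proof.
  intros HF. destruct (ccont_ex_RInt F 0 (2 * PI) HF) as [H1 H2].
  apply C_eq; simpl.
  - replace (fst c * _ - _) with (Re c * RInt (fun t => Re (F t)) 0 (2 * PI)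
      + - Im c * RInt (fun t => Im (F t)) 0 (2 * PI)) by (unfold Re, Im; ring).
    rewrite <- RInt_lin by assumption. apply RInt_ext. intros x _. unfold Re, Im; simpl. ring.
  - rewrite (Rplus_comm (fst c * _)).
    rewrite <- RInt_lin by assumption. apply RInt_ext. intros x _. unfold Re, Im; simpl. ring.
Qed.

Lemma CInt_const (c : C) : CInt (fun _ => c) = (RtoC (2 * PI) * c)%C.
Proof.
  unfold CInt. rewrite !RInt_const. apply C_eq; Csimp; unfold scal; simpl;
  unfold mult; simpl; ring.
Qed.

(** Real and imaginary parts are estimated separately; this doubles the sharp constant [2 PI M],
    which is harmless below. *)
Lemma CInt_bound (F : R -> C) (M : R) : ccont F -> (forall t, Cmod (F t) <= M) ->
  Cmod (CInt F) <= 4 * PI * M.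
Proof.
  intros HF HM. destruct (ccont_ex_RInt F 0 (2 * PI) HF) as [H1 H2].
  assert (P := two_PI_pos).
  assert (B1 : Rabs (RInt (fun t => Re (F t)) 0 (2 * PI)) <= (2 * PI - 0) * M).
  { apply abs_RInt_le_const; [lra|exact H1|]. intros t _.
    eapply Rle_trans; [apply re_le_Cmod|apply HM]. }
  assert (B2 : Rabs (RInt (fun t => Im (F t)) 0 (2 * PI)) <= (2 * PI - 0) * M).
  { apply abs_RInt_le_const; [lra|exact H2|]. intros t _.
    eapply Rle_trans; [apply im_le_Cmod|apply HM]. }
  eapply Rle_trans; [apply Cmod_le_Re_Im|]. unfold CInt. Csimp. lra.
Qed.

Lemma CInt_derive (B K : R -> C) :
  (forall t, pdiff B t (K t)) -> ccont K -> B (2 * PI) = B 0 -> CInt K = 0.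
Proof.
  intros HB HK HP. unfold CInt.
  assert (H1 : is_RInt (fun t => Re (K t)) 0 (2 * PI) (Re (B (2 * PI)) - Re (B 0))).
  { apply (is_RInt_derive (V := R_CompleteNormedModule) (fun t => Re (B t))).
    - intros x _. destruct (HB x); assumption.
    - intros x _. destruct (HK x); assumption. }
  assert (H2 : is_RInt (fun t => Im (K t)) 0 (2 * PI) (Im (B (2 * PI)) - Im (B 0))).
  { apply (is_RInt_derive (V := R_CompleteNormedModule) (fun t => Im (B t))).
    - intros x _. destruct (HB x); assumption.
    - intros x _. destruct (HK x); assumption. }
  rewrite (is_RInt_unique _ _ _ _ H1), (is_RInt_unique _ _ _ _ H2), HP.
  apply C_eq; Csimp; ring.
Qed.

Lemma RInt_param (A K : R -> R -> R) (a b s : R) :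
  (forall s t, a < s < b -> is_derive (fun u => A u t) s (K s t)) ->
  (forall s t, a < s < b -> continuity_2d_pt K s t) ->
  (forall s t, a < s < b -> continuous (A s) t) ->
  a < s < b ->
  is_derive (fun u => RInt (A u) 0 (2 * PI)) s (RInt (K s) 0 (2 * PI)).
Proof.
  intros HA HK HC Hs.
  assert (HL : locally s (fun u => a < u < b)).
  { apply (locally_interval _ s a b); simpl; try tauto. }
  assert (HD : RInt (K s) 0 (2 * PI) = RInt (fun t => Derive (fun u => A u t) s) 0 (2 * PI)).
  { apply RInt_ext. intros t _. symmetry. apply is_derive_unique. now apply HA. }
  rewrite HD.
  apply (is_derive_RInt_param (fun u t => A u t)).
  - eapply filter_imp; [|exact HL]. intros u Hu t _. exists (K u t). now apply HA.
  - intros t _. apply (continuity_2d_pt_ext_loc K).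
    + destruct HL as [d Hd]. exists d. intros u v Hu _. symmetry.
      apply is_derive_unique, HA, Hd, Hu.
    + now apply HK.
  - eapply filter_imp; [|exact HL]. intros u Hu.
    apply (ex_RInt_continuous (V := R_CompleteNormedModule)).
    intros z _. now apply HC.
Qed.

Lemma CInt_param (A K : R -> R -> C) (a b s : R) :
  (forall s t, a < s < b -> pdiff (fun u => A u t) s (K s t)) ->
  (forall s t, a < s < b -> jcont K s t) ->
  (forall s, a < s < b -> ccont (A s)) ->
  a < s < b ->
  pdiff (fun u => CInt (A u)) s (CInt (K s)).
Proof.
  intros HA HK HC Hs. split.
  - apply (RInt_param (fun s t => Re (A s t)) (fun s t => Re (K s t)) a b); auto.
    + intros u t Hu. destruct (HA u t Hu); assumption.
    + intros u t Hu. now apply jcont_2d, HK.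
    + intros u t Hu. destruct (HC u Hu t); assumption.
  - apply (RInt_param (fun s t => Im (A s t)) (fun s t => Im (K s t)) a b); auto.
    + intros u t Hu. destruct (HA u t Hu); assumption.
    + intros u t Hu. now apply jcont_2d, HK.
    + intros u t Hu. destruct (HC u Hu t); assumption.
Qed.

Lemma R_zero_derive (f : R -> R) (df : R -> R) (a b : R) :
  a < b -> (forall s, a <= s <= b -> is_derive f s (df s)) ->
  (forall s, a < s < b -> df s = 0) -> f b = f a.
Proof.
  intros Hab Hf H0.
  destruct (MVT_cor2 f df a b Hab) as [c [Hc Hc']].
  - intros c Hc. apply is_derive_Reals. now apply Hf.
  - rewrite H0 in Hc by exact Hc'. lra.
Qed.

(** The mechanism behind all the integral formulas below: an integral is carried along a homotopy
    whose velocity integrates to zero. The margins [a' < a] and [b < b'] make the derivative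
    two-sided at the ends. The vanishing is asked only for [a < s < b], since the mean value theorem
    needs no more and the primitives used may divide by [s]. *)
Lemma CInt_conserved (A K : R -> R -> C) (a' a b b' : R) :
  a' < a -> a < b -> b < b' ->
  (forall s t, a' < s < b' -> pdiff (fun u => A u t) s (K s t)) ->
  (forall s t, a' < s < b' -> jcont K s t) ->
  (forall s, a' < s < b' -> ccont (A s)) ->
  (forall s, a < s < b -> CInt (K s) = 0) ->
  CInt (A b) = CInt (A a).
Proof.
  intros H1 H2 H3 HA HK HC H0.
  assert (D := fun s Hs => CInt_param A K a' b' s HA HK HC Hs).
  apply C_eq.
  - apply (R_zero_derive (fun s => Re (CInt (A s))) (fun s => Re (CInt (K s)))); auto.
    + intros s Hs. assert (Hs2 : a' < s < b') by lra. destruct (D s Hs2) as [D1 D2]. assumption.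
    + intros s Hs. now rewrite H0.
  - apply (R_zero_derive (fun s => Im (CInt (A s))) (fun s => Im (CInt (K s)))); auto.
    + intros s Hs. assert (Hs2 : a' < s < b') by lra. destruct (D s Hs2) as [D1 D2]. assumption.
    + intros s Hs. now rewrite H0.
Qed.

(** * Integrals over circles *)

Definition cis (t : R) : C := (cos t, sin t).

Lemma Cmod_cis (t : R) : Cmod (cis t) = 1.
Proof.
  unfold Cmod, cis; simpl. replace (_ + _) with 1; [apply sqrt_1|].
  assert (H := sin2_cos2 t). unfold Rsqr in H. lra.
Qed.

Lemma cis_neq_0 (t : R) : cis t <> 0.
Proof. apply Cmod_gt_0. rewrite Cmod_cis. lra. Qed.

Lemma cis_period : cis (2 * PI) = cis 0.
Proof. unfold cis. now rewrite cos_2PI, sin_2PI, cos_0, sin_0. Qed.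

Lemma pdiff_cis (t : R) : pdiff cis t (Ci * cis t)%C.
Proof.
  split; Csimp; unfold cis; simpl.
  - replace (0 * cos t - 1 * sin t) with (- sin t) by ring. apply is_derive_cos.
  - replace (0 * sin t + 1 * cos t) with (cos t) by ring. apply is_derive_sin.
Qed.

Lemma pdiff_ccont (F dF : R -> C) : (forall t, pdiff F t (dF t)) -> ccont F.
Proof.
  intros H t. destruct (H t) as [H1 H2].
  split; apply (ex_derive_continuous (V := R_NormedModule)); eexists; eassumption.
Qed.

Lemma contC_fst_param (z : C) : contC (fun p => RtoC (Re p)) z.
Proof. apply contC_of_2d. apply continuity_2d_pt_id1. Qed.

Lemma contC_cis (z : C) : contC (fun p => cis (Im p)) z.
Proof.
  apply (contC_pair (fun p => cos (Im p)) (fun p => sin (Im p))); apply contC_of_2d; simpl;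
  apply continuity_1d_2d_pt_comp; try apply continuity_2d_pt_id2.
  - apply continuity_pt_filterlim, continuous_cos.
  - apply continuity_pt_filterlim, continuous_sin.
Qed.

Lemma Ci_neq_0 : Ci <> 0.
Proof. apply Cmod_gt_0. rewrite Cmod_Ci. lra. Qed.

(** Shrinking [m] to [s m] changes the integrand by a quantity exact in [t], and at [s = 0] the
    integrand is the constant 1. *)
Lemma CInt_kernel (m : C) (rho : R) : Cmod m < rho ->
  CInt (fun t => RtoC rho * cis t / (RtoC rho * cis t - m))%C = RtoC (2 * PI).
Proof.
  intros Hm. assert (P := Cmod_ge_0 m).
  (* Chosen so that [(1 + eta) |m| < rho] when [m] is nonzero: the denominators stay away from zero
     slightly beyond [s = 1]. *)
  set (eta := (rho - Cmod m) / rho).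
  assert (He : 0 < eta) by (unfold eta; apply Rdiv_lt_0_compat; lra).
  assert (NZ : forall s t, - eta < s < 1 + eta -> (RtoC rho * cis t - RtoC s * m)%C <> 0).
  { intros s t Hs. apply Cmod_gt_0.
    assert (T := Cmod_rev_triangle (RtoC rho * cis t)%C (RtoC s * m)%C).
    rewrite !Cmod_mult, !Cmod_R, Cmod_cis, (Rabs_pos_eq rho) in T by lra.
    assert (Rabs s <= 1 + eta) by (apply Rabs_le; lra).
    assert (Q := Rabs_pos s).
    assert (Rabs s * Cmod m < rho); [|lra].
    destruct (Req_dec (Cmod m) 0) as [E|E]; [rewrite E; lra|].
    assert (0 < Cmod m) by lra.
    assert (Rabs s < 1 + eta) by (apply Rabs_def1; lra).
    apply Rlt_le_trans with ((1 + eta) * Cmod m); [now apply Rmult_lt_compat_r|].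
    assert (E2 : eta * Cmod m <= rho - Cmod m); [|lra].
    unfold eta. apply Rmult_le_reg_r with rho; [lra|].
    replace ((rho - Cmod m) / rho * Cmod m * rho) with ((rho - Cmod m) * Cmod m)
      by (field; lra). nra. }
  assert (NZ2 : forall s t, - eta < s < 1 + eta ->
     ((RtoC rho * cis t - RtoC s * m) * (RtoC rho * cis t - RtoC s * m))%C <> 0).
  { intros s t Hs E. apply (NZ s t Hs). assert (E' := f_equal Cmod E).
    rewrite Cmod_mult, Cmod_0 in E'. apply Cmod_eq_0.
    set (q := Cmod _) in *. nra. }
  pose (A := fun s t => (RtoC rho * cis t / (RtoC rho * cis t - RtoC s * m))%C).
  pose (K := fun s t => (RtoC rho * cis t * m /
     ((RtoC rho * cis t - RtoC s * m) * (RtoC rho * cis t - RtoC s * m)))%C).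
  assert (JK : forall s t, - eta < s < 1 + eta -> jcont K s t).
  { intros s t Hs. unfold jcont, K. apply contC_div; [| |now apply NZ2].
    - repeat apply contC_mult; try apply contC_const; apply contC_cis.
    - apply contC_mult; apply contC_minus; apply contC_mult;
      first [apply contC_const|apply contC_cis|apply contC_fst_param]. }
  rewrite (CInt_ext _ (A 1)) by (intros t; unfold A; f_equal; f_equal; ring).
  transitivity (CInt (A 0)).
  - apply (CInt_conserved A K (- eta) 0 1 (1 + eta)); try lra.
    + intros s t Hs. unfold A, K.
      assert (D1 : pdiff (fun u => RtoC rho * cis t - RtoC u * m)%C s (- m)%C).
      { eapply pdiff_eq; [apply pdiff_minus; [apply pdiff_const|
          apply pdiff_mult; [apply (pdiff_RtoC (fun u => u)), (is_derive_id (K := R_AbsRing))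
                           |apply pdiff_const]]|].
        cbv beta. change (RtoC one) with (RtoC 1). ring. }
      eapply pdiff_eq; [apply pdiff_div; [apply pdiff_const|exact D1|now apply NZ]|].
      cbv beta. field. now apply NZ.
    + exact JK.
    + intros s Hs. apply (jcont_ccont A). intros t. unfold jcont, A.
      apply contC_div; [| |now apply NZ].
      * apply contC_mult; [apply contC_const|apply contC_cis].
      * apply contC_minus; apply contC_mult;
        first [apply contC_const|apply contC_cis|apply contC_fst_param].
    + intros s Hs.
      apply (CInt_derive (fun t => Ci * m / (RtoC rho * cis t - RtoC s * m))%C).
      * intros t. unfold K.
        eapply pdiff_eq; [apply pdiff_div; [apply pdiff_const
          |apply pdiff_minus; [apply pdiff_mult; [apply pdiff_const|apply pdiff_cis]
                             |apply pdiff_const] |apply NZ; lra]|].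
        cbv beta.
        replace (RtoC rho * cis t * m)%C with (- (Ci * Ci) * (RtoC rho * cis t * m))%C
          by (apply C_eq; Csimp; ring).
        field. apply NZ; lra.
      * apply jcont_ccont. intros t. apply JK. lra.
      * now rewrite cis_period.
  - rewrite (CInt_ext (A 0) (fun _ => RtoC 1)).
    + rewrite CInt_const. ring.
    + intros t. unfold A. field. split; [apply cis_neq_0|].
      intros E. apply RtoC_inj in E. lra.
Qed.

(* Replacing [zeta] by [z + s (zeta - z)] in [F] only, the integrand has an [s]-derivative
   that is exact in [t]; at [s = 0] the integral is [F z] times that of the kernel. *)
Theorem Cauchy_formula (U : C -> Prop) (F dF : C -> C) (z0 z : C) (rho r : R) :
  hol U F dF -> (forall w, Cmod (w - z0)%C < r -> U w) ->
  Cmod (z - z0)%C < rho -> rho < r ->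
  CInt (fun t => F (z0 + RtoC rho * cis t) *
                 (RtoC rho * cis t / (RtoC rho * cis t - (z - z0))))%C
  = (RtoC (2 * PI) * F z)%C.
Proof.
  intros HF HU Hz Hr. set (m := (z - z0)%C) in *.
  assert (P := Cmod_ge_0 m).
  (* For [s] up to [eta] outside the unit interval, [|1 - s| + |s| < 1 + 2 eta]; the moved point
     then stays within [rho (1 + 2 eta) = r] of the centre. *)
  set (eta := (r - rho) / (2 * rho)).
  assert (He : 0 < eta) by (unfold eta; apply Rdiv_lt_0_compat; lra).
  pose (pt := fun s t => (z + RtoC s * (RtoC rho * cis t - m))%C).
  assert (HP : forall s t, - eta < s < 1 + eta -> U (pt s t)).
  { intros s t Hs. apply HU. unfold pt.
    replace (z + RtoC s * (RtoC rho * cis t - m) - z0)%C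
      with (RtoC (1 - s) * m + RtoC s * (RtoC rho * cis t))%C
      by (unfold m; rewrite RtoC_minus; ring).
    eapply Rle_lt_trans; [apply Cmod_triangle|].
    rewrite !Cmod_mult, Cmod_cis, !Cmod_R, (Rabs_pos_eq rho) by lra.
    replace r with (rho + 2 * eta * rho) by (unfold eta; field; lra).
    unfold Rabs; destruct (Rcase_abs (1 - s)), (Rcase_abs s); nra. }
  assert (NZ : forall t, (RtoC rho * cis t - m)%C <> 0).
  { intros t. apply Cmod_gt_0.
    assert (T := Cmod_rev_triangle (RtoC rho * cis t)%C m).
    rewrite Cmod_mult, Cmod_cis, Cmod_R, (Rabs_pos_eq rho) in T by lra. lra. }
  pose (ker := fun t => (RtoC rho * cis t / (RtoC rho * cis t - m))%C).
  pose (A := fun s t => (F (pt s t) * ker t)%C).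
  pose (K := fun s t => (dF (pt s t) * (RtoC rho * cis t))%C).
  assert (Jpt : forall s t, contC (fun p => pt (Re p) (Im p)) (s, t)).
  { intros s t. unfold pt. apply contC_plus; [apply contC_const|].
    apply contC_mult; [apply contC_fst_param|]. apply contC_minus; [|apply contC_const].
    apply contC_mult; [apply contC_const|apply contC_cis]. }
  assert (JK : forall s t, - eta < s < 1 + eta -> jcont K s t).
  { intros s t Hs. unfold jcont, K. apply contC_mult.
    - apply (contC_comp dF (fun p => pt (Re p) (Im p))); [apply Jpt|].
      apply HF. exact (HP s t Hs).
    - apply contC_mult; [apply contC_const|apply contC_cis]. }
  assert (Jker : forall z, contC (fun p => ker (Im p)) z).
  { intros z1. unfold ker. apply contC_div; [| |apply NZ].
    - apply contC_mult; [apply contC_const|apply contC_cis].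
    - apply contC_minus; [apply contC_mult; [apply contC_const|apply contC_cis]
                         |apply contC_const]. }
  rewrite (CInt_ext _ (A 1)).
  2:{ intros t. unfold A, pt, ker. f_equal. f_equal. unfold m. ring. }
  transitivity (CInt (A 0)).
  - apply (CInt_conserved A K (- eta) 0 1 (1 + eta)); try lra.
    + intros s t Hs. unfold A, K.
      assert (D1 : pdiff (fun u => pt u t) s (RtoC rho * cis t - m)%C).
      { unfold pt. eapply pdiff_eq; [apply pdiff_plus; [apply pdiff_const|
          apply pdiff_mult; [apply (pdiff_RtoC (fun u => u)), (is_derive_id (K := R_AbsRing))
                           |apply pdiff_const]]|].
        cbv beta. change (RtoC one) with (RtoC 1). ring. }
      eapply pdiff_eq.
      * apply pdiff_mult; [|apply pdiff_const].
        apply (pdiff_comp F (fun u => pt u t)); [|exact D1].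
        apply HF. now apply HP.
      * cbv beta. unfold ker. field. apply NZ.
    + exact JK.
    + intros s Hs. apply (jcont_ccont A). intros t. unfold jcont, A.
      apply contC_mult; [|apply Jker].
      apply (contC_comp F (fun p => pt (Re p) (Im p))); [apply Jpt|].
      eapply cdiff_contC, HF. exact (HP s t Hs).
    + intros s Hs.
      assert (Ns : RtoC s <> 0) by (intros E; apply RtoC_inj in E; lra).
      (* The chain rule in [t] produces the factor [i s], so this primitive exists only for
         [s <> 0]. *)
      apply (CInt_derive (fun t => F (pt s t) / (Ci * RtoC s))%C).
      * intros t. unfold K.
        assert (D1 : pdiff (fun u => pt s u) t (RtoC s * (RtoC rho * (Ci * cis t)))%C).
        { unfold pt. eapply pdiff_eq; [apply pdiff_plus; [apply pdiff_const|
            apply pdiff_mult; [apply pdiff_const|apply pdiff_minus; [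
            apply pdiff_mult; [apply pdiff_const|apply pdiff_cis]|apply pdiff_const]]]|].
          cbv beta. ring. }
        eapply pdiff_eq; [apply pdiff_mult; [|apply pdiff_const]|].
        -- apply (pdiff_comp F (fun u => pt s u)); [|exact D1].
           apply HF. apply HP. lra.
        -- cbv beta. field. split; [exact Ns|apply Ci_neq_0].
      * apply jcont_ccont. intros t. apply JK. lra.
      * unfold pt. now rewrite cis_period.
  - rewrite (CInt_ext (A 0) (fun t => F z * ker t)%C).
    + rewrite CInt_scal by (apply (jcont_ccont (fun _ => ker) 0); intros t; apply Jker).
      unfold ker. rewrite CInt_kernel by exact Hz. ring.
    + intros t. unfold A. f_equal. f_equal. unfold pt. ring.
Qed.

(** * Gradient estimates and removable singularities *)

Lemma limC_Cmod_bound (F : C -> C) (z l : C) (d M : R) : 0 < d ->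
  (forall w, 0 < Cmod (w - z)%C < d -> Cmod (F w) <= M) -> limC F z l -> Cmod l <= M.
Proof.
  intros Hd HM HF. apply Rnot_lt_le. intros H.
  destruct (HF (Cmod l - M) ltac:(lra)) as [d' [Hd' H']].
  set (w := (z + RtoC (Rmin d d' / 2))%C).
  assert (Hm : 0 < Rmin d d') by now apply Rmin_pos.
  assert (Hw : Cmod (w - z)%C = Rmin d d' / 2).
  { replace (w - z)%C with (RtoC (Rmin d d' / 2)) by (unfold w; ring).
    rewrite Cmod_R. apply Rabs_pos_eq. lra. }
  assert (A1 := Rmin_l d d'). assert (A2 := Rmin_r d d').
  assert (B1 := HM w). assert (B2 := H' w). rewrite Hw in B1, B2.
  specialize (B1 ltac:(lra)). specialize (B2 ltac:(lra)).
  assert (T := Cmod_rev_triangle l (F w)). rewrite (Cmod_minus_sym l (F w)) in T. lra.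
Qed.

Lemma rho_cis_minus (rho : R) (m : C) (t : R) : Cmod m < rho ->
  rho - Cmod m <= Cmod (RtoC rho * cis t - m)%C.
Proof.
  intros H. assert (P := Cmod_ge_0 m).
  assert (T := Cmod_rev_triangle (RtoC rho * cis t)%C m).
  rewrite Cmod_mult, Cmod_cis, Cmod_R, (Rabs_pos_eq rho) in T by lra. lra.
Qed.

Lemma rho_cis_minus_neq_0 (rho : R) (m : C) (t : R) : Cmod m < rho ->
  (RtoC rho * cis t - m)%C <> 0.
Proof. intros H. apply Cmod_gt_0. assert (T := rho_cis_minus rho m t H). lra. Qed.

Lemma contC_circle (z0 : C) (rho : R) (z : C) :
  contC (fun p => z0 + RtoC rho * cis (Im p))%C z.
Proof.
  apply contC_plus; [apply contC_const|apply contC_mult; [apply contC_const|apply contC_cis]].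
Qed.

Lemma Cmod_circle (z0 : C) (rho : R) (t : R) : 0 <= rho ->
  Cmod (z0 + RtoC rho * cis t - z0)%C = rho.
Proof.
  intros H. replace (z0 + RtoC rho * cis t - z0)%C with (RtoC rho * cis t)%C by ring.
  rewrite Cmod_mult, Cmod_cis, Cmod_R, Rabs_pos_eq; lra.
Qed.

Lemma ccont_circle (U : C -> Prop) (F dF : C -> C) (z0 : C) (rho r : R) :
  hol U F dF -> (forall w, Cmod (w - z0)%C < r -> U w) -> 0 <= rho < r ->
  ccont (fun t => F (z0 + RtoC rho * cis t)%C).
Proof.
  intros HF HU Hr. apply (jcont_ccont (fun _ t => F (z0 + RtoC rho * cis t)%C) 0).
  intros t. apply (contC_comp F (fun p => z0 + RtoC rho * cis (Im p))%C).
  - apply contC_circle.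
  - eapply cdiff_contC. apply HF, HU.
    change (Cmod (z0 + RtoC rho * cis t - z0)%C < r). rewrite Cmod_circle; lra.
Qed.

Lemma ccont_inv_circle (rho : R) (m : C) : Cmod m < rho ->
  ccont (fun t => / (RtoC rho * cis t - m))%C.
Proof.
  intros H. apply (jcont_ccont (fun _ t => / (RtoC rho * cis t - m))%C 0).
  intros t. unfold jcont. apply contC_inv; [|now apply rho_cis_minus_neq_0].
  apply contC_minus; [apply contC_mult; [apply contC_const|apply contC_cis]|apply contC_const].
Qed.

Lemma Cauchy_mean (U : C -> Prop) (F dF : C -> C) (z0 : C) (rho r : R) :
  hol U F dF -> (forall w, Cmod (w - z0)%C < r -> U w) -> 0 < rho < r ->
  CInt (fun t => F (z0 + RtoC rho * cis t)%C) = (RtoC (2 * PI) * F z0)%C.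
Proof.
  intros HF HU Hr. assert (Z : Cmod (z0 - z0)%C < rho).
  { replace (z0 - z0)%C with (RtoC 0) by ring. rewrite Cmod_0. lra. }
  rewrite <- (Cauchy_formula U F dF z0 z0 rho r HF HU Z (proj2 Hr)).
  apply CInt_ext. intros t. field. now apply rho_cis_minus_neq_0.
Qed.

(** Subtracting the mean value formula from Cauchy's formula leaves a factor [z - z0], so the
    difference quotient is bounded before passing to the limit. The constant 8 collects 2 from
    [CInt_bound], 2 from the kernel at [|z - z0| < rho / 2], and 2 from [rho = r / 2]. *)
Lemma Cauchy_estimate (U : C -> Prop) (F dF : C -> C) (z0 : C) (r M : R) :
  hol U F dF -> 0 < r -> (forall w, Cmod (w - z0)%C < r -> U w) ->
  (forall w, Cmod (w - z0)%C < r -> Cmod (F w) <= M) ->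
  Cmod (dF z0) <= 8 * M / r.
Proof.
  intros HF Hr HU HM.
  assert (Z : Cmod (z0 - z0)%C = 0).
  { replace (z0 - z0)%C with (RtoC 0) by ring. apply Cmod_0. }
  assert (M0 : 0 <= M).
  { eapply Rle_trans; [apply Cmod_ge_0|apply (HM z0)]. lra. }
  set (rho := r / 2). assert (Hrho : 0 < rho < r) by (unfold rho; lra).
  apply (limC_Cmod_bound (fun w => (F w - F z0) / (w - z0))%C z0 (dF z0) (rho / 2));
    [lra| |apply HF, HU; lra].
  intros z Hz. set (m := (z - z0)%C) in *.
  assert (Nm : m <> 0) by now apply Cmod_gt_0.
  assert (CF := ccont_circle U F dF z0 rho r HF HU ltac:(lra)).
  assert (CK := ccont_inv_circle rho m ltac:(lra)).
  assert (E : (RtoC (2 * PI) * (F z - F z0) =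
     m * CInt (fun t => F (z0 + RtoC rho * cis t) * / (RtoC rho * cis t - m)))%C).
  { transitivity (RtoC (2 * PI) * F z + (-1) * (RtoC (2 * PI) * F z0))%C; [ring|].
    rewrite <- (Cauchy_formula U F dF z0 z rho r HF HU) by (fold m; lra). fold m.
    rewrite <- (Cauchy_mean U F dF z0 rho r HF HU Hrho).
    rewrite <- !CInt_scal; [| |exact CF].
    - rewrite <- CInt_plus.
      + apply CInt_ext. intros t. field. apply rho_cis_minus_neq_0. lra.
      + apply ccont_mult; [exact CF|]. unfold Cdiv. apply ccont_mult; [|exact CK].
        apply ccont_mult; [apply ccont_const|]. apply (pdiff_ccont _ _ pdiff_cis).
      + apply ccont_mult; [apply ccont_const|exact CF].
    - now apply ccont_mult. }
  assert (P := PI_RGT_0).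
  assert (EM := f_equal Cmod E). rewrite !Cmod_mult, Cmod_R, (Rabs_pos_eq (2 * PI)) in EM by lra.
  assert (BD : Cmod (CInt (fun t => F (z0 + RtoC rho * cis t) * / (RtoC rho * cis t - m)))%C
     <= 4 * PI * (M * (2 / rho))).
  { apply CInt_bound; [now apply ccont_mult|]. intros t. rewrite Cmod_mult.
    apply Rmult_le_compat; try apply Cmod_ge_0.
    - apply HM. rewrite Cmod_circle; lra.
    - rewrite Cmod_inv by (apply rho_cis_minus_neq_0; lra).
      replace (2 / rho) with (/ (rho / 2)) by (field; lra).
      apply Rinv_le_contravar; [lra|]. assert (T := rho_cis_minus rho m t ltac:(lra)). lra. }
  change (Cmod ((F z - F z0) * / m)%C <= 8 * M / r).
  rewrite Cmod_mult, Cmod_inv by exact Nm.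
  apply Rmult_le_reg_r with (2 * PI * Cmod m); [apply Rmult_lt_0_compat; lra|].
  replace (Cmod (F z - F z0)%C * / Cmod m * (2 * PI * Cmod m))
    with (2 * PI * Cmod (F z - F z0)%C) by (field; lra).
  rewrite EM. replace (8 * M / r * (2 * PI * Cmod m))
    with (Cmod m * (4 * PI * (M * (2 / rho)))) by (unfold rho; field; lra).
  apply Rmult_le_compat_l; [lra|exact BD].
Qed.

Lemma rdiff_contC (h : C -> R) (z : C) (a b : R) : rdiff h z a b -> contC (fun w => RtoC (h w)) z.
Proof.
  intros H. apply contC_of_2d. apply differentiable_continuity_pt.
  exists a, b. exact H.
Qed.

(* With [F = h_x - i h_y], the mean value property of [F] gives
   [d/ds (s int exp(-it) h) = 2 pi s F(z0)], the integral being over the circle of radius [s]. *)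
Lemma harm_gradient (U : C -> Prop) (h : C -> R) (F : C -> C) (z0 : C) (r M : R) :
  harm U h F -> 0 < r -> (forall w, Cmod (w - z0)%C < r -> U w) ->
  (forall w, Cmod (w - z0)%C < r -> Rabs (h w) <= M) ->
  Cmod (F z0) <= 8 * M / r.
Proof.
  intros [[dF HF] Hh] Hr HU HM. set (rho := r / 2).
  pose (pt := fun s t => (z0 + RtoC s * cis t)%C).
  assert (HP : forall s t, - r < s < r -> Cmod (pt s t - z0)%C < r).
  { intros s t Hs. unfold pt.
    replace (z0 + RtoC s * cis t - z0)%C with (RtoC s * cis t)%C by ring.
    rewrite Cmod_mult, Cmod_cis, Cmod_R, Rmult_1_r. apply Rabs_def1; lra. }
  pose (q := fun z => (RtoC (Re z))).
  (* The subtracted term makes the integral of [A s] independent of [s]. Its [s]-derivative splits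
     into [K1], which integrates to zero by the mean value property of [F], and [K2], the
     [t]-derivative of [i exp(-it) h]. *)
  pose (A := fun s t => (Cconj (cis t) * RtoC (h (pt s t)) * RtoC s
      - RtoC s * RtoC s * (F z0 / 2))%C).
  pose (K1 := fun s t => (RtoC s * (F (pt s t) + -1 * F z0))%C).
  pose (K2 := fun s t => (Ci * (Cconj (Ci * cis t) * RtoC (h (pt s t)) +
      Cconj (cis t) * q (F (pt s t) * (RtoC s * (Ci * cis t)))))%C).
  pose (K := fun s t => (K1 s t + K2 s t)%C).
  assert (Jpt : forall s t, contC (fun p => pt (Re p) (Im p)) (s, t)).
  { intros s t. unfold pt. apply contC_plus; [apply contC_const|].
    apply contC_mult; [apply contC_fst_param|apply contC_cis]. }
  assert (JF : forall s t, - r < s < r -> contC (fun p => F (pt (Re p) (Im p))) (s, t)).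
  { intros s t Hs. apply (contC_comp F (fun p => pt (Re p) (Im p))); [apply Jpt|].
    eapply cdiff_contC, HF, HU. exact (HP s t Hs). }
  assert (Jh : forall s t, - r < s < r -> contC (fun p => RtoC (h (pt (Re p) (Im p)))) (s, t)).
  { intros s t Hs. apply (contC_comp (fun w => RtoC (h w)) (fun p => pt (Re p) (Im p)));
    [apply Jpt|]. eapply rdiff_contC, Hh, HU. exact (HP s t Hs). }
  assert (JK1 : forall s t, - r < s < r -> jcont K1 s t).
  { intros s t Hs. unfold jcont, K1. apply contC_mult; [apply contC_fst_param|].
    apply contC_plus; [now apply JF|apply contC_const]. }
  assert (JK2 : forall s t, - r < s < r -> jcont K2 s t).
  { intros s t Hs. unfold jcont, K2. apply contC_mult; [apply contC_const|].
    apply contC_plus.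
    - apply contC_mult; [|now apply Jh]. apply contC_conj, contC_mult;
      [apply contC_const|apply contC_cis].
    - apply contC_mult; [apply contC_conj, contC_cis|]. unfold q. apply contC_Re.
      apply contC_mult; [now apply JF|]. apply contC_mult; [apply contC_fst_param|].
      apply contC_mult; [apply contC_const|apply contC_cis]. }
  assert (D2 : forall s t, pdiff (fun v => pt s v) t (RtoC s * (Ci * cis t))%C).
  { intros s t. unfold pt. eapply pdiff_eq; [apply pdiff_plus; [apply pdiff_const|
      apply pdiff_mult; [apply pdiff_const|apply pdiff_cis]]|]. cbv beta. ring. }
  assert (D1 : forall s t, pdiff (fun u => pt u t) s (cis t)).
  { intros s t. unfold pt. eapply pdiff_eq; [apply pdiff_plus; [apply pdiff_const|
      apply pdiff_mult; [apply (pdiff_RtoC (fun u => u)), (is_derive_id (K := R_AbsRing))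
                       |apply pdiff_const]]|].
    cbv beta. change (RtoC one) with (RtoC 1). ring. }
  assert (CA : forall s, - r < s < r -> ccont (A s)).
  { intros s Hs. apply (jcont_ccont A). intros t. unfold jcont, A.
    apply contC_minus.
    - apply contC_mult; [apply contC_mult; [apply contC_conj, contC_cis|now apply Jh]|].
      apply contC_fst_param.
    - apply contC_mult; [apply contC_mult; apply contC_fst_param|apply contC_const]. }
  assert (Eq : CInt (A rho) = CInt (A 0)).
  { apply (CInt_conserved A K (- r) 0 rho r); try (unfold rho; lra); auto.
    - intros s t Hs. unfold A, K, K1, K2.
      assert (Dh : pdiff (fun u => RtoC (h (pt u t))) s (q (F (pt s t) * cis t)%C)).
      { apply pdiff_RtoC. unfold q.
        replace (Re (F (pt s t) * cis t)%C) with
          (Re (F (pt s t)) * Re (cis t) + - Im (F (pt s t)) * Im (cis t)) by (Csimp; ring).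
        apply (rdiff_comp h (fun u => pt u t)); [|apply D1]. apply Hh, HU, HP, Hs. }
      eapply pdiff_eq.
      { apply pdiff_minus.
        - apply pdiff_mult; [apply pdiff_mult; [apply pdiff_const|exact Dh]|].
          apply (pdiff_RtoC (fun u => u)), (is_derive_id (K := R_AbsRing)).
        - apply pdiff_mult; [|apply pdiff_const].
          apply pdiff_mult; apply (pdiff_RtoC (fun u => u)), (is_derive_id (K := R_AbsRing)). }
      cbv beta. change (RtoC one) with (RtoC 1).
      assert (S := sin2_cos2 t). unfold Rsqr in S.
      generalize (h (pt s t)); intros h0. generalize (F (pt s t)); intros f.
      transitivity (Cconj (cis t) * RtoC h0
         + RtoC s * (Cconj (cis t) * q (f * cis t)%C) - RtoC s * F z0)%C; [field|].
      (* With [v = f exp(it)] this is [v = Re v - i Re (i v)], multiplied by [exp(-it)]. *)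
      assert (X : (Cconj (cis t) * q (f * cis t)%C = f + Ci * (Cconj (cis t) *
         q (f * (Ci * cis t))%C))%C).
      { unfold q, cis. destruct f as [f1 f2]. apply C_eq; Csimp.
        - transitivity (f1 * (sin t * sin t + cos t * cos t) +
            (- f1 * sin t * sin t - f2 * sin t * cos t)); [ring|rewrite S; ring].
        - transitivity (f2 * (sin t * sin t + cos t * cos t) +
            (- f2 * cos t * cos t - f1 * sin t * cos t)); [ring|rewrite S; ring]. }
      rewrite X.
      replace (q (f * (RtoC s * (Ci * cis t)))%C) with (RtoC s * q (f * (Ci * cis t)))%C
        by (unfold q; apply C_eq; Csimp; ring).
      replace (Cconj (Ci * cis t)) with (- Ci * Cconj (cis t))%C by (apply C_eq; Csimp; ring).
      transitivity (RtoC s * (f + -1 * F z0) +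
         (- (Ci * Ci) * Cconj (cis t) * RtoC h0 +
            Ci * (Cconj (cis t) * (RtoC s * q (f * (Ci * cis t))))))%C; [|ring].
      replace (- (Ci * Ci))%C with (RtoC 1) by (apply C_eq; Csimp; ring). ring.
    - intros s t Hs. unfold jcont, K. apply contC_plus; [now apply JK1|now apply JK2].
    - intros s Hs. unfold K. rewrite CInt_plus;
        [|apply jcont_ccont; intros t; apply JK1; unfold rho in *; lra
         |apply jcont_ccont; intros t; apply JK2; unfold rho in *; lra].
      assert (E1 : CInt (K1 s) = 0).
      { unfold K1. assert (CF := ccont_circle U F dF z0 s r HF HU ltac:(unfold rho in *; lra)).
        rewrite CInt_scal by (apply ccont_plus; [exact CF|apply ccont_const]).
        rewrite CInt_plus by (first [exact CF|apply ccont_const]).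
        rewrite CInt_const. unfold pt.
        rewrite (Cauchy_mean U F dF z0 s r HF HU) by (unfold rho in *; lra). ring. }
      assert (E2 : CInt (K2 s) = 0).
      { apply (CInt_derive (fun t => Ci * (Cconj (cis t) * RtoC (h (pt s t))))%C).
        - intros t. unfold K2.
          assert (Dh : pdiff (fun u => RtoC (h (pt s u))) t
             (q (F (pt s t) * (RtoC s * (Ci * cis t)))%C)).
          { apply pdiff_RtoC. unfold q.
            rewrite Re_mult.
            replace (_ - _) with (Re (F (pt s t)) * Re (RtoC s * (Ci * cis t))%C
              + - Im (F (pt s t)) * Im (RtoC s * (Ci * cis t))%C) by ring.
            apply (rdiff_comp h (fun u => pt s u)); [|apply D2].
            apply Hh, HU, HP; unfold rho in *; lra. }
          eapply pdiff_eq; [apply pdiff_mult; [apply pdiff_const|apply pdiff_mult;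
            [apply pdiff_conj, pdiff_cis|exact Dh]]|]. cbv beta. ring.
        - apply jcont_ccont. intros t. apply JK2. unfold rho in *; lra.
        - unfold pt. now rewrite cis_period. }
      change (CInt (fun t => K1 s t)) with (CInt (K1 s)).
      change (CInt (fun t => K2 s t)) with (CInt (K2 s)). rewrite E1, E2. ring. }
  assert (Hrho : 0 < rho < r) by (unfold rho; lra).
  rewrite (CInt_ext (A 0) (fun _ => 0)), CInt_const in Eq by (intros t; unfold A; ring).
  assert (CH : ccont (fun t => Cconj (cis t) * RtoC (h (pt rho t)))%C).
  { apply ccont_mult.
    - apply (jcont_ccont (fun _ t => Cconj (cis t)) 0). intros t. apply contC_conj, contC_cis.
    - apply (jcont_ccont (fun s t => RtoC (h (pt s t))) rho). intros t. apply Jh. lra. }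
  assert (E3 : CInt (A rho) = (RtoC rho * CInt (fun t => Cconj (cis t) * RtoC (h (pt rho t)))
     + - (RtoC PI * RtoC rho * RtoC rho * F z0))%C).
  { rewrite <- CInt_scal by exact CH.
    replace (- (RtoC PI * RtoC rho * RtoC rho * F z0))%C with
      (CInt (fun _ => - (RtoC rho * RtoC rho * (F z0 / 2)))%C)
      by (rewrite CInt_const, RtoC_mult; field).
    rewrite <- CInt_plus; [|apply ccont_mult; [apply ccont_const|exact CH]|apply ccont_const].
    apply CInt_ext. intros t. unfold A. ring. }
  assert (P := PI_RGT_0).
  (* The complex gradient at the centre is a first Fourier coefficient of [h] on the circle, hence
     is bounded by the size of [h]. *)
  assert (E4 : (RtoC (PI * rho) * F z0 =
     CInt (fun t => Cconj (cis t) * RtoC (h (pt rho t))))%C).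
  { rewrite Eq in E3. clear Eq.
    set (J := CInt (fun t => Cconj (cis t) * RtoC (h (pt rho t)))%C) in *.
    assert (Nr : RtoC rho <> 0) by (intros E; apply RtoC_inj in E; lra).
    rewrite RtoC_mult.
    transitivity ((RtoC PI * RtoC rho * RtoC rho * F z0) / RtoC rho)%C; [field; exact Nr|].
    transitivity ((RtoC rho * J) / RtoC rho)%C; [|field; exact Nr]. f_equal.
    transitivity (RtoC (2 * PI) * 0 + RtoC PI * RtoC rho * RtoC rho * F z0)%C; [ring|].
    rewrite E3. ring. }
  apply (f_equal Cmod) in E4. rewrite Cmod_mult, Cmod_R, Rabs_pos_eq in E4 by nra.
  assert (BD : Cmod (CInt (fun t => Cconj (cis t) * RtoC (h (pt rho t)))%C) <= 4 * PI * M).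
  { apply CInt_bound; [exact CH|]. intros t.
    rewrite Cmod_mult, Cmod_conj, Cmod_cis, Cmod_R, Rmult_1_l. apply HM, HP. lra. }
  rewrite <- E4 in BD.
  apply Rmult_le_reg_l with (PI * rho); [nra|].
  replace (PI * rho * (8 * M / r)) with (4 * PI * M) by (unfold rho; field; lra). exact BD.
Qed.

Lemma Cminus_0 (w : C) : (w - 0)%C = w.
Proof. ring. Qed.

Lemma limC_ext_0 (F G : C -> C) (l : C) (d : R) :
  0 < d -> (forall w, 0 < Cmod w < d -> F w = G w) -> limC F 0 l -> limC G 0 l.
Proof. intros Hd H. apply limC_ext with (1 := Hd). intros w. rewrite Cminus_0. apply H. Qed.

Lemma ball_in_punctured (R0 : R) (z w : C) (d : R) :
  0 < Cmod z < R0 -> d <= Cmod z -> d <= R0 - Cmod z -> Cmod (w - z)%C < d ->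
  punctured_disk R0 w.
Proof.
  intros Hz H1 H2 Hw. unfold punctured_disk.
  assert (T1 := Cmod_rev_triangle w z). assert (T2 := Cmod_rev_triangle z w).
  rewrite (Cmod_minus_sym z w) in T2. lra.
Qed.

Lemma hol_gradient_0 (R0 M : R) (p dp : C -> C) (z : C) :
  hol (punctured_disk R0) p dp -> 0 < Cmod z < R0 / 2 ->
  (forall w, 0 < Cmod w < 2 * Cmod z -> Cmod (p w) <= M) ->
  Cmod (dp z) <= 8 * M / Cmod z.
Proof.
  intros Hp Hz HM.
  assert (HB : forall w, Cmod (w - z)%C < Cmod z -> 0 < Cmod w < 2 * Cmod z).
  { intros w Hw. apply (ball_in_punctured (2 * Cmod z) z w (Cmod z)); lra. }
  apply (Cauchy_estimate (punctured_disk R0) p dp z (Cmod z) M Hp); try lra.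
  - intros w Hw. specialize (HB w Hw). split; lra.
  - intros w Hw. apply HM, HB, Hw.
Qed.

(** Serves to kill one by one the leading coefficients of an expansion at the puncture. *)
Lemma zero_of_small (c : C) (B : C -> C) (d M : R) : 0 < d ->
  (forall w, 0 < Cmod w < d -> Cmod (B w) <= M) ->
  (forall w, 0 < Cmod w < d -> c = (w * B w)%C) -> c = 0.
Proof.
  intros Hd HB HE. apply (limC_unique (fun _ => c) 0).
  - apply limC_const.
  - apply (limC_ext_0 (fun w => w * B w)%C _ _ d Hd).
    + intros w Hw. symmetry. now apply HE.
    + apply (limC_0_mult_bounded _ _ 0 M d Hd).
      * intros w. rewrite Cminus_0. apply HB.
      * apply limC_id.
Qed.

(* [z^2 p] is continuously differentiable across the puncture, so Cauchy's formula applies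
   to it; the first two terms of the expansion of the kernel contribute nothing. *)
Lemma bounded_hol_limit (R0 M : R) (p dp : C -> C) : 0 < R0 ->
  hol (punctured_disk R0) p dp -> (forall z, punctured_disk R0 z -> Cmod (p z) <= M) ->
  exists l, limC p 0 l.
Proof.
  intros HR Hp HM.
  assert (HM0 : 0 <= M).
  { eapply Rle_trans; [apply Cmod_ge_0|apply (HM (RtoC (R0 / 2)))].
    unfold punctured_disk. rewrite Cmod_R, Rabs_pos_eq; lra. }
  (* A single factor [z] would leave a derivative only known to be bounded. With two, the estimate
     [|z| |p'| <= 8 M] makes the derivative [O(z)]. *)
  pose (G := fun z => (z * z * p z)%C).
  pose (dG := fun z => ((1 * z + z * 1) * p z + z * z * dp z)%C).
  set (R1 := R0 / 2).
  assert (Hdp : forall w, 0 < Cmod w < R1 -> Cmod w * Cmod (dp w) <= 8 * M).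
  { intros w Hw. assert (B := hol_gradient_0 R0 M p dp w Hp Hw).
    apply Rmult_le_reg_l with (/ Cmod w); [apply Rinv_0_lt_compat, Hw|].
    replace (/ Cmod w * (Cmod w * Cmod (dp w))) with (Cmod (dp w)) by (field; lra).
    replace (/ Cmod w * (8 * M)) with (8 * M / Cmod w) by (field; lra).
    apply B. intros v Hv. apply HM. unfold punctured_disk, R1 in *. lra. }
  assert (HG : hol (fun z => Cmod z < R1) G dG).
  { intros z Hz. destruct (Req_dec (Cmod z) 0) as [E|E].
    - apply Cmod_eq_0 in E. subst z. split.
      + replace (dG 0) with (RtoC 0) by (unfold dG; ring).
        apply (limC_ext_0 (fun w => w * p w)%C _ _ R0 HR).
        * intros w Hw. unfold G. rewrite Cminus_0. field. apply Cmod_gt_0. lra.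
        * apply (limC_0_mult_bounded _ _ 0 M R0 HR); [|apply limC_id].
          intros w. rewrite Cminus_0. apply HM.
      + unfold contC. replace (dG 0) with (RtoC 0) by (unfold dG; ring).
        apply (limC_Cmod_le _ (fun w => w) 0 R1 (10 * M)); [unfold R1; lra| |apply limC_id].
        intros w. rewrite Cminus_0. intros Hw. unfold dG.
        eapply Rle_trans; [apply Cmod_triangle|]. rewrite !Cmod_mult.
        assert (B1 := Hdp w Hw). assert (B2 := HM w ltac:(unfold punctured_disk, R1 in *; lra)).
        replace (1 * w + w * 1)%C with (RtoC 2 * w)%C by (apply C_eq; Csimp; ring).
        rewrite Cmod_mult, Cmod_R, (Rabs_pos_eq 2) by lra.
        assert (P := Cmod_ge_0 w). nra.
    - assert (P := Cmod_ge_0 z).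
      assert (Uz : punctured_disk R0 z) by (unfold punctured_disk, R1 in *; lra).
      exact (hol_mult _ _ _ _ _ (hol_mult _ _ _ _ _ (hol_id _) (hol_id _)) Hp z Uz). }
  set (rho := R1 / 2).
  assert (Hr : 0 < rho < R1) by (unfold rho, R1; lra).
  assert (HB1 : forall w, Cmod (w - 0)%C < R1 -> Cmod w < R1).
  { intros w. now rewrite Cminus_0. }
  pose (ze := fun t => (RtoC rho * cis t)%C).
  pose (g := fun t => G (0 + ze t)%C).
  assert (Cg : ccont g) by (apply (ccont_circle _ G dG 0 rho R1 HG HB1); lra).
  assert (Nze : forall t, ze t <> 0).
  { intros t. replace (ze t) with (RtoC rho * cis t - 0)%C by (unfold ze; ring).
    apply rho_cis_minus_neq_0. rewrite Cmod_0. lra. }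
  assert (Ci1 : ccont (fun t => / ze t)%C).
  { apply (ccont_ext (fun t => / (RtoC rho * cis t - 0))%C).
    - intros t. now rewrite Cminus_0.
    - apply ccont_inv_circle. rewrite Cmod_0. lra. }
  pose (g1 := fun t => (g t * / ze t)%C). pose (g2 := fun t => (g1 t * / ze t)%C).
  assert (Cg1 : ccont g1) by (now apply ccont_mult).
  assert (Cg2 : ccont g2) by (now apply ccont_mult).
  pose (K := fun w => CInt (fun t => g2 t * / (ze t - w))%C).
  assert (Mg2 : exists M2, forall t, Cmod (g2 t) <= M2).
  { exists M. intros t. unfold g2, g1, g, G.
    replace (_ * _ * _ * _ * _)%C with (p (0 + ze t)%C) by (field; apply Nze).
    - apply HM. unfold punctured_disk. replace (0 + ze t)%C with (ze t) by ring.
      unfold ze. rewrite Cmod_mult, Cmod_cis, Cmod_R, Rabs_pos_eq; unfold R1 in *; lra. }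
  destruct Mg2 as [M2 Mg2].
  assert (BK : forall w, 0 < Cmod w < rho / 2 -> Cmod (K w) <= 4 * PI * (M2 * (2 / rho))).
  { intros w Hw. apply CInt_bound.
    - apply ccont_mult; [exact Cg2|apply ccont_inv_circle; lra].
    - intros t. rewrite Cmod_mult. apply Rmult_le_compat; try apply Cmod_ge_0; [apply Mg2|].
      unfold ze. rewrite Cmod_inv by (apply rho_cis_minus_neq_0; lra).
      replace (2 / rho) with (/ (rho / 2)) by (field; lra).
      apply Rinv_le_contravar; [lra|]. assert (T := rho_cis_minus rho w t ltac:(lra)). lra. }
  (* Cauchy's formula with the kernel expanded to third order: [ze / (ze - w) = 1 + w / ze + w^2 /
     ze^2 + w^3 / (ze^2 (ze - w))]. *)
  assert (EX : forall w, 0 < Cmod w < rho / 2 ->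
     (RtoC (2 * PI) * (w * w * p w) = CInt g + w * CInt g1 + w * w * CInt g2
        + w * w * w * K w)%C).
  { intros w Hw.
    assert (CK : ccont (fun t => / (ze t - w))%C) by (apply ccont_inv_circle; lra).
    assert (CF := Cauchy_formula _ G dG 0 w rho R1 HG HB1).
    rewrite Cminus_0 in CF. specialize (CF ltac:(lra) ltac:(lra)).
    change (G w) with (w * w * p w)%C in CF. rewrite <- CF. unfold K.
    rewrite <- (CInt_scal g1), <- (CInt_scal g2), <- (CInt_scal (fun t => g2 t * / (ze t - w))%C)
      by (try apply ccont_mult; assumption).
    assert (C1 : ccont (fun t => w * g1 t)%C)
      by (apply ccont_mult; [apply ccont_const|exact Cg1]).
    assert (C2 : ccont (fun t => w * w * g2 t)%C)
      by (apply ccont_mult; [apply ccont_const|exact Cg2]).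
    assert (C3 : ccont (fun t => w * w * w * (g2 t * / (ze t - w)))%C)
      by (apply ccont_mult; [apply ccont_const|apply ccont_mult; assumption]).
    assert (C4 := ccont_plus _ _ Cg C1). assert (C5 := ccont_plus _ _ C4 C2).
    rewrite <- (CInt_plus _ _ Cg C1), <- (CInt_plus _ _ C4 C2), <- (CInt_plus _ _ C5 C3).
    apply CInt_ext. intros t. unfold g2, g1. fold (ze t). fold (g t). field.
    repeat split; first [apply Nze|unfold ze; apply rho_cis_minus_neq_0; lra]. }
  assert (Hr2 : 0 < rho / 2) by lra.
  assert (BC := fun w (Hw : 0 < Cmod w < rho / 2) =>
    HM w ltac:(unfold punctured_disk, rho, R1 in *; lra)).
  set (MM := 4 * PI * (M2 * (2 / rho))) in *.
  assert (HMM : forall w, 0 < Cmod w < rho / 2 -> 0 <= MM).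
  { intros w Hw. eapply Rle_trans; [apply Cmod_ge_0|apply (BK w Hw)]. }
  assert (P2 := two_PI_pos).
  assert (J0 : CInt g = 0).
  { apply (zero_of_small _ (fun w => RtoC (2 * PI) * (w * p w) +
      - (CInt g1 + w * CInt g2 + w * w * K w))%C (rho / 2)
      (2 * PI * (rho * M) + (Cmod (CInt g1) + rho * Cmod (CInt g2) + rho * rho * MM)) Hr2).
    - intros w Hw. specialize (BC w Hw). specialize (BK w Hw).
      assert (Q := HMM w Hw). assert (Q2 := Cmod_ge_0 (CInt g2)).
      assert (Q3 := Cmod_ge_0 (K w)). assert (Q4 := Cmod_ge_0 (p w)).
      eapply Rle_trans; [apply Cmod_triangle|]. rewrite Cmod_opp.
      apply Rplus_le_compat.
      + rewrite !Cmod_mult, Cmod_R, Rabs_pos_eq by lra.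
        apply Rmult_le_compat_l; [lra|]. apply Rmult_le_compat; lra.
      + eapply Rle_trans; [apply Cmod_triangle|]. apply Rplus_le_compat.
        * eapply Rle_trans; [apply Cmod_triangle|]. apply Rplus_le_compat_l.
          rewrite Cmod_mult. apply Rmult_le_compat_r; lra.
        * rewrite !Cmod_mult.
          assert (QW : 0 <= Cmod w * Cmod w <= rho * rho) by (split; nra).
          apply Rmult_le_compat; lra.
    - intros w Hw. specialize (EX w Hw).
      transitivity (RtoC (2 * PI) * (w * w * p w) -
        (w * CInt g1 + w * w * CInt g2 + w * w * w * K w))%C; [rewrite EX; ring|ring]. }
  assert (J1 : CInt g1 = 0).
  { apply (zero_of_small _ (fun w => RtoC (2 * PI) * p w +
      - (CInt g2 + w * K w))%C (rho / 2)
      (2 * PI * M + (Cmod (CInt g2) + rho * MM)) Hr2).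
    - intros w Hw. specialize (BC w Hw). specialize (BK w Hw).
      assert (Q := HMM w Hw). assert (Q3 := Cmod_ge_0 (K w)).
      eapply Rle_trans; [apply Cmod_triangle|]. rewrite Cmod_opp.
      apply Rplus_le_compat.
      + rewrite !Cmod_mult, Cmod_R, Rabs_pos_eq by lra.
        apply Rmult_le_compat_l; lra.
      + eapply Rle_trans; [apply Cmod_triangle|]. apply Rplus_le_compat_l.
        rewrite Cmod_mult. apply Rmult_le_compat; lra.
    - intros w Hw. specialize (EX w Hw). rewrite J0 in EX.
      assert (Nw : w <> 0) by now apply Cmod_gt_0.
      transitivity ((RtoC (2 * PI) * (w * w * p w) -
        (0 + w * w * CInt g2 + w * w * w * K w)) / w)%C; [rewrite EX; field; exact Nw|].
      field; exact Nw. }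
  assert (N2 : RtoC (2 * PI) <> 0) by (intros E; apply RtoC_inj in E; lra).
  (* With the first two coefficients gone, division by [w^2] leaves the third one as the value at
     the puncture. *)
  exists (CInt g2 / RtoC (2 * PI))%C.
  apply limC_0_minus.
  apply (limC_ext_0 (fun w => w * (K w / RtoC (2 * PI)))%C _ _ (rho / 2) Hr2).
  - intros w Hw. specialize (EX w Hw). rewrite J0, J1 in EX.
    assert (Nw : w <> 0) by now apply Cmod_gt_0.
    transitivity (RtoC (2 * PI) * (w * w * p w) / (w * w * RtoC (2 * PI))
       - CInt g2 / RtoC (2 * PI))%C; [rewrite EX; field; now split|field; now split].
  - apply (limC_0_mult_bounded _ _ 0 (MM * / (2 * PI)) (rho / 2) Hr2); [|apply limC_id].
    intros w. rewrite Cminus_0. intros Hw.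
    unfold Cdiv. rewrite Cmod_mult, Cmod_inv by exact N2.
    rewrite Cmod_R, Rabs_pos_eq by lra.
    apply Rmult_le_compat_r; [left; apply Rinv_0_lt_compat; lra|]. now apply BK.
Qed.

(** * An a priori bound for Riccati equations *)

Lemma rectangle_bounded (f : R -> R -> R) (x0 y0 d : R) : 0 < d ->
  (forall x y, x0 - d <= x <= x0 + d -> y0 - d <= y <= y0 + d -> continuity_2d_pt f x y) ->
  exists B, forall x y, x0 - d <= x <= x0 + d -> y0 - d <= y <= y0 + d -> Rabs (f x y) <= B.
Proof.
  intros Hd Hc.
  (* Uniform continuity with tolerance 1: along the segment from the centre, [N] equal steps shorter
     than [del] in each coordinate change [f] by at most [N]. *)
  destruct (uniform_continuity_2d f _ _ _ _ Hc (mkposreal 1 Rlt_0_1)) as [del H].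
  destruct (nfloor_ex (d / del)) as [n Hn].
  { left. apply Rdiv_lt_0_compat; [lra|apply cond_pos]. }
  (* The integer part gives [d / del < n + 1], hence the successor. *)
  set (N := S n). assert (HN : 0 < INR N) by (apply lt_0_INR; unfold N; lia).
  assert (HdN : d / INR N < del).
  { apply Rmult_lt_reg_r with (INR N); [exact HN|].
    replace (d / INR N * INR N) with d by (field; lra).
    unfold N. rewrite S_INR.
    assert (P := cond_pos del).
    apply Rmult_lt_reg_r with (/ del); [now apply Rinv_0_lt_compat|].
    replace (del * (INR n + 1) * / del) with (INR n + 1) by (field; lra). apply Hn. }
  exists (Rabs (f x0 y0) + INR N). intros x y Hx Hy.
  set (h := (x - x0) / INR N). set (l := (y - y0) / INR N).
  assert (Bh : Rabs h < del /\ Rabs l < del).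
  { unfold h, l, Rdiv. rewrite !Rabs_mult, (Rabs_pos_eq (/ INR N))
      by (left; now apply Rinv_0_lt_compat).
    split; eapply Rle_lt_trans; [|exact HdN| |exact HdN];
    (apply Rmult_le_compat_r; [left; now apply Rinv_0_lt_compat|apply Rabs_le; lra]). }
  assert (IN : forall k, (k <= N)%nat -> - d <= INR k * h <= d /\ - d <= INR k * l <= d).
  { intros k Hk. apply le_INR in Hk. assert (Pk := pos_INR k).
    assert (Q : 0 <= INR k / INR N <= 1).
    { split; [apply Rdiv_le_0_compat; lra|].
      apply Rmult_le_reg_r with (INR N); [exact HN|].
      replace (INR k / INR N * INR N) with (INR k) by (field; lra). lra. }
    replace (INR k * h) with (INR k / INR N * (x - x0)) by (unfold h; field; lra).
    replace (INR k * l) with (INR k / INR N * (y - y0)) by (unfold l; field; lra).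
    nra. }
  assert (IND : forall k, (k <= N)%nat ->
    Rabs (f (x0 + INR k * h) (y0 + INR k * l) - f x0 y0) <= INR k).
  { induction k as [|k IH]; intros Hk.
    - simpl. rewrite !Rmult_0_l, !Rplus_0_r. unfold Rminus. rewrite Rplus_opp_r, Rabs_R0. lra.
    - specialize (IH ltac:(lia)).
      assert (I1 := IN k ltac:(lia)). assert (I2 := IN (S k) Hk).
      assert (S1 := H (x0 + INR k * h) (y0 + INR k * l) (x0 + INR (S k) * h)
        (y0 + INR (S k) * l) ltac:(lra) ltac:(lra) ltac:(lra) ltac:(lra)).
      rewrite S_INR in *. simpl pos in S1.
      replace (x0 + (INR k + 1) * h - (x0 + INR k * h)) with h in S1 by ring.
      replace (y0 + (INR k + 1) * l - (y0 + INR k * l)) with l in S1 by ring.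
      specialize (S1 (proj1 Bh) (proj2 Bh)).
      apply Rabs_def2 in S1. apply Rabs_le_between in IH.
      apply Rabs_le. lra. }
  specialize (IND N (le_n N)).
  replace (x0 + INR N * h) with x in IND by (unfold h; field; lra).
  replace (y0 + INR N * l) with y in IND by (unfold l; field; lra).
  assert (T := Rabs_triang_inv (f x y) (f x0 y0)). lra.
Qed.

(** The square of half-side [d] contains the disk of radius [d] and lies in that of radius [2 d],
    where continuity is assumed. *)
Lemma ball_bounded (F : C -> C) (z0 : C) (d : R) : 0 < d ->
  (forall w, Cmod (w - z0)%C <= 2 * d -> contC F w) ->
  exists B, forall w, Cmod (w - z0)%C <= d -> Cmod (F w) <= B.
Proof.
  intros Hd HF.
  assert (HC : forall x y, Re z0 - d <= x <= Re z0 + d -> Im z0 - d <= y <= Im z0 + d ->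
    contC F (x, y)).
  { intros x y Hx Hy. apply HF. eapply Rle_trans; [apply Cmod_le_Re_Im|]. Csimp.
    assert (Rabs (x - Re z0) <= d) by (apply Rabs_le; lra).
    assert (Rabs (y - Im z0) <= d) by (apply Rabs_le; lra). lra. }
  destruct (rectangle_bounded (fun x y => Re (F (x, y))) (Re z0) (Im z0) d Hd) as [B1 H1].
  { intros x y Hx Hy. exact (proj1 (contC_2d F (x, y) (HC x y Hx Hy))). }
  destruct (rectangle_bounded (fun x y => Im (F (x, y))) (Re z0) (Im z0) d Hd) as [B2 H2].
  { intros x y Hx Hy. exact (proj2 (contC_2d F (x, y) (HC x y Hx Hy))). }
  exists (B1 + B2). intros w Hw.
  assert (R1 := re_le_Cmod (w - z0)%C). assert (R2 := im_le_Cmod (w - z0)%C).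
  rewrite Re_minus in R1. rewrite Im_minus in R2.
  assert (Q1 : Rabs (Re w - Re z0) <= d) by lra. assert (Q2 : Rabs (Im w - Im z0) <= d) by lra.
  apply Rabs_le_between in Q1. apply Rabs_le_between in Q2.
  specialize (H1 (Re w) (Im w) ltac:(lra) ltac:(lra)).
  specialize (H2 (Re w) (Im w) ltac:(lra) ltac:(lra)).
  replace (F (Re w, Im w)) with (F w) in H1, H2 by (f_equal; apply C_eq; reflexivity).
  eapply Rle_trans; [apply Cmod_le_Re_Im|]. lra.
Qed.

(* A pole-free solution of a Riccati equation cannot be large: near a point where
   [|u| * distance to the boundary] is almost maximal, Cauchy's estimate bounds [|u'|]
   by a small multiple of [|u|^2], whereas the equation makes it comparable to [|u|^2]. *)
Lemma Riccati_bounded (R0 a0 b0 : R) (u du al be : C -> C) :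
  0 < R0 -> 0 < a0 -> 0 <= b0 ->
  hol (punctured_disk R0) u du ->
  (forall z, punctured_disk R0 z -> du z = (al z * u z * u z - be z)%C) ->
  (forall z, punctured_disk R0 z -> a0 <= Cmod (al z)) ->
  (forall z, punctured_disk R0 z -> Cmod (be z) * (Cmod z * Cmod z) <= b0) ->
  forall z, punctured_disk (R0 / 2) z -> Cmod (z * u z)%C <= 6 * (1 + (64 + b0) / a0).
Proof.
  intros HR Ha Hb Hu HE Hal Hbe z0 Hz0.
  (* With this radius the disk of radius [2 d0] about [z0] avoids 0 and lies in
     [|w| <= 5 |z0| / 3 < R0]. *)
  set (d0 := Cmod z0 / 3). assert (Hd0 : 0 < d0) by (unfold d0; destruct Hz0; lra).
  assert (HIN : forall w, Cmod (w - z0)%C <= 2 * d0 -> punctured_disk R0 w).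
  { intros w Hw. unfold d0, punctured_disk in *.
    assert (T1 := Cmod_rev_triangle w z0). assert (T2 := Cmod_rev_triangle z0 w).
    rewrite (Cmod_minus_sym z0 w) in T2. lra. }
  destruct (ball_bounded u z0 d0 Hd0) as [B HB].
  { intros w Hw. eapply cdiff_contC. apply Hu, HIN, Hw. }
  (* The quantity to maximize is [|u|] weighted by the distance to the boundary of the disk. It is
     invariant under scaling and vanishes on the boundary circle. *)
  set (E := fun v => exists w, Cmod (w - z0)%C <= d0 /\ v = Cmod (u w) * (d0 - Cmod (w - z0)%C)).
  assert (E0 : E (Cmod (u z0) * d0)).
  { exists z0. replace (z0 - z0)%C with (RtoC 0) by ring. rewrite Cmod_0. split; [lra|ring]. }
  assert (HBd : bound E).
  { exists (B * d0). intros v [w [Hw ->]]. specialize (HB w Hw).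
    assert (P1 := Cmod_ge_0 (u w)). assert (P2 := Cmod_ge_0 (w - z0)%C).
    apply Rmult_le_compat; lra. }
  destruct (completeness E HBd (ex_intro _ _ E0)) as [m [Hm1 Hm2]].
  (* The summand 1 makes the almost maximal value [m1] exceed 1, so that [b0 <= b0 m1] and
     [a0 m1^2 <= 64 m1 + b0] can be divided by [m1]. *)
  set (M1 := 1 + (64 + b0) / a0).
  assert (HM1 : 1 < M1) by (unfold M1; assert (0 < (64 + b0) / a0)
    by (apply Rdiv_lt_0_compat; lra); lra).
  assert (Hm : m <= 2 * M1).
  { apply Rnot_lt_le. intros Hlt.
    (* The supremum need not be attained; half of it is enough. *)
    assert (EX : exists w, Cmod (w - z0)%C <= d0 /\ m / 2 < Cmod (u w) * (d0 - Cmod (w - z0)%C)).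
    { apply Classical_Prop.NNPP. intros HN. assert (U : is_upper_bound E (m / 2)).
      { intros v [w [Hw ->]]. apply Rnot_lt_le. intros HL. apply HN. exists w. now split. }
      specialize (Hm2 _ U). lra. }
    destruct EX as [z1 [Hz1 Hm3]].
    set (d1 := d0 - Cmod (z1 - z0)%C) in *. set (u1 := Cmod (u z1)) in *.
    assert (P1 : 0 <= u1) by apply Cmod_ge_0. assert (P2 := Cmod_ge_0 (z1 - z0)%C).
    assert (Hd1 : 0 < d1).
    { destruct (Rle_lt_dec d1 0) as [Q|Q]; [|exact Q]. exfalso. unfold d1 in Q.
      assert (d1 = 0) by (unfold d1; lra). rewrite H in Hm3. lra. }
    assert (Hd1' : d1 <= d0) by (unfold d1; lra).
    assert (Hu1 : 0 < u1) by (destruct P1 as [P1|P1]; [exact P1|rewrite <- P1 in Hm3; lra]).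
    assert (IN1 : forall w, Cmod (w - z1)%C < d1 / 2 -> Cmod (w - z0)%C <= d0 - d1 / 2).
    { intros w Hw. assert (T := Cmod_minus_triangle w z1 z0). unfold d1 in *. lra. }
    (* On the disk of radius [d1 / 2] about [z1] the weight is at least [d1 / 2], so
       [|u| d1 / 2 <= m < 2 u1 d1], that is [|u| <= 4 u1]. Hence [64 = 8 * 4 * 2]. *)
    assert (CE : Cmod (du z1) <= 8 * (4 * u1) / (d1 / 2)).
    { apply (Cauchy_estimate (punctured_disk R0) u du z1 (d1 / 2) (4 * u1) Hu); [lra| |].
      - intros w Hw. apply HIN. specialize (IN1 w Hw). lra.
      - intros w Hw. specialize (IN1 w Hw).
        assert (Q : Cmod (u w) * (d0 - Cmod (w - z0)%C) <= m).
        { apply Hm1. exists w. split; [lra|reflexivity]. }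
        assert (P3 := Cmod_ge_0 (u w)).
        apply Rmult_le_reg_r with (d1 / 2); [lra|].
        apply Rle_trans with (Cmod (u w) * (d0 - Cmod (w - z0)%C)); [|lra].
        apply Rmult_le_compat_l; lra. }
    assert (I1 : punctured_disk R0 z1) by (apply HIN; lra).
    assert (L : a0 * (u1 * u1) - Cmod (be z1) <= Cmod (du z1)).
    { rewrite HE by exact I1. eapply Rle_trans; [|apply Cmod_rev_triangle].
      rewrite !Cmod_mult. fold u1. specialize (Hal z1 I1). nra. }
    (* Allows the bound on [|z|^2 |be|] to be used with [d1] in place of [|z1|]. *)
    assert (Z1 : d1 <= Cmod z1).
    { assert (T2 := Cmod_rev_triangle z0 z1). rewrite (Cmod_minus_sym z0 z1) in T2.
      unfold d0 in *. lra. }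
    assert (Bz : Cmod (be z1) * (d1 * d1) <= b0).
    { eapply Rle_trans; [|apply (Hbe z1 I1)]. apply Rmult_le_compat_l; [apply Cmod_ge_0|]. nra. }
    set (m1 := u1 * d1) in *.
    assert (F1 : a0 * (m1 * m1) <= 64 * m1 + b0).
    { assert (Q : Cmod (du z1) * (d1 * d1) <= 64 * m1).
      { replace (64 * m1) with (8 * (4 * u1) / (d1 / 2) * (d1 * d1)) by (unfold m1; field; lra).
        apply Rmult_le_compat_r; [nra|exact CE]. }
      assert (Q2 : (a0 * (u1 * u1) - Cmod (be z1)) * (d1 * d1) <= Cmod (du z1) * (d1 * d1)).
      { apply Rmult_le_compat_r; [nra|exact L]. }
      unfold m1 in *. nra. }
    assert (Hmm : M1 < m1) by lra.
    assert (F2 : a0 * m1 <= 64 + b0) by nra.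
    assert (F3 : m1 <= (64 + b0) / a0).
    { apply Rmult_le_reg_l with a0; [exact Ha|]. replace (a0 * ((64 + b0) / a0)) with (64 + b0)
        by (field; lra). exact F2. }
    unfold M1 in Hmm. lra. }
  (* The constant 6 is 3 from [|z0| = 3 d0] times 2 from [m <= 2 M1]. *)
  specialize (Hm1 _ E0). rewrite Cmod_mult.
  replace (Cmod z0) with (3 * d0) by (unfold d0; field). fold M1. lra.
Qed.

(** * Derivatives along coordinate lines *)

(** Only in these two directions is [diff] itself a one-variable derivative; in the others it is a
    combination of partial derivatives. *)
Definition axis (e : C) : Prop := e = e1 \/ e = e2.

Definition line (z e : C) (t : R) : C := (z + RtoC t * e)%C.

Definition ldiff (h : C -> R) (z e : C) (l : R) : Prop :=
  is_derive (fun t => h (line z e t)) 0 l.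

Lemma line_0 (z e : C) : line z e 0 = z.
Proof. unfold line. ring. Qed.

Lemma line_e1 (z : C) (t : R) : line z e1 t = (Re z + t, Im z).
Proof. unfold line, e1. apply C_eq; Csimp; ring. Qed.

Lemma line_e2 (z : C) (t : R) : line z e2 t = (Re z, Im z + t).
Proof. unfold line, e2. apply C_eq; Csimp; ring. Qed.

Lemma pdiff_line (z e : C) (t : R) : pdiff (line z e) t e.
Proof.
  unfold line. eapply pdiff_eq; [apply pdiff_plus; [apply pdiff_const|
    apply pdiff_mult; [apply (pdiff_RtoC (fun u => u)), (is_derive_id (K := R_AbsRing))
                     |apply pdiff_const]]|].
  cbv beta. change (RtoC one) with (RtoC 1). ring.
Qed.

Lemma axis_Cmod (e : C) : axis e -> Cmod e = 1.
Proof.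
  intros [->| ->]; unfold e1, e2, Cmod; simpl.
  - replace (_ + _) with 1 by ring. apply sqrt_1.
  - replace (_ + _) with 1 by ring. apply sqrt_1.
Qed.

Lemma line_near (z e : C) (d : R) : axis e -> 0 < d ->
  locally 0 (fun t => Cmod (line z e t - z)%C < d).
Proof.
  intros He Hd. exists (mkposreal d Hd). intros t Ht.
  unfold line. replace (z + RtoC t * e - z)%C with (RtoC t * e)%C by ring.
  rewrite Cmod_mult, Cmod_R, (axis_Cmod e He), Rmult_1_r.
  change (Rabs (t - 0) < d) in Ht. now rewrite Rminus_0_r in Ht.
Qed.

Lemma is_derive_shift (g : R -> R) (x a l : R) :
  is_derive (fun t => g (a + t)) x l <-> is_derive g (a + x) l.
Proof.
  split; intros H.
  - apply (is_derive_ext (fun s => g (a + (s - a)))).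
    { intros s. f_equal. ring. }
    replace l with (scal 1 l) by (unfold scal; simpl; unfold mult; simpl; ring).
    apply (is_derive_comp (fun t => g (a + t)) (fun s => s - a)).
    + now replace (a + x - a) with x by ring.
    + auto_derive; [exact I|ring].
  - replace l with (scal 1 l) by (unfold scal; simpl; unfold mult; simpl; ring).
    apply (is_derive_comp g (fun t => a + t)); [exact H|]. auto_derive; [exact I|ring].
Qed.

Lemma ldiff_e1 (h : C -> R) (z : C) (l : R) :
  ldiff h z e1 l <-> is_derive (fun t => h (t, Im z)) (Re z) l.
Proof.
  unfold ldiff. replace (Re z) with (Re z + 0) by ring. rewrite <- is_derive_shift.
  split; apply is_derive_ext; intros t; now rewrite line_e1.
Qed.

Lemma ldiff_e2 (h : C -> R) (z : C) (l : R) :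
  ldiff h z e2 l <-> is_derive (fun t => h (Re z, t)) (Im z) l.
Proof.
  unfold ldiff. replace (Im z) with (Im z + 0) by ring. rewrite <- is_derive_shift.
  split; apply is_derive_ext; intros t; now rewrite line_e2.
Qed.

Lemma diff_e1 (h : C -> R) (z : C) : diff h z e1 = pd1 h z.
Proof. unfold diff, e1. Csimp. ring. Qed.

Lemma diff_e2 (h : C -> R) (z : C) : diff h z e2 = pd2 h z.
Proof. unfold diff, e2. Csimp. ring. Qed.

Lemma ldiff_diff (h : C -> R) (z e : C) (l : R) : axis e -> ldiff h z e l -> diff h z e = l.
Proof.
  intros [->| ->] H.
  - rewrite diff_e1. exact (is_derive_unique _ _ _ (proj1 (ldiff_e1 h z l) H)).
  - rewrite diff_e2. exact (is_derive_unique _ _ _ (proj1 (ldiff_e2 h z l) H)).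
Qed.

Lemma ldiff_correct (h : C -> R) (z e : C) :
  axis e -> (exists l, ldiff h z e l) -> ldiff h z e (diff h z e).
Proof. intros He [l Hl]. now rewrite (ldiff_diff h z e l He Hl). Qed.

Lemma ldiff_eq (h : C -> R) (z e : C) (l m : R) : ldiff h z e l -> l = m -> ldiff h z e m.
Proof. intros H <-; exact H. Qed.

Lemma ldiff_unique (h : C -> R) (z e : C) (l m : R) : ldiff h z e l -> ldiff h z e m -> l = m.
Proof.
  intros H1 H2. rewrite <- (is_derive_unique _ _ _ H1). now apply is_derive_unique.
Qed.

Lemma ldiff_ext (f g : C -> R) (z e : C) (l d : R) : axis e -> 0 < d ->
  (forall w, Cmod (w - z)%C < d -> f w = g w) -> ldiff f z e l -> ldiff g z e l.
Proof.
  intros He Hd H. apply is_derive_ext_loc.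
  eapply filter_imp; [|apply (line_near z e d He Hd)]. intros t Ht. now apply H.
Qed.

Lemma ldiff_const (c : R) (z e : C) : ldiff (fun _ => c) z e 0.
Proof. unfold ldiff. auto_derive; [exact I|ring]. Qed.

Lemma ldiff_plus (f g : C -> R) (z e : C) (a b : R) :
  ldiff f z e a -> ldiff g z e b -> ldiff (fun w => f w + g w) z e (a + b).
Proof. intros H1 H2. exact (is_derive_plus _ _ _ _ _ H1 H2). Qed.

Lemma ldiff_opp (f : C -> R) (z e : C) (a : R) :
  ldiff f z e a -> ldiff (fun w => - f w) z e (- a).
Proof. intros H1. exact (is_derive_opp _ _ _ H1). Qed.

Lemma ldiff_minus (f g : C -> R) (z e : C) (a b : R) :
  ldiff f z e a -> ldiff g z e b -> ldiff (fun w => f w - g w) z e (a - b).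
Proof. intros H1 H2. exact (is_derive_minus _ _ _ _ _ H1 H2). Qed.

Lemma ldiff_mult (f g : C -> R) (z e : C) (a b : R) :
  ldiff f z e a -> ldiff g z e b -> ldiff (fun w => f w * g w) z e (a * g z + f z * b).
Proof.
  intros H1 H2. assert (H := is_derive_mult_R _ _ _ _ _ H1 H2). cbv beta in H.
  rewrite line_0 in H. exact H.
Qed.

Lemma ldiff_inv (f : C -> R) (z e : C) (a : R) :
  ldiff f z e a -> f z <> 0 -> ldiff (fun w => / f w) z e (- a / (f z * f z)).
Proof.
  intros H N. eapply ldiff_eq.
  - unfold ldiff. apply (is_derive_inv (fun t => f (line z e t)) 0 a H). now rewrite line_0.
  - cbv beta. rewrite line_0. field. exact N.
Qed.

Lemma ldiff_sqrt (f : C -> R) (z e : C) (a : R) :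
  ldiff f z e a -> 0 < f z -> exists l, ldiff (fun w => sqrt (f w)) z e l.
Proof.
  intros H N. eexists. apply (is_derive_sqrt (fun t => f (line z e t)) 0 a H).
  now rewrite line_0.
Qed.

(** The increment is split along the axes: the horizontal part needs the first partial near [z] and
    its continuity, the vertical part only the second partial at [z]. *)
Lemma rdiff_of_partials (f fx : C -> R) (z : C) (fy d : R) : 0 < d ->
  (forall w, Cmod (w - z)%C < d -> ldiff f w e1 (fx w)) -> ldiff f z e2 fy ->
  continuity_2d_pt (fun x y => fx (x, y)) (Re z) (Im z) -> rdiff f z (fx z) fy.
Proof.
  intros Hd H1 H2 H3. apply filterdiff_differentiable_pt_lim.
  assert (F := is_derive_filterdiff (fun x y => f (x, y)) (Re z) (Im z)
     (fun x y => fx (x, y)) fy).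
  eapply filterdiff_ext_lin.
  - apply F.
    + assert (Hd2 : 0 < d / 2) by lra. exists (mkposreal _ Hd2). intros [a b] [Ha Hb].
      change (Rabs (a - Re z) < d / 2) in Ha. change (Rabs (b - Im z) < d / 2) in Hb.
      apply (proj1 (ldiff_e1 f (a, b) _)). apply H1.
      eapply Rle_lt_trans; [apply Cmod_le_Re_Im|]. Csimp. lra.
    + apply (proj1 (ldiff_e2 f z _) H2).
    + apply continuity_2d_pt_filterlim in H3. exact H3.
  - intros [a b]. simpl.
    replace (fx (Re z, Im z)) with (fx z) by (f_equal; apply C_eq; reflexivity). reflexivity.
Qed.

(** * Smooth functions *)

Lemma open_punctured (eps : R) : openC (punctured_disk eps).
Proof.
  intros z [H1 H2]. exists (Rmin (Cmod z) (eps - Cmod z)). split; [apply Rmin_pos; lra|].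
  intros w Hw. assert (A1 := Rmin_l (Cmod z) (eps - Cmod z)).
  assert (A2 := Rmin_r (Cmod z) (eps - Cmod z)). unfold punctured_disk.
  assert (T1 := Cmod_rev_triangle w z). assert (T2 := Cmod_rev_triangle z w).
  rewrite (Cmod_minus_sym z w) in T2. lra.
Qed.

Lemma smooth_pd1 (U : C -> Prop) (h : C -> R) : smooth_on U h -> smooth_on U (pd1 h).
Proof. intros H n z Hz. exact (ex_diff_n_deriv_aux1 _ n _ _ (H (S n) z Hz)). Qed.

Lemma smooth_pd2 (U : C -> Prop) (h : C -> R) : smooth_on U h -> smooth_on U (pd2 h).
Proof. intros H n z Hz. exact (ex_diff_n_deriv_aux2 _ n _ _ (H (S n) z Hz)). Qed.

Lemma smooth_continuity (U : C -> Prop) (h : C -> R) (z : C) : smooth_on U h -> U z ->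
  continuity_2d_pt (fun x y => h (x, y)) (Re z) (Im z).
Proof. intros H Hz. exact (proj1 (H 0%nat z Hz)). Qed.

Lemma smooth_contC (U : C -> Prop) (h : C -> R) (z : C) : smooth_on U h -> U z ->
  contC (fun w => RtoC (h w)) z.
Proof. intros H Hz. apply contC_of_2d. now apply (smooth_continuity U). Qed.

Lemma smooth_ex (U : C -> Prop) (h : C -> R) (z : C) : smooth_on U h -> U z ->
  ex_derive (fun t => h (t, Im z)) (Re z) /\ ex_derive (fun t => h (Re z, t)) (Im z).
Proof. intros H Hz. destruct (H 1%nat z Hz) as [_ [H1 [H2 _]]]. now split. Qed.

Lemma smooth_ldiff (U : C -> Prop) (h : C -> R) (z e : C) : smooth_on U h -> U z -> axis e ->
  ldiff h z e (diff h z e).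
Proof.
  intros H Hz He. destruct (smooth_ex U h z H Hz) as [[l1 H1] [l2 H2]].
  apply ldiff_correct; [exact He|]. destruct He as [->| ->].
  - exists l1. exact (proj2 (ldiff_e1 h z l1) H1).
  - exists l2. exact (proj2 (ldiff_e2 h z l2) H2).
Qed.

Lemma smooth_rdiff (U : C -> Prop) (h : C -> R) (z : C) : openC U -> smooth_on U h -> U z ->
  rdiff h z (pd1 h z) (pd2 h z).
Proof.
  intros HU H Hz. destruct (HU z Hz) as [d [Hd HB]].
  apply (rdiff_of_partials h (pd1 h) z (pd2 h z) d Hd).
  - intros w Hw. rewrite <- diff_e1. apply (smooth_ldiff U); auto. now left.
  - rewrite <- diff_e2. apply (smooth_ldiff U); auto. now right.
  - apply (smooth_continuity U); [now apply smooth_pd1|exact Hz].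
Qed.

Lemma smooth_Schwarz (U : C -> Prop) (h : C -> R) (z : C) : openC U -> smooth_on U h ->
  U z -> pd1 (pd2 h) z = pd2 (pd1 h) z.
Proof.
  intros HU H Hz. destruct (HU z Hz) as [d [Hd HB]].
  apply (Schwarz (fun x y => h (x, y)) (Re z) (Im z)).
  - assert (Hd2 : 0 < d / 2) by lra. exists (mkposreal _ Hd2). simpl. intros a b Ha Hb.
    assert (Uw : U (a, b)).
    { apply HB. eapply Rle_lt_trans; [apply Cmod_le_Re_Im|]. Csimp. lra. }
    repeat split.
    + exact (proj1 (smooth_ex U h (a, b) H Uw)).
    + exact (proj2 (smooth_ex U h (a, b) H Uw)).
    + exact (proj1 (smooth_ex U _ (a, b) (smooth_pd2 U h H) Uw)).
    + exact (proj2 (smooth_ex U _ (a, b) (smooth_pd1 U h H) Uw)).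
  - exact (smooth_continuity U (pd1 (pd2 h)) z (smooth_pd1 U _ (smooth_pd2 U h H)) Hz).
  - exact (smooth_continuity U (pd2 (pd1 h)) z (smooth_pd2 U _ (smooth_pd1 U h H)) Hz).
Qed.

(** Laplace's equation and the symmetry of second derivatives are the two Cauchy-Riemann equations
    of [h_x - i h_y]. *)
Lemma harm_of_laplace (U : C -> Prop) (h : C -> R) : openC U -> smooth_on U h ->
  (forall z, U z -> pd1 (pd1 h) z + pd2 (pd2 h) z = 0) ->
  harm U h (fun z => (pd1 h z, - pd2 h z)).
Proof.
  intros HU H HL. assert (H1 := smooth_pd1 U h H). assert (H2 := smooth_pd2 U h H).
  split.
  - exists (fun z => (pd1 (pd1 h) z, - pd1 (pd2 h) z)). intros z Hz. split.
    + apply cdiff_of_rdiff; Csimp.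
      * replace (- - pd1 (pd2 h) z) with (pd2 (pd1 h) z)
          by (rewrite (smooth_Schwarz U h z HU H Hz); ring).
        exact (smooth_rdiff U _ z HU H1 Hz).
      * assert (D := smooth_rdiff U _ z HU H2 Hz).
        replace (pd1 (pd1 h) z) with (- pd2 (pd2 h) z) by (specialize (HL z Hz); lra).
        intros e. destruct (D e) as [d Hd]. exists d. intros u v Hu Hv.
        specialize (Hd u v Hu Hv). eapply Rle_trans; [|exact Hd].
        right. rewrite <- Rabs_Ropp. f_equal. Csimp. ring.
    + apply (contC_pair (fun z => pd1 (pd1 h) z) (fun z => - pd1 (pd2 h) z)).
      * apply (smooth_contC U); [now apply smooth_pd1|exact Hz].
      * apply contC_of_2d, continuity_2d_pt_opp.
        apply (smooth_continuity U (pd1 (pd2 h))); [now apply smooth_pd1|exact Hz].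
  - intros z Hz. Csimp. rewrite Ropp_involutive. now apply (smooth_rdiff U).
Qed.

(** * Vectors *)

Lemma x1_plus (p q : vec) : x1 (plus p q) = x1 p + x1 q. Proof. reflexivity. Qed.
Lemma x2_plus (p q : vec) : x2 (plus p q) = x2 p + x2 q. Proof. reflexivity. Qed.
Lemma x3_plus (p q : vec) : x3 (plus p q) = x3 p + x3 q. Proof. reflexivity. Qed.
Lemma x1_minus (p q : vec) : x1 (minus p q) = x1 p - x1 q. Proof. reflexivity. Qed.
Lemma x2_minus (p q : vec) : x2 (minus p q) = x2 p - x2 q. Proof. reflexivity. Qed.
Lemma x3_minus (p q : vec) : x3 (minus p q) = x3 p - x3 q. Proof. reflexivity. Qed.
Lemma x1_scal (a : R) (p : vec) : x1 (scal a p) = a * x1 p. Proof. reflexivity. Qed.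
Lemma x2_scal (a : R) (p : vec) : x2 (scal a p) = a * x2 p. Proof. reflexivity. Qed.
Lemma x3_scal (a : R) (p : vec) : x3 (scal a p) = a * x3 p. Proof. reflexivity. Qed.
Lemma x1_mk (a b c : R) : x1 (a, b, c) = a. Proof. reflexivity. Qed.
Lemma x2_mk (a b c : R) : x2 (a, b, c) = b. Proof. reflexivity. Qed.
Lemma x3_mk (a b c : R) : x3 (a, b, c) = c. Proof. reflexivity. Qed.

#[local] Hint Rewrite x1_plus x2_plus x3_plus x1_minus x2_minus x3_minus
  x1_scal x2_scal x3_scal x1_mk x2_mk x3_mk : vecs.

Ltac vsimp := unfold dot, cross; autorewrite with vecs.

Lemma vec_eq (p q : vec) : x1 p = x1 q -> x2 p = x2 q -> x3 p = x3 q -> p = q.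
Proof.
  destruct p as [[a b] c], q as [[a' b'] c']; unfold x1, x2, x3; simpl.
  intros -> -> ->; reflexivity.
Qed.

Lemma dot_comm (p q : vec) : dot p q = dot q p.
Proof. unfold dot. ring. Qed.
Lemma dot_plus_l (p q r : vec) : dot (plus p q) r = dot p r + dot q r.
Proof. vsimp. ring. Qed.
Lemma dot_plus_r (p q r : vec) : dot r (plus p q) = dot r p + dot r q.
Proof. vsimp. ring. Qed.
Lemma dot_minus_l (p q r : vec) : dot (minus p q) r = dot p r - dot q r.
Proof. vsimp. ring. Qed.
Lemma dot_minus_r (p q r : vec) : dot r (minus p q) = dot r p - dot r q.
Proof. vsimp. ring. Qed.
Lemma dot_scal_l (a : R) (p r : vec) : dot (scal a p) r = a * dot p r.
Proof. vsimp. ring. Qed.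
Lemma dot_scal_r (a : R) (p r : vec) : dot r (scal a p) = a * dot r p.
Proof. vsimp. ring. Qed.

#[local] Hint Rewrite dot_plus_l dot_plus_r dot_minus_l dot_minus_r dot_scal_l dot_scal_r : dots.

Lemma dot_pos (p : vec) : 0 <= dot p p.
Proof. unfold dot. nra. Qed.

Lemma dot_eq_0 (p : vec) : dot p p = 0 -> x1 p = 0 /\ x2 p = 0 /\ x3 p = 0.
Proof. unfold dot. intros H. repeat split; nra. Qed.

Lemma norm3_sq (p : vec) : norm3 p * norm3 p = dot p p.
Proof. apply sqrt_sqrt, dot_pos. Qed.

(** Parseval's identity in the basis [a], [b], [cross a b], cleared of denominators by the Gram
    determinant of [a] and [b]. *)
Lemma Gram_cross (a b p q : vec) :
  dot p q * (dot a a * dot b b - dot a b * dot a b) =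
  dot p a * dot q a * dot b b + dot p b * dot q b * dot a a
  - dot a b * (dot p a * dot q b + dot p b * dot q a)
  + dot p (cross a b) * dot q (cross a b).
Proof. vsimp. ring. Qed.

Lemma dot_cross_cross (a b p q : vec) :
  dot (cross a b) (cross p q) = dot a p * dot b q - dot a q * dot b p.
Proof. vsimp. ring. Qed.

Lemma dot_cross_l (a b : vec) : dot (cross a b) a = 0.
Proof. vsimp. ring. Qed.
Lemma dot_cross_r (a b : vec) : dot (cross a b) b = 0.
Proof. vsimp. ring. Qed.

(** Used with [E] the conformal factor for the coordinate frame of a surface, and with [E = 1] for a
    fixed direct orthonormal basis adapted to the axis of the catenoid. *)
Record oframe (a b n : vec) (E : R) : Prop := {
  of_pos : 0 < E;
  of_aa : dot a a = E;
  of_bb : dot b b = E;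
  of_ab : dot a b = 0;
  of_cross : cross a b = scal E n
}.

Lemma of_n (a b n : vec) (E : R) : oframe a b n E ->
  dot n n = 1 /\ dot n a = 0 /\ dot n b = 0.
Proof.
  intros [H1 H2 H3 H4 H5].
  assert (A1 := dot_cross_cross a b a b). assert (A2 := dot_cross_l a b).
  assert (A3 := dot_cross_r a b). rewrite H5 in *. autorewrite with dots in *.
  rewrite (dot_comm b a), H2, H3, H4 in A1.
  repeat split; apply Rmult_eq_reg_l with E; try lra.
  apply Rmult_eq_reg_l with E; lra.
Qed.

Lemma of_parseval (a b n : vec) (E : R) (p q : vec) : oframe a b n E ->
  E * dot p q = dot p a * dot q a + dot p b * dot q b + E * (dot p n * dot q n).
Proof.
  intros [H1 H2 H3 H4 H5]. assert (G := Gram_cross a b p q).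
  rewrite H2, H3, H4, H5 in G. autorewrite with dots in G.
  apply Rmult_eq_reg_l with E; lra.
Qed.

Lemma of_eq (a b n : vec) (E : R) (p q : vec) : oframe a b n E ->
  dot p a = dot q a -> dot p b = dot q b -> dot p n = dot q n -> p = q.
Proof.
  intros F H1 H2 H3. assert (G := of_parseval a b n E (minus p q) (minus p q) F).
  rewrite !(dot_minus_l p q a), !(dot_minus_l p q b), !(dot_minus_l p q n), H1, H2, H3 in G.
  assert (P := of_pos _ _ _ _ F).
  assert (Z : dot (minus p q) (minus p q) = 0).
  { apply Rmult_eq_reg_l with E; lra. }
  apply dot_eq_0 in Z. autorewrite with vecs in Z. apply vec_eq; lra.
Qed.

(** * Vector fields along coordinate lines *)

Definition vldiff (X : C -> vec) (z e : C) (v : vec) : Prop :=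
  ldiff (fun w => x1 (X w)) z e (x1 v) /\ ldiff (fun w => x2 (X w)) z e (x2 v) /\
  ldiff (fun w => x3 (X w)) z e (x3 v).

Lemma vldiff_eq (X : C -> vec) (z e : C) (v v' : vec) : vldiff X z e v -> v = v' -> vldiff X z e v'.
Proof. intros H <-; exact H. Qed.

Lemma vldiff_ext (X Y : C -> vec) (z e : C) (v : vec) (d : R) : axis e -> 0 < d ->
  (forall w, Cmod (w - z)%C < d -> X w = Y w) -> vldiff X z e v -> vldiff Y z e v.
Proof.
  intros He Hd H [H1 [H2 H3]].
  split; [|split].
  - refine (ldiff_ext _ _ z e _ d He Hd _ H1). intros w Hw. now rewrite H.
  - refine (ldiff_ext _ _ z e _ d He Hd _ H2). intros w Hw. now rewrite H.
  - refine (ldiff_ext _ _ z e _ d He Hd _ H3). intros w Hw. now rewrite H.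
Qed.

Lemma vldiff_vdiff (X : C -> vec) (z e : C) (v : vec) :
  axis e -> vldiff X z e v -> vdiff X z e = v.
Proof.
  intros He [H1 [H2 H3]]. apply vec_eq; simpl; unfold vdiff; autorewrite with vecs;
  now apply ldiff_diff.
Qed.

Lemma vldiff_plus (X Y : C -> vec) (z e : C) (v w : vec) :
  vldiff X z e v -> vldiff Y z e w -> vldiff (fun u => plus (X u) (Y u)) z e (plus v w).
Proof.
  intros [H1 [H2 H3]] [H4 [H5 H6]]. split; [|split].
  - exact (ldiff_plus _ _ _ _ _ _ H1 H4).
  - exact (ldiff_plus _ _ _ _ _ _ H2 H5).
  - exact (ldiff_plus _ _ _ _ _ _ H3 H6).
Qed.

Lemma vldiff_minus (X Y : C -> vec) (z e : C) (v w : vec) :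
  vldiff X z e v -> vldiff Y z e w -> vldiff (fun u => minus (X u) (Y u)) z e (minus v w).
Proof.
  intros [H1 [H2 H3]] [H4 [H5 H6]]. split; [|split].
  - exact (ldiff_minus _ _ _ _ _ _ H1 H4).
  - exact (ldiff_minus _ _ _ _ _ _ H2 H5).
  - exact (ldiff_minus _ _ _ _ _ _ H3 H6).
Qed.

Lemma vldiff_scal (f : C -> R) (X : C -> vec) (z e : C) (a : R) (v : vec) :
  ldiff f z e a -> vldiff X z e v ->
  vldiff (fun u => scal (f u) (X u)) z e (plus (scal a (X z)) (scal (f z) v)).
Proof.
  intros Hf [H1 [H2 H3]]. split; [|split].
  - exact (ldiff_mult _ _ _ _ _ _ Hf H1).
  - exact (ldiff_mult _ _ _ _ _ _ Hf H2).
  - exact (ldiff_mult _ _ _ _ _ _ Hf H3).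
Qed.

Lemma ldiff_dot (X Y : C -> vec) (z e : C) (v w : vec) :
  vldiff X z e v -> vldiff Y z e w ->
  ldiff (fun u => dot (X u) (Y u)) z e (dot v (Y z) + dot (X z) w).
Proof.
  intros [H1 [H2 H3]] [H4 [H5 H6]].
  eapply ldiff_eq.
  - exact (ldiff_plus _ _ _ _ _ _ (ldiff_plus _ _ _ _ _ _ (ldiff_mult _ _ _ _ _ _ H1 H4)
     (ldiff_mult _ _ _ _ _ _ H2 H5)) (ldiff_mult _ _ _ _ _ _ H3 H6)).
  - unfold dot. ring.
Qed.

Lemma vldiff_const (c : vec) (z e : C) : vldiff (fun _ => c) z e (0, 0, 0).
Proof. split; [|split]; apply ldiff_const. Qed.

Lemma ldiff_of_const (h : C -> R) (z e : C) (c l d : R) : axis e -> 0 < d ->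
  (forall w, Cmod (w - z)%C < d -> h w = c) -> ldiff h z e l -> l = 0.
Proof.
  intros He Hd H Hl. apply (ldiff_unique h z e); [exact Hl|].
  apply (ldiff_ext (fun _ => c) h z e 0 d He Hd); [|apply ldiff_const].
  intros w Hw. symmetry. now apply H.
Qed.

(** * Conformal minimal immersions *)

Lemma smooth_on_ext (U : C -> Prop) (f g : C -> R) :
  (forall w, f w = g w) -> smooth_on U f -> smooth_on U g.
Proof.
  intros H Hf n z Hz. apply (ex_diff_n_ext_loc (fun x y => f (x, y))); [|now apply Hf].
  exists (mkposreal 1 Rlt_0_1). intros u v _ _. apply H.
Qed.

Lemma smooth_diff (U : C -> Prop) (h : C -> R) (e : C) : axis e -> smooth_on U h ->
  smooth_on U (fun w => diff h w e).
Proof.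
  intros [->| ->] H.
  - apply (smooth_on_ext U (pd1 h)); [intros w; now rewrite diff_e1|now apply smooth_pd1].
  - apply (smooth_on_ext U (pd2 h)); [intros w; now rewrite diff_e2|now apply smooth_pd2].
Qed.

Lemma vsmooth_vdiff (U : C -> Prop) (X : C -> vec) (e : C) : axis e -> vsmooth_on U X ->
  vsmooth_on U (fun w => vdiff X w e).
Proof.
  intros He [H1 [H2 H3]]. split; [|split].
  - exact (smooth_diff U _ e He H1).
  - exact (smooth_diff U _ e He H2).
  - exact (smooth_diff U _ e He H3).
Qed.

Lemma vsmooth_vldiff (U : C -> Prop) (X : C -> vec) (z e : C) :
  vsmooth_on U X -> U z -> axis e -> vldiff X z e (vdiff X z e).
Proof.
  intros [H1 [H2 H3]] Hz He. split; [|split].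
  - exact (smooth_ldiff U _ z e H1 Hz He).
  - exact (smooth_ldiff U _ z e H2 Hz He).
  - exact (smooth_ldiff U _ z e H3 Hz He).
Qed.

Lemma diff_pd_pd (h : C -> R) (z : C) :
  diff (fun w => diff h w e1) z e1 = pd1 (pd1 h) z /\
  diff (fun w => diff h w e2) z e1 = pd1 (pd2 h) z /\
  diff (fun w => diff h w e1) z e2 = pd2 (pd1 h) z /\
  diff (fun w => diff h w e2) z e2 = pd2 (pd2 h) z.
Proof.
  rewrite !diff_e1, !diff_e2. unfold pd1 at 1 3 6, pd2 at 3 4 6.
  repeat split; apply Derive_ext; intros t; now rewrite ?diff_e1, ?diff_e2.
Qed.

Lemma vdiff_Schwarz (U : C -> Prop) (X : C -> vec) (z : C) : openC U ->
  vsmooth_on U X -> U z ->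
  vdiff (fun w => vdiff X w e2) z e1 = vdiff (fun w => vdiff X w e1) z e2.
Proof.
  intros HU [H1 [H2 H3]] Hz. apply vec_eq; unfold vdiff at 1 3; autorewrite with vecs.
  - destruct (diff_pd_pd (fun w => x1 (X w)) z) as [_ [A [B _]]].
    etransitivity; [exact A|]. etransitivity; [|exact (eq_sym B)].
    exact (smooth_Schwarz U _ z HU H1 Hz).
  - destruct (diff_pd_pd (fun w => x2 (X w)) z) as [_ [A [B _]]].
    etransitivity; [exact A|]. etransitivity; [|exact (eq_sym B)].
    exact (smooth_Schwarz U _ z HU H2 Hz).
  - destruct (diff_pd_pd (fun w => x3 (X w)) z) as [_ [A [B _]]].
    etransitivity; [exact A|]. etransitivity; [|exact (eq_sym B)].
    exact (smooth_Schwarz U _ z HU H3 Hz).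
Qed.

Lemma vldiff_cross (X Y : C -> vec) (z e : C) (v w : vec) :
  vldiff X z e v -> vldiff Y z e w ->
  vldiff (fun u => cross (X u) (Y u)) z e (plus (cross v (Y z)) (cross (X z) w)).
Proof.
  intros [H1 [H2 H3]] [H4 [H5 H6]]. split; [|split].
  - eapply ldiff_eq; [exact (ldiff_minus _ _ _ _ _ _ (ldiff_mult _ _ _ _ _ _ H2 H6)
      (ldiff_mult _ _ _ _ _ _ H3 H5))|vsimp; ring].
  - eapply ldiff_eq; [exact (ldiff_minus _ _ _ _ _ _ (ldiff_mult _ _ _ _ _ _ H3 H4)
      (ldiff_mult _ _ _ _ _ _ H1 H6))|vsimp; ring].
  - eapply ldiff_eq; [exact (ldiff_minus _ _ _ _ _ _ (ldiff_mult _ _ _ _ _ _ H1 H5)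
      (ldiff_mult _ _ _ _ _ _ H2 H4))|vsimp; ring].
Qed.

Lemma det_first_cross (X : C -> vec) (z : C) :
  det_first X z = dot (cross (vdiff X z e1) (vdiff X z e2)) (cross (vdiff X z e1) (vdiff X z e2)).
Proof.
  unfold det_first, first_form. rewrite dot_cross_cross.
  rewrite (dot_comm (vdiff X z e2) (vdiff X z e1)). ring.
Qed.

Lemma gauss_vldiff (U : C -> Prop) (X : C -> vec) (z e : C) :
  immersion_on U X -> U z -> axis e -> vldiff (gauss_map X) z e (vdiff (gauss_map X) z e).
Proof.
  intros [HX HD] Hz He.
  pose (n := fun w => cross (vdiff X w e1) (vdiff X w e2)).
  assert (Hn : exists v, vldiff n z e v).
  { eexists. apply vldiff_cross.
    - apply (vsmooth_vldiff U); [apply vsmooth_vdiff; [now left|exact HX]|exact Hz|exact He].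
    - apply (vsmooth_vldiff U); [apply vsmooth_vdiff; [now right|exact HX]|exact Hz|exact He]. }
  destruct Hn as [v Hv].
  assert (Pn : 0 < dot (n z) (n z)).
  { specialize (HD z Hz). rewrite det_first_cross in HD. fold (n z) in HD.
    assert (P := dot_pos (n z)). lra. }
  destruct (ldiff_sqrt _ z e _ (ldiff_dot n n z e v v Hv Hv) Pn) as [l Hl].
  assert (Ps : sqrt (dot (n z) (n z)) <> 0) by (apply Rgt_not_eq, sqrt_lt_R0, Pn).
  assert (Hi := ldiff_inv _ z e l Hl Ps).
  assert (HN := vldiff_scal _ _ _ _ _ _ Hi Hv).
  assert (HN' : vldiff (gauss_map X) z e
    (plus (scal (- l / (sqrt (dot (n z) (n z)) * sqrt (dot (n z) (n z)))) (n z))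
          (scal (/ sqrt (dot (n z) (n z))) v))) by exact HN.
  rewrite (vldiff_vdiff _ _ _ _ He HN'). exact HN'.
Qed.

Lemma conformal_frame (U : C -> Prop) (X : C -> vec) (z : C) :
  immersion_on U X -> conformal_on U X -> U z ->
  oframe (vdiff X z e1) (vdiff X z e2) (gauss_map X z) (first_form X z e1 e1).
Proof.
  intros [_ HD] HC Hz. destruct (HC z Hz) as [C1 C2]. specialize (HD z Hz).
  set (E := first_form X z e1 e1) in *.
  assert (HE : det_first X z = E * E).
  { unfold det_first. fold E. rewrite <- C1, C2. ring. }
  assert (P : 0 <= E) by apply dot_pos.
  assert (PE : 0 < E).
  { destruct P as [P|P]; [exact P|]. exfalso. apply HD. rewrite HE, <- P. ring. }
  constructor; try reflexivity; try assumption.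
  - exact (eq_sym C1).
  - unfold gauss_map. cbv zeta. unfold norm3. rewrite <- det_first_cross, HE, sqrt_square by exact P.
    apply vec_eq; rewrite ?x1_scal, ?x2_scal, ?x3_scal; field; lra.
Qed.

Lemma gauss_unit (U : C -> Prop) (X : C -> vec) (z : C) : immersion_on U X -> U z ->
  dot (gauss_map X z) (gauss_map X z) = 1 /\
  forall e, axis e -> dot (gauss_map X z) (vdiff X z e) = 0.
Proof.
  intros [_ HD] Hz. specialize (HD z Hz). rewrite det_first_cross in HD.
  unfold gauss_map. cbv zeta. unfold norm3.
  set (n := cross (vdiff X z e1) (vdiff X z e2)) in *.
  assert (P := dot_pos n). assert (S := sqrt_sqrt _ P).
  assert (Ps : sqrt (dot n n) <> 0) by (apply Rgt_not_eq, sqrt_lt_R0; lra).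
  split.
  - rewrite dot_scal_l, dot_scal_r. rewrite <- S at 3. field. exact Ps.
  - intros e [->| ->]; rewrite dot_scal_l; unfold n; [rewrite dot_cross_l|rewrite dot_cross_r]; ring.
Qed.

(** The constraints [<N, N> = 1] and [<N, X_e'> = 0] hold near [z] and are differentiated. *)
Lemma gauss_derive (U : C -> Prop) (X : C -> vec) (z e : C) : openC U ->
  immersion_on U X -> U z -> axis e ->
  dot (vdiff (gauss_map X) z e) (gauss_map X z) = 0 /\
  forall e', axis e' -> dot (vdiff (gauss_map X) z e) (vdiff X z e') =
     - dot (gauss_map X z) (vdiff (fun w => vdiff X w e') z e).
Proof.
  intros HU HX Hz He. destruct (HU z Hz) as [d [Hd HB]].
  assert (DN := gauss_vldiff U X z e HX Hz He). split.
  - assert (D := ldiff_dot _ _ _ _ _ _ DN DN).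
    assert (Q := ldiff_of_const _ z e 1 _ d He Hd
      (fun w Hw => proj1 (gauss_unit U X w HX (HB w Hw))) D).
    rewrite (dot_comm (gauss_map X z)) in Q. lra.
  - intros e' He'.
    assert (D2 := vsmooth_vldiff U _ z e (vsmooth_vdiff U X e' He' (proj1 HX)) Hz He).
    assert (D := ldiff_dot _ _ _ _ _ _ DN D2).
    assert (Q := ldiff_of_const _ z e 0 _ d He Hd
      (fun w Hw => proj2 (gauss_unit U X w HX (HB w Hw)) e' He') D).
    lra.
Qed.

(** Both sides are minus the normal component of a mixed second derivative. *)
Lemma gauss_symmetric (U : C -> Prop) (X : C -> vec) (z : C) : openC U ->
  immersion_on U X -> U z ->
  dot (vdiff (gauss_map X) z e1) (vdiff X z e2) = dot (vdiff (gauss_map X) z e2) (vdiff X z e1).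
Proof.
  intros HU HX Hz.
  rewrite (proj2 (gauss_derive U X z e1 HU HX Hz (or_introl eq_refl)) e2 (or_intror eq_refl)).
  rewrite (proj2 (gauss_derive U X z e2 HU HX Hz (or_intror eq_refl)) e1 (or_introl eq_refl)).
  now rewrite (vdiff_Schwarz U X z HU (proj1 HX) Hz).
Qed.

Lemma minimal_trace (U : C -> Prop) (X : C -> vec) (z : C) :
  minimal_immersion_on U X -> conformal_on U X -> U z ->
  dot (vdiff (gauss_map X) z e1) (vdiff X z e1) + dot (vdiff (gauss_map X) z e2) (vdiff X z e2) = 0.
Proof.
  intros [HX HM] HC Hz. assert (F := conformal_frame U X z HX HC Hz).
  assert (P := of_pos _ _ _ _ F).
  specialize (HM z Hz). unfold mean_curvature, second_form in HM.
  destruct (HC z Hz) as [C1 C2]. rewrite <- C1, C2 in HM.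
  unfold det_first in HM. rewrite <- C1, C2 in HM.
  set (E := first_form X z e1 e1) in *.
  set (A := dot _ (vdiff (gauss_map X) z e1)) in HM.
  rewrite (dot_comm _ (vdiff X z e1)). fold A.
  set (B := dot (vdiff X z e2) (vdiff (gauss_map X) z e2)) in HM.
  rewrite (dot_comm _ (vdiff X z e2)). fold B.
  assert (Q : - (A + B) = 0).
  { apply Rmult_eq_reg_l with (/ (2 * E)); [|apply Rinv_neq_0_compat; lra].
    rewrite Rmult_0_r. rewrite <- HM. field. lra. }
  lra.
Qed.

(** In the conformal frame the shape operator is symmetric and trace-free, so its square is a
    multiple of the identity: the third fundamental form is proportional to the first. *)
Lemma minimal_gauss_conformal (U : C -> Prop) (X : C -> vec) (z : C) : openC U ->
  minimal_immersion_on U X -> conformal_on U X -> U z ->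
  dot (vdiff (gauss_map X) z e1) (vdiff (gauss_map X) z e1) =
    dot (vdiff (gauss_map X) z e2) (vdiff (gauss_map X) z e2) /\
  dot (vdiff (gauss_map X) z e1) (vdiff (gauss_map X) z e2) = 0 /\
  first_form X z e1 e1 * dot (vdiff (gauss_map X) z e1) (vdiff (gauss_map X) z e1) =
    dot (vdiff (gauss_map X) z e1) (vdiff X z e1) ^ 2 +
    dot (vdiff (gauss_map X) z e1) (vdiff X z e2) ^ 2.
Proof.
  intros HU HX HC Hz. assert (F := conformal_frame U X z (proj1 HX) HC Hz).
  assert (P := of_pos _ _ _ _ F).
  assert (T := minimal_trace U X z HX HC Hz).
  assert (S := gauss_symmetric U X z HU (proj1 HX) Hz).
  assert (N1 := proj1 (gauss_derive U X z e1 HU (proj1 HX) Hz (or_introl eq_refl))).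
  assert (N2 := proj1 (gauss_derive U X z e2 HU (proj1 HX) Hz (or_intror eq_refl))).
  assert (P11 := of_parseval _ _ _ _ (vdiff (gauss_map X) z e1) (vdiff (gauss_map X) z e1) F).
  assert (P12 := of_parseval _ _ _ _ (vdiff (gauss_map X) z e1) (vdiff (gauss_map X) z e2) F).
  assert (P22 := of_parseval _ _ _ _ (vdiff (gauss_map X) z e2) (vdiff (gauss_map X) z e2) F).
  rewrite N1, ?N2 in P11, P12. rewrite N2 in P22.
  rewrite <- S in P12, P22.
  replace (dot (vdiff (gauss_map X) z e2) (vdiff X z e2)) with
    (- dot (vdiff (gauss_map X) z e1) (vdiff X z e1)) in P12, P22 by lra.
  split; [|split].
  - apply Rmult_eq_reg_l with (first_form X z e1 e1); [rewrite P11, P22; ring|lra].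
  - apply Rmult_eq_reg_l with (first_form X z e1 e1); [rewrite P12; ring|lra].
  - rewrite P11. ring.
Qed.

(* The normal component of the Laplacian is the trace of the second form; the tangential
   ones vanish by differentiating the conformality relations. *)
Lemma minimal_laplace (U : C -> Prop) (X : C -> vec) (z : C) : openC U ->
  minimal_immersion_on U X -> conformal_on U X -> U z ->
  plus (vdiff (fun w => vdiff X w e1) z e1) (vdiff (fun w => vdiff X w e2) z e2) = (0, 0, 0).
Proof.
  intros HU HX HC Hz. destruct (HU z Hz) as [d [Hd HB]].
  assert (A1 : axis e1) by now left. assert (A2 : axis e2) by now right.
  assert (HS := proj1 (proj1 HX)).
  assert (D11 := vsmooth_vldiff U _ z e1 (vsmooth_vdiff U X e1 A1 HS) Hz A1).
  assert (D12 := vsmooth_vldiff U _ z e1 (vsmooth_vdiff U X e2 A2 HS) Hz A1).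
  assert (D21 := vsmooth_vldiff U _ z e2 (vsmooth_vdiff U X e1 A1 HS) Hz A2).
  assert (D22 := vsmooth_vldiff U _ z e2 (vsmooth_vdiff U X e2 A2 HS) Hz A2).
  assert (SW := vdiff_Schwarz U X z HU HS Hz).
  assert (EQ : forall e, axis e ->
    forall a b, vldiff (fun w => vdiff X w e1) z e a -> vldiff (fun w => vdiff X w e2) z e b ->
    dot a (vdiff X z e1) = dot b (vdiff X z e2) /\
    dot a (vdiff X z e2) + dot (vdiff X z e1) b = 0).
  { intros e He a b Ha Hb. split.
    - assert (D := ldiff_minus _ _ _ _ _ _ (ldiff_dot _ _ _ _ _ _ Ha Ha)
        (ldiff_dot _ _ _ _ _ _ Hb Hb)).
      assert (Q := ldiff_of_const _ z e 0 _ d He Hd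
        (fun w Hw => Rminus_diag_eq _ _ (proj1 (HC w (HB w Hw)))) D).
      rewrite (dot_comm (vdiff X z e1)), (dot_comm (vdiff X z e2)) in Q. lra.
    - assert (D := ldiff_dot _ _ _ _ _ _ Ha Hb).
      exact (ldiff_of_const _ z e 0 _ d He Hd (fun w Hw => proj2 (HC w (HB w Hw))) D). }
  destruct (EQ e1 A1 _ _ D11 D12) as [Q1 Q2]. destruct (EQ e2 A2 _ _ D21 D22) as [Q3 Q4].
  rewrite SW in Q1, Q2.
  assert (G1 := proj2 (gauss_derive U X z e1 HU (proj1 HX) Hz A1) e1 A1).
  assert (G2 := proj2 (gauss_derive U X z e2 HU (proj1 HX) Hz A2) e2 A2).
  assert (T := minimal_trace U X z HX HC Hz).
  apply (of_eq _ _ _ _ _ _ (conformal_frame U X z (proj1 HX) HC Hz)).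
  - rewrite dot_plus_l. rewrite (dot_comm (vdiff X z e1)) in Q4.
    unfold dot at 3. autorewrite with vecs. lra.
  - rewrite dot_plus_l. rewrite (dot_comm (vdiff X z e1)) in Q2.
    unfold dot at 3. autorewrite with vecs. lra.
  - rewrite dot_plus_l. unfold dot at 3. autorewrite with vecs.
    rewrite !(dot_comm _ (gauss_map X z)). lra.
Qed.

(** This is [2 d<X, b>/dz]. *)
Definition hgrad (X : C -> vec) (b : vec) (z : C) : C :=
  (dot (vdiff X z e1) b, - dot (vdiff X z e2) b).

Lemma harm_lin (U : C -> Prop) (h1 h2 : C -> R) (F1 F2 : C -> C) (a b : R) :
  harm U h1 F1 -> harm U h2 F2 ->
  harm U (fun z => a * h1 z + b * h2 z) (fun z => RtoC a * F1 z + RtoC b * F2 z)%C.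
Proof.
  intros [[d1 H1] D1] [[d2 H2] D2]. split.
  - eexists. apply hol_plus; apply hol_scal; eassumption.
  - intros z Hz. specialize (D1 z Hz). specialize (D2 z Hz).
    unfold rdiff in *. apply filterdiff_differentiable_pt_lim in D1.
    apply filterdiff_differentiable_pt_lim in D2.
    apply filterdiff_differentiable_pt_lim.
    eapply filterdiff_ext_lin.
    + exact (filterdiff_plus_fct _ _ _ _ (filterdiff_scal_r_fct a _ _ Rmult_comm D1)
              (filterdiff_scal_r_fct b _ _ Rmult_comm D2)).
    + intros [p q]. unfold plus, scal; simpl. unfold mult; simpl.
      unfold Re, Im; simpl. ring.
Qed.

Lemma harm_ext (U : C -> Prop) (h1 h2 : C -> R) (F1 F2 : C -> C) :
  (forall z, h1 z = h2 z) -> (forall z, F1 z = F2 z) -> harm U h1 F1 -> harm U h2 F2.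
Proof.
  intros Hh HF [[d1 H1] D1]. split.
  - exists d1. intros z Hz. destruct (H1 z Hz) as [A1 A2]. split; [|exact A2].
    apply (cdiff_ext F1 F2 z _ 1 Rlt_0_1); auto.
  - intros z Hz. rewrite <- HF.
    apply (differentiable_pt_lim_ext (fun x y => h1 (x, y))); [|now apply D1].
    exists (mkposreal 1 Rlt_0_1). intros u v _ _. apply Hh.
Qed.

Lemma minimal_harm (U : C -> Prop) (X : C -> vec) (b : vec) : openC U ->
  minimal_immersion_on U X -> conformal_on U X ->
  harm U (fun z => dot (X z) b) (hgrad X b).
Proof.
  intros HU HX HC. destruct (proj1 (proj1 HX)) as [S1 [S2 S3]].
  assert (L := fun z Hz => minimal_laplace U X z HU HX HC Hz).
  assert (H1 : harm U (fun z => x1 (X z)) (hgrad X (1, 0, 0))).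
  { apply (harm_ext U (fun z => x1 (X z)) _
      (fun z => (pd1 (fun z => x1 (X z)) z, - pd2 (fun z => x1 (X z)) z))); auto.
    - intros z. unfold hgrad, vdiff. vsimp. rewrite !diff_e1, !diff_e2.
      apply C_eq; Csimp; ring.
    - apply harm_of_laplace; auto. intros z Hz. specialize (L z Hz).
      apply (f_equal x1) in L. unfold vdiff in L. autorewrite with vecs in L.
      destruct (diff_pd_pd (fun w => x1 (X w)) z) as [A [_ [_ B]]].
      rewrite <- A, <- B. exact L. }
  assert (H2 : harm U (fun z => x2 (X z)) (hgrad X (0, 1, 0))).
  { apply (harm_ext U (fun z => x2 (X z)) _
      (fun z => (pd1 (fun z => x2 (X z)) z, - pd2 (fun z => x2 (X z)) z))); auto.
    - intros z. unfold hgrad, vdiff. vsimp. rewrite !diff_e1, !diff_e2.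
      apply C_eq; Csimp; ring.
    - apply harm_of_laplace; auto. intros z Hz. specialize (L z Hz).
      apply (f_equal x2) in L. unfold vdiff in L. autorewrite with vecs in L.
      destruct (diff_pd_pd (fun w => x2 (X w)) z) as [A [_ [_ B]]].
      rewrite <- A, <- B. exact L. }
  assert (H3 : harm U (fun z => x3 (X z)) (hgrad X (0, 0, 1))).
  { apply (harm_ext U (fun z => x3 (X z)) _
      (fun z => (pd1 (fun z => x3 (X z)) z, - pd2 (fun z => x3 (X z)) z))); auto.
    - intros z. unfold hgrad, vdiff. vsimp. rewrite !diff_e1, !diff_e2.
      apply C_eq; Csimp; ring.
    - apply harm_of_laplace; auto. intros z Hz. specialize (L z Hz).
      apply (f_equal x3) in L. unfold vdiff in L. autorewrite with vecs in L.
      destruct (diff_pd_pd (fun w => x3 (X w)) z) as [A [_ [_ B]]].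
      rewrite <- A, <- B. exact L. }
  assert (H12 := harm_lin U _ _ _ _ (x1 b) (x2 b) H1 H2).
  assert (H123 := harm_lin U _ _ _ _ 1 (x3 b) H12 H3).
  refine (harm_ext U _ _ _ _ _ _ H123).
  - intros z. unfold dot. ring.
  - intros z. unfold hgrad. vsimp. apply C_eq; Csimp; ring.
Qed.

(** * Ribaucour pairs *)

Definition rib_vec (c : R) (Z Zt : C -> vec) (z : C) : vec := scal c (minus (Zt z) (Z z)).

(** The Ribaucour data enter only through [V = c (Zt - Z) = - (grad phi + rho N) / rho],
    which satisfies a closed first-order system. *)
Record rib_pair (U : C -> Prop) (c : R) (Z Zt : C -> vec) : Prop := {
  rp_c : c <> 0;
  rp_normal : forall z, U z -> dot (rib_vec c Z Zt z) (gauss_map Z z) = -1;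
  rp_neq_0 : forall z, U z -> 0 < dot (rib_vec c Z Zt z) (rib_vec c Z Zt z);
  rp_derive : forall z e, U z -> axis e -> scal c (vdiff Zt z e) =
    plus (scal (- (dot (rib_vec c Z Zt z) (rib_vec c Z Zt z) / 2)) (vdiff (gauss_map Z) z e))
         (scal (dot (rib_vec c Z Zt z) (vdiff (gauss_map Z) z e)) (rib_vec c Z Zt z));
  rp_gauss : forall z, U z -> gauss_map Zt z =
    plus (gauss_map Z z)
         (scal (2 / dot (rib_vec c Z Zt z) (rib_vec c Z Zt z)) (rib_vec c Z Zt z))
}.

Lemma rib_vec_vldiff (U : C -> Prop) (c : R) (Z Zt : C -> vec) (z e : C) :
  vsmooth_on U Z -> vsmooth_on U Zt -> U z -> axis e ->
  vldiff (rib_vec c Z Zt) z e (scal c (minus (vdiff Zt z e) (vdiff Z z e))).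
Proof.
  intros HZ HZt Hz He.
  eapply vldiff_eq.
  - apply (vldiff_scal (fun _ => c)); [apply ldiff_const|].
    apply vldiff_minus; apply (vsmooth_vldiff U); assumption.
  - apply vec_eq; autorewrite with vecs; ring.
Qed.

Lemma grad_normal (U : C -> Prop) (X : C -> vec) (phi : C -> R) (z : C) :
  immersion_on U X -> U z -> dot (grad X phi z) (gauss_map X z) = 0.
Proof.
  intros HX Hz. destruct (gauss_unit U X z HX Hz) as [_ H]. unfold grad.
  rewrite dot_plus_l, !dot_scal_l, !(dot_comm _ (gauss_map X z)).
  rewrite (H e1), (H e2) by (first [now left|now right]). ring.
Qed.

(** With [grad phi = - rho V - rho N], the Hessian equation prescribes the tangential part of
    [d(rho V)], and the relation [<V, N> = -1] its normal part. Together they determine [dV], hence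
    [c dZt = dV + c dZ]. *)
Lemma rib_pair_of_data (U : C -> Prop) (Z Zt : C -> vec) (c : R) (rho phi : C -> R) :
  openC U -> minimal_immersion_on U Z -> conformal_on U Z -> vsmooth_on U Zt ->
  ribaucour_data U Z Zt c rho phi -> rib_pair U c Z Zt.
Proof.
  intros HU HZ HC HZt RD.
  pose (V := rib_vec c Z Zt). pose (N := gauss_map Z).
  assert (Nc := rd_c _ _ _ _ _ _ RD).
  assert (Nrho := rd_rho_neq0 _ _ _ _ _ _ RD). assert (Nphi := rd_phi_neq0 _ _ _ _ _ _ RD).
  assert (HW : forall z, U z -> grad Z phi z = minus (scal (- rho z) (V z)) (scal (rho z) (N z))).
  { intros z Hz. unfold V, rib_vec. rewrite (rd_surface _ _ _ _ _ _ RD z Hz). fold N.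
    specialize (Nrho z Hz).
    apply vec_eq; autorewrite with vecs; field; now split. }
  assert (NN : forall z, U z -> dot (N z) (N z) = 1).
  { intros z Hz. exact (proj1 (gauss_unit U Z z (proj1 HZ) Hz)). }
  assert (VN : forall z, U z -> dot (V z) (N z) = -1).
  { intros z Hz. assert (G := grad_normal U Z phi z (proj1 HZ) Hz). fold N in G.
    rewrite (HW z Hz) in G. autorewrite with dots in G. rewrite (NN z Hz) in G.
    apply Rmult_eq_reg_l with (- rho z); [lra|]. specialize (Nrho z Hz). lra. }
  (* Since [|V + N|^2 = |V|^2 - 1], the equation for [|grad phi|^2] becomes a formula for [|V|^2];
     the nonvanishing of [phi] then keeps [V] away from zero. *)
  assert (VV : forall z, U z -> dot (V z) (V z) = 2 * (c * phi z / rho z)).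
  { intros z Hz. assert (G := rd_norm _ _ _ _ _ _ RD z Hz). rewrite (HW z Hz) in G.
    autorewrite with dots in G. rewrite (dot_comm (N z) (V z)), (NN z Hz), (VN z Hz) in G.
    specialize (Nrho z Hz).
    apply Rmult_eq_reg_l with (rho z * rho z); [|now apply Rmult_integral_contrapositive].
    transitivity (2 * c * rho z * phi z); [lra|field; exact Nrho]. }
  assert (VV0 : forall z, U z -> 0 < dot (V z) (V z)).
  { intros z Hz. destruct (dot_pos (V z)) as [P|P]; [exact P|].
    rewrite VV in P by exact Hz. exfalso.
    assert (Q : c * phi z = 0).
    { apply Rmult_eq_reg_l with (2 / rho z).
      - transitivity (2 * (c * phi z / rho z)); [field; now apply Nrho|lra].
      - apply Rmult_integral_contrapositive; split; [lra|].
        apply Rinv_neq_0_compat. now apply Nrho. }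
    apply Rmult_integral in Q. destruct Q; [now apply Nc|now apply (Nphi z)]. }
  constructor; auto.
  - intros z e Hz He. fold V. fold N. change (gauss_map Z) with N.
    destruct (HU z Hz) as [d [Hd HB]].
    assert (DN := gauss_vldiff U Z z e (proj1 HZ) Hz He). fold N in DN.
    assert (DV := rib_vec_vldiff U c Z Zt z e (proj1 (proj1 HZ)) HZt Hz He). fold V in DV.
    assert (Drho := smooth_ldiff U rho z e (rd_rho_smooth _ _ _ _ _ _ RD) Hz He).
    set (dV := scal c (minus (vdiff Zt z e) (vdiff Z z e))) in *.
    assert (DW := vldiff_scal _ _ _ _ _ _ (ldiff_opp _ _ _ _ Drho) DV).
    assert (DrN := vldiff_scal _ _ _ _ _ _ Drho DN).
    assert (DG : vldiff (grad Z phi) z e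
       (minus (plus (scal (- diff rho z e) (V z)) (scal (- rho z) dV))
              (plus (scal (diff rho z e) (N z)) (scal (rho z) (vdiff N z e))))).
    { refine (vldiff_ext _ _ z e _ d He Hd _ (vldiff_minus _ _ _ _ _ _ DW DrN)).
      intros w Hw. symmetry. apply HW, HB, Hw. }
    apply (vldiff_vdiff _ _ _ _ He) in DG.
    set (A := plus (scal (- diff rho z e) (V z)) (scal (- rho z) dV)) in *.
    assert (NeN : dot (vdiff N z e) (N z) = 0).
    { exact (proj1 (gauss_derive U Z z e HU (proj1 HZ) Hz He)). }
    assert (Dr : diff rho z e = - (rho z * dot (V z) (vdiff N z e))).
    { assert (Q := rd_drho _ _ _ _ _ _ RD z e Hz). rewrite (HW z Hz) in Q.
      fold N in Q. rewrite Q. autorewrite with dots. rewrite (dot_comm (N z)), NeN. ring. }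
    (* [A] is the derivative of [- rho V]. The remaining term [rho dN] of the derivative of
       [grad phi] cancels the summand [rho II] of the Hessian equation. *)
    assert (HAX : forall e', axis e' -> dot A (vdiff Z z e') =
       c * rho z * dot (vdiff Z z e) (vdiff Z z e')
       + c * phi z * dot (vdiff N z e) (vdiff Z z e')).
    { intros e' He'. assert (Q := rd_hess _ _ _ _ _ _ RD z e e' Hz).
      unfold hess, second_form, first_form in Q. fold N in Q. change (gauss_map Z) with N in Q.
      rewrite DG in Q.
      assert (S : dot (vdiff Z z e) (vdiff N z e') = dot (vdiff N z e) (vdiff Z z e')).
      { assert (S0 := gauss_symmetric U Z z HU (proj1 HZ) Hz). fold N in S0.
        change (gauss_map Z) with N in S0. rewrite (dot_comm (vdiff Z z e)).
        destruct He as [->| ->], He' as [->| ->]; auto. }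
      rewrite S in Q. rewrite dot_minus_l, (dot_plus_l (scal (diff rho z e) (N z))), !dot_scal_l in Q.
      unfold N in Q at 1. rewrite (proj2 (gauss_unit U Z z (proj1 HZ) Hz) e' He') in Q.
      fold N in Q. lra. }
    (* Differentiating [<- rho V, N> = rho] leaves two equal terms, because
       [d rho = - rho <V, dN>]. *)
    assert (HAN : dot A (N z) = 0).
    { assert (D := ldiff_minus _ _ _ _ _ _ (ldiff_dot _ _ _ _ _ _ DW DN) Drho).
      assert (PF : forall w, Cmod (w - z)%C < d ->
        dot (scal (- rho w) (V w)) (N w) - rho w = 0).
      { intros w Hw. rewrite dot_scal_l, VN by (apply HB, Hw). ring. }
      assert (Q := ldiff_of_const _ z e 0 _ d He Hd PF D). cbv beta in Q.
      assert (Q' : dot A (N z) + - rho z * dot (V z) (vdiff N z e) - diff rho z e = 0).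
      { rewrite <- Q. now rewrite dot_scal_l. }
      rewrite Dr in Q'. lra. }
    assert (EA : A = plus (scal (c * rho z) (vdiff Z z e)) (scal (c * phi z) (vdiff N z e))).
    { apply (of_eq _ _ _ _ _ _ (conformal_frame U Z z (proj1 HZ) HC Hz)).
      - rewrite HAX by now left. autorewrite with dots. ring.
      - rewrite HAX by now right. autorewrite with dots. ring.
      - fold N. rewrite HAN. autorewrite with dots. rewrite NeN, (dot_comm (vdiff Z z e)).
        unfold N. rewrite (proj2 (gauss_unit U Z z (proj1 HZ) Hz) e He). ring. }
    rewrite (VV z Hz). unfold A, dV in EA. rewrite Dr in EA. specialize (Nrho z Hz).
    set (al := dot (V z) (vdiff N z e)) in *.
    assert (E1 := f_equal x1 EA). assert (E2 := f_equal x2 EA). assert (E3 := f_equal x3 EA).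
    autorewrite with vecs in E1, E2, E3.
    apply vec_eq; autorewrite with vecs; apply Rmult_eq_reg_l with (rho z); try exact Nrho.
    + transitivity (rho z * (al * x1 (V z)) - c * phi z * x1 (vdiff N z e)); [lra|field; exact Nrho].
    + transitivity (rho z * (al * x2 (V z)) - c * phi z * x2 (vdiff N z e)); [lra|field; exact Nrho].
    + transitivity (rho z * (al * x3 (V z)) - c * phi z * x3 (vdiff N z e)); [lra|field; exact Nrho].
  - intros z Hz. fold V. rewrite (rd_gauss _ _ _ _ _ _ RD z Hz), (HW z Hz), (VV z Hz).
    fold N. specialize (Nrho z Hz). specialize (Nphi z Hz).
    apply vec_eq; autorewrite with vecs; field; auto.
Qed.

(** [c dZt] is [- |V|^2 / 2] times the image of [dN] under the reflection orthogonal to [V], and the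
    reflection preserves scalar products. *)
Lemma rib_first_form (U : C -> Prop) (c : R) (Z Zt : C -> vec) (z e e' : C) :
  rib_pair U c Z Zt -> U z -> axis e -> axis e' ->
  c * c * first_form Zt z e e' =
  dot (rib_vec c Z Zt z) (rib_vec c Z Zt z) ^ 2 / 4 *
  dot (vdiff (gauss_map Z) z e) (vdiff (gauss_map Z) z e').
Proof.
  intros RP Hz He He'. unfold first_form.
  transitivity (dot (scal c (vdiff Zt z e)) (scal c (vdiff Zt z e'))).
  { autorewrite with dots. ring. }
  rewrite !(rp_derive _ _ _ _ RP z) by assumption.
  autorewrite with dots.
  set (V := rib_vec c Z Zt z). set (q := dot V V).
  rewrite !(dot_comm _ V). field.
Qed.

(** The metric of [Zt] is proportional to the third fundamental form of [Z], which is conformal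
    because [Z] is minimal. *)
Lemma rib_conformal (U : C -> Prop) (c : R) (Z Zt : C -> vec) : openC U ->
  minimal_immersion_on U Z -> conformal_on U Z ->
  rib_pair U c Z Zt -> conformal_on U Zt.
Proof.
  intros HU HZ HC RP z Hz.
  destruct (minimal_gauss_conformal U Z z HU HZ HC Hz) as [G1 [G2 _]].
  assert (A1 : axis e1) by now left. assert (A2 : axis e2) by now right.
  assert (F11 := rib_first_form U c Z Zt z e1 e1 RP Hz A1 A1).
  assert (F22 := rib_first_form U c Z Zt z e2 e2 RP Hz A2 A2).
  assert (F12 := rib_first_form U c Z Zt z e1 e2 RP Hz A1 A2).
  rewrite G1 in F11. rewrite G2 in F12. assert (Nc := rp_c _ _ _ _ RP).
  assert (Ncc : c * c <> 0) by now apply Rmult_integral_contrapositive.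
  split; apply Rmult_eq_reg_l with (c * c); try exact Ncc.
  - now rewrite F11, F22.
  - rewrite F12. ring.
Qed.

(** By symmetry the right-hand side is the second form of [Z]: the two surfaces share it. The terms
    involving [V] cancel when the reflection formula for the normal is differentiated and paired
    with [rp_derive]. *)
Lemma rib_second_form (U : C -> Prop) (c : R) (Z Zt : C -> vec) (z e e' : C) : openC U ->
  immersion_on U Z -> vsmooth_on U Zt -> rib_pair U c Z Zt -> U z -> axis e -> axis e' ->
  second_form Zt z e e' = - dot (vdiff (gauss_map Z) z e) (vdiff Z z e').
Proof.
  intros HU HZ HZt RP Hz He He'. destruct (HU z Hz) as [d [Hd HB]].
  set (V := rib_vec c Z Zt). set (N := gauss_map Z).
  assert (DN := gauss_vldiff U Z z e' HZ Hz He'). fold N in DN.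
  assert (DV := rib_vec_vldiff U c Z Zt z e' (proj1 HZ) HZt Hz He'). fold V in DV.
  set (dV := scal c (minus (vdiff Zt z e') (vdiff Z z e'))) in *.
  assert (Pq := rp_neq_0 _ _ _ _ RP z Hz). fold V in Pq.
  assert (Nq : dot (V z) (V z) <> 0) by lra.
  assert (Dq := ldiff_inv _ _ _ _ (ldiff_dot _ _ _ _ _ _ DV DV) Nq).
  assert (D2q := ldiff_mult _ _ _ _ _ _ (ldiff_const 2 z e') Dq).
  assert (DNt := vldiff_plus _ _ _ _ _ _ DN (vldiff_scal _ _ _ _ _ _ D2q DV)).
  cbv beta in DNt.
  match type of DNt with vldiff _ _ _ ?v => set (v0 := v) in * end.
  assert (DG : vldiff (gauss_map Zt) z e' v0).
  { refine (vldiff_ext _ _ z e' _ d He' Hd _ DNt). intros w Hw.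
    rewrite (rp_gauss _ _ _ _ RP w (HB w Hw)). reflexivity. }
  unfold second_form. rewrite (vldiff_vdiff _ _ _ _ He' DG).
  assert (Nc := rp_c _ _ _ _ RP).
  assert (E := rp_derive _ _ _ _ RP z e Hz He). fold V N in E. change (gauss_map Z) with N in E.
  assert (E' := rp_derive _ _ _ _ RP z e' Hz He'). fold V N in E'. change (gauss_map Z) with N in E'.
  set (q := dot (V z) (V z)) in *.
  set (a := dot (V z) (vdiff N z e)) in *. set (b := dot (V z) (vdiff N z e')) in *.
  set (g := dot (vdiff N z e) (vdiff N z e')).
  set (s := dot (vdiff N z e) (vdiff Z z e')). set (m := dot (V z) (vdiff Z z e')).
  assert (HV : forall r, c * dot (vdiff Zt z e) r = - (q / 2) * dot (vdiff N z e) r + a * dot (V z) r).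
  { intros r. rewrite <- dot_scal_l, E. autorewrite with dots. ring. }
  assert (HdV : dV = minus (plus (scal (- (q / 2)) (vdiff N z e')) (scal b (V z)))
                          (scal c (vdiff Z z e'))).
  { unfold dV. rewrite <- E'. apply vec_eq; autorewrite with vecs; ring. }
  assert (VdV : dot (V z) dV = q / 2 * b - c * m).
  { rewrite HdV. autorewrite with dots. fold b q m. field. }
  apply Rmult_eq_reg_l with c; [|exact Nc].
  transitivity (- (c * dot (vdiff Zt z e) v0)); [ring|]. rewrite HV.
  unfold v0. autorewrite with dots. rewrite (dot_comm dV (V z)), VdV. fold q.
  rewrite HdV. autorewrite with dots. fold q b g s m a.
  rewrite (dot_comm (vdiff N z e) (V z)). fold a. field. exact Nq.
Qed.

(** Let [g] be the factor of the third form and [q = |V|^2]. The shared second form has determinant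
    [- E g], while the metric of [Zt] has factor [q^2 g / (4 c^2)]; the quotient no longer contains
    [g]. *)
Lemma rib_curvature (U : C -> Prop) (c : R) (Z Zt : C -> vec) (z : C) : openC U ->
  minimal_immersion_on U Z -> conformal_on U Z -> immersion_on U Zt ->
  rib_pair U c Z Zt -> U z ->
  Rabs (gauss_curvature Zt z) * area_density Zt z =
  4 * (c * c) * first_form Z z e1 e1 / dot (rib_vec c Z Zt z) (rib_vec c Z Zt z) ^ 2.
Proof.
  intros HU HZ HC HZt RP Hz.
  assert (A1 : axis e1) by now left. assert (A2 : axis e2) by now right.
  assert (F11 := rib_first_form U c Z Zt z e1 e1 RP Hz A1 A1).
  assert (CC := rib_conformal U c Z Zt HU HZ HC RP z Hz). destruct CC as [C1 C2].
  destruct (minimal_gauss_conformal U Z z HU HZ HC Hz) as [_ [_ G3]].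
  assert (T := minimal_trace U Z z HZ HC Hz).
  assert (S := gauss_symmetric U Z z HU (proj1 HZ) Hz).
  assert (PE := of_pos _ _ _ _ (conformal_frame U Z z (proj1 HZ) HC Hz)).
  assert (ND := proj2 HZt z Hz).
  assert (Pq := rp_neq_0 _ _ _ _ RP z Hz). assert (Nc := rp_c _ _ _ _ RP).
  unfold area_density, gauss_curvature.
  rewrite !(rib_second_form U c Z Zt z) by (assumption || exact (proj1 HZ) || exact (proj1 HZt)).
  replace (dot (vdiff (gauss_map Z) z e2) (vdiff Z z e2)) with
    (- dot (vdiff (gauss_map Z) z e1) (vdiff Z z e1)) by lra.
  unfold det_first in *. rewrite <- C1, C2 in *.
  set (Et := first_form Zt z e1 e1) in *. set (E := first_form Z z e1 e1) in *.
  set (q := dot (rib_vec c Z Zt z) (rib_vec c Z Zt z)) in *.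
  set (g := dot (vdiff (gauss_map Z) z e1) (vdiff (gauss_map Z) z e1)) in *.
  set (l := dot (vdiff (gauss_map Z) z e1) (vdiff Z z e1)) in *.
  set (m := dot (vdiff (gauss_map Z) z e1) (vdiff Z z e2)) in *.
  assert (PEt : 0 <= Et) by apply dot_pos.
  assert (NEt : Et <> 0) by (intros Q; apply ND; rewrite Q; ring).
  assert (PEt' : 0 < Et) by lra.
  assert (Ng : g <> 0).
  { intros Q. rewrite Q in F11. apply NEt.
    apply Rmult_eq_reg_l with (c * c); [lra|now apply Rmult_integral_contrapositive]. }
  replace (Et * Et - 0 ^ 2) with (Et * Et) by ring.
  rewrite sqrt_square by exact PEt.
  replace ((- l * - - l - (- m) ^ 2) / (Et * Et)) with (- (E * g / (Et * Et)))
    by (rewrite G3; field; exact NEt).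
  assert (Pg : 0 <= g) by apply dot_pos.
  rewrite Rabs_Ropp, Rabs_pos_eq.
  2:{ apply Rmult_le_pos; [nra|]. left. apply Rinv_0_lt_compat. nra. }
  assert (HEt : Et = q ^ 2 / 4 * g / (c * c)).
  { rewrite <- F11. field. exact Nc. }
  rewrite HEt. field. repeat split; try assumption; lra.
Qed.

(** * Behaviour at the puncture *)

Lemma ball_half (z w : C) : 0 < Cmod z -> Cmod (w - z)%C < Cmod z / 2 ->
  Cmod z / 2 < Cmod w < 2 * Cmod z.
Proof.
  intros Hz Hw. assert (T1 := Cmod_rev_triangle w z). assert (T2 := Cmod_rev_triangle z w).
  rewrite (Cmod_minus_sym z w) in T2. lra.
Qed.

(** The disk of radius [|z| / 2] about [z] stays in a dyadic annulus, so the gradient estimate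
    becomes scale invariant, with constant [16 = 8 * 2]. *)
Lemma harm_gradient_at (R0 M : R) (h : C -> R) (F : C -> C) (z : C) :
  harm (punctured_disk R0) h F -> 0 < Cmod z < R0 / 2 ->
  (forall w, Cmod z / 2 < Cmod w < 2 * Cmod z -> Rabs (h w) <= M) ->
  Cmod z * Cmod (F z) <= 16 * M.
Proof.
  intros Hh Hz HM.
  assert (B : Cmod (F z) <= 8 * M / (Cmod z / 2)).
  { apply (harm_gradient (punctured_disk R0) h F z (Cmod z / 2) M Hh); [lra| |].
    - intros w Hw. apply ball_half in Hw; [|lra]. split; lra.
    - intros w Hw. apply HM, ball_half; lra. }
  apply (Rmult_le_compat_l (Cmod z)) in B; [|lra].
  replace (Cmod z * (8 * M / (Cmod z / 2))) with (16 * M) in B by (field; lra). exact B.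
Qed.

Lemma hol_gradient_at (R0 M : R) (p dp : C -> C) (z : C) :
  hol (punctured_disk R0) p dp -> 0 < Cmod z < R0 / 2 ->
  (forall w, Cmod z / 2 < Cmod w < 2 * Cmod z -> Cmod (p w) <= M) ->
  Cmod z * Cmod (dp z) <= 16 * M.
Proof.
  intros Hh Hz HM.
  assert (B : Cmod (dp z) <= 8 * M / (Cmod z / 2)).
  { apply (Cauchy_estimate (punctured_disk R0) p dp z (Cmod z / 2) M Hh); [lra| |].
    - intros w Hw. apply ball_half in Hw; [|lra]. split; lra.
    - intros w Hw. apply HM, ball_half; lra. }
  apply (Rmult_le_compat_l (Cmod z)) in B; [|lra].
  replace (Cmod z * (8 * M / (Cmod z / 2))) with (16 * M) in B by (field; lra). exact B.
Qed.

Lemma limC_0_intro (F : C -> C) :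
  (forall e, 0 < e -> exists d, 0 < d /\ forall w, 0 < Cmod w < d -> Cmod (F w) <= e) ->
  limC F 0 0.
Proof.
  intros H e He. destruct (H (e / 2) ltac:(lra)) as [d [Hd H']]. exists d.
  split; [exact Hd|]. intros w. rewrite !Cminus_0. intros Hw. specialize (H' w Hw). lra.
Qed.

Lemma limC_0_elim (F : C -> C) (e : R) : limC F 0 0 -> 0 < e ->
  exists d, 0 < d /\ forall w, 0 < Cmod w < d -> Cmod (F w) < e.
Proof.
  intros H He. destruct (H e He) as [d [Hd H']]. exists d. split; [exact Hd|].
  intros w Hw. specialize (H' w). rewrite !Cminus_0 in H'. now apply H'.
Qed.

Lemma harm_limit_gradient (R0 : R) (h : C -> R) (F : C -> C) : 0 < R0 ->
  harm (punctured_disk R0) h F -> limC (fun z => RtoC (h z)) 0 0 ->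
  limC (fun z => z * F z)%C 0 0.
Proof.
  intros HR Hh Hl. apply limC_0_intro. intros e He.
  destruct (limC_0_elim _ (e / 16) Hl ltac:(lra)) as [d [Hd H]].
  exists (Rmin (R0 / 2) (d / 2)). split; [apply Rmin_pos; lra|]. intros z Hz.
  assert (A1 := Rmin_l (R0 / 2) (d / 2)). assert (A2 := Rmin_r (R0 / 2) (d / 2)).
  rewrite Cmod_mult. replace e with (16 * (e / 16)) by field.
  apply (harm_gradient_at R0 (e / 16) h F z Hh); [lra|].
  intros w Hw. rewrite <- Cmod_R. left. apply H. lra.
Qed.

Lemma harm_limit_gradient2 (R0 : R) (h : C -> R) (F : C -> C) : 0 < R0 ->
  harm (punctured_disk R0) h F -> limC (fun z => z * RtoC (h z))%C 0 0 ->
  limC (fun z => z * z * F z)%C 0 0.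
Proof.
  intros HR Hh Hl. apply limC_0_intro. intros e He.
  destruct (limC_0_elim _ (e / 32) Hl ltac:(lra)) as [d [Hd H]].
  exists (Rmin (R0 / 2) (d / 2)). split; [apply Rmin_pos; lra|]. intros z Hz.
  assert (A1 := Rmin_l (R0 / 2) (d / 2)). assert (A2 := Rmin_r (R0 / 2) (d / 2)).
  assert (B : Cmod z * Cmod (F z) <= 16 * (e / 16 / Cmod z)).
  { apply (harm_gradient_at R0 _ h F z Hh); [lra|].
    intros w Hw. specialize (H w ltac:(lra)). rewrite Cmod_mult, Cmod_R in H.
    apply Rmult_le_reg_l with (Cmod w); [lra|].
    apply Rle_trans with (e / 32); [lra|].
    replace (Cmod w * (e / 16 / Cmod z)) with (e / 32 * (2 * Cmod w / Cmod z)) by (field; lra).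
    assert (1 <= 2 * Cmod w / Cmod z).
    { apply Rmult_le_reg_r with (Cmod z); [lra|].
      replace (2 * Cmod w / Cmod z * Cmod z) with (2 * Cmod w) by (field; lra). lra. }
    nra. }
  rewrite !Cmod_mult, Rmult_assoc.
  apply (Rmult_le_compat_l (Cmod z)) in B; [|lra].
  replace (Cmod z * (16 * (e / 16 / Cmod z))) with e in B by (field; lra). exact B.
Qed.

Lemma hol_limit_gradient (R0 : R) (p dp : C -> C) (l : C) : 0 < R0 ->
  hol (punctured_disk R0) p dp -> limC p 0 l -> limC (fun z => z * dp z)%C 0 0.
Proof.
  intros HR Hp Hl. apply limC_0_minus in Hl.
  assert (Hp2 : hol (punctured_disk R0) (fun z => p z + - l)%C (fun z => dp z + 0)%C).
  { apply hol_plus; [exact Hp|apply hol_const]. }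
  apply limC_0_intro. intros e He.
  destruct (limC_0_elim _ (e / 16) Hl ltac:(lra)) as [d [Hd H]].
  exists (Rmin (R0 / 2) (d / 2)). split; [apply Rmin_pos; lra|]. intros z Hz.
  assert (A1 := Rmin_l (R0 / 2) (d / 2)). assert (A2 := Rmin_r (R0 / 2) (d / 2)).
  rewrite Cmod_mult. replace e with (16 * (e / 16)) by field.
  assert (B := hol_gradient_at R0 (e / 16) _ _ z Hp2 ltac:(lra)). cbv beta in B.
  replace (dp z + 0)%C with (dp z) in B by ring. apply B.
  intros w Hw. left. apply H. lra.
Qed.

(** The gradient estimate is applied to [p - l z], which is [o(z)]. *)
Lemma hol_limit_derivative (R0 : R) (p dp : C -> C) (l : C) : 0 < R0 ->
  hol (punctured_disk R0) p dp -> limC (fun z => p z / z)%C 0 l -> limC dp 0 l.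
Proof.
  intros HR Hp Hl. apply limC_0_minus in Hl. apply limC_0_minus.
  assert (Hp2 : hol (punctured_disk R0) (fun z => p z + - l * z)%C (fun z => dp z + - l * 1)%C).
  { apply hol_plus; [exact Hp|apply hol_scal, hol_id]. }
  apply limC_0_intro. intros e He.
  destruct (limC_0_elim _ (e / 32) Hl ltac:(lra)) as [d [Hd H]].
  exists (Rmin (R0 / 2) (d / 2)). split; [apply Rmin_pos; lra|]. intros z Hz.
  assert (A1 := Rmin_l (R0 / 2) (d / 2)). assert (A2 := Rmin_r (R0 / 2) (d / 2)).
  assert (B := hol_gradient_at R0 (e / 16 * Cmod z) _ _ z Hp2 ltac:(lra)). cbv beta in B.
  replace (dp z + - l * 1)%C with (dp z - l)%C in B by ring.
  apply Rmult_le_reg_l with (Cmod z); [lra|].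
  replace (Cmod z * e) with (16 * (e / 16 * Cmod z)) by field. apply B.
  intros w Hw. specialize (H w ltac:(lra)).
  assert (Nw : w <> 0) by (apply Cmod_gt_0; lra).
  replace (p w + - l * w)%C with ((p w / w - l) * w)%C by (field; exact Nw).
  rewrite Cmod_mult. assert (Q := Cmod_ge_0 (p w / w - l)%C). nra.
Qed.

Lemma harm_Re (U : C -> Prop) (F dF ddF : C -> C) : hol U F dF -> hol U dF ddF ->
  harm U (fun z => Re (F z)) dF.
Proof.
  intros H1 H2. split; [exists ddF; exact H2|].
  intros z Hz. exact (proj1 (cdiff_rdiff _ _ _ (proj1 (H1 z Hz)))).
Qed.

Lemma punctured_neq_0 (R0 : R) (z : C) : punctured_disk R0 z -> z <> 0.
Proof. intros [H _]. now apply Cmod_gt_0. Qed.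

Lemma harm_Re_inv (R0 : R) (A : C) :
  harm (punctured_disk R0) (fun z => Re (A / z)%C) (fun z => - A / (z * z))%C.
Proof.
  assert (H1 := hol_div (punctured_disk R0) _ _ _ _ (hol_const _ A) (hol_id _)
     (punctured_neq_0 R0)).
  assert (H2 := hol_div (punctured_disk R0) _ _ _ _ (hol_const _ (- A)%C)
     (hol_mult _ _ _ _ _ (hol_id _) (hol_id _))
     (fun z Hz => Cmult_neq_0 z z (punctured_neq_0 R0 z Hz) (punctured_neq_0 R0 z Hz))).
  split; [eexists; exact H2|]. intros z Hz.
  assert (Nz := punctured_neq_0 R0 z Hz).
  assert (D := proj1 (cdiff_rdiff _ _ _ (proj1 (H1 z Hz)))).
  cbv beta in D. replace (- A / (z * z))%C with ((0 * z - A * 1) / (z * z))%C; [exact D|].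
  f_equal. ring.
Qed.

Lemma Cmod_sq (z : C) : Cmod z * Cmod z = Re z * Re z + Im z * Im z.
Proof. assert (H := Cmod2_alt z). nra. Qed.

Lemma Cinv_parts (z : C) : z <> 0 ->
  Re (/ z)%C = Re z / (Cmod z * Cmod z) /\ Im (/ z)%C = - Im z / (Cmod z * Cmod z).
Proof.
  intros Hz. rewrite Cmod_sq. unfold Cinv, Re, Im; simpl.
  split; f_equal; f_equal; ring.
Qed.

Lemma harm_ln (R0 : R) : harm (punctured_disk R0) (fun z => ln (Cmod z)) (fun z => / z)%C.
Proof.
  assert (H2 := hol_div (punctured_disk R0) _ _ _ _ (hol_const _ (RtoC 1)) (hol_id _)
     (punctured_neq_0 R0)).
  split.
  - eexists. intros z Hz. destruct (H2 z Hz) as [A1 A2]. split; [|exact A2].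
    apply (cdiff_ext (fun z => 1 / z)%C _ z _ 1 Rlt_0_1); [|exact A1].
    intros w _. unfold Cdiv. ring.
  - intros z Hz. destruct (open_punctured R0 z Hz) as [d [Hd HB]].
    assert (POS : forall w, punctured_disk R0 w -> 0 < Re w * Re w + Im w * Im w).
    { intros w [Hw _]. rewrite <- Cmod_sq. nra. }
    assert (FX : forall x y, Cmod (x, y) = sqrt (x * x + y * y)).
    { intros x y. unfold Cmod; simpl. f_equal. ring. }
    assert (D1 : forall w, punctured_disk R0 w -> ldiff (fun z => ln (Cmod z)) w e1 (Re (/ w)%C)).
    { intros w Hw. apply (proj2 (ldiff_e1 (fun z => ln (Cmod z)) w _)).
      apply (is_derive_ext (fun t => ln (sqrt (t * t + Im w * Im w)))).
      { intros t. now rewrite FX. }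
      specialize (POS w Hw).
      assert (SQ : 0 < sqrt (Re w * Re w + Im w * Im w)) by now apply sqrt_lt_R0.
      auto_derive; [repeat split; assumption|].
      rewrite (proj1 (Cinv_parts w (punctured_neq_0 R0 w Hw))), Cmod_sq.
      assert (S := sqrt_sqrt (Re w * Re w + Im w * Im w) ltac:(lra)).
      rewrite <- S at 3. field. lra. }
    assert (D2 : ldiff (fun z => ln (Cmod z)) z e2 (- Im (/ z)%C)).
    { apply (proj2 (ldiff_e2 (fun z => ln (Cmod z)) z _)).
      apply (is_derive_ext (fun t => ln (sqrt (Re z * Re z + t * t)))).
      { intros t. now rewrite FX. }
      specialize (POS z Hz).
      assert (SQ : 0 < sqrt (Re z * Re z + Im z * Im z)) by now apply sqrt_lt_R0.
      auto_derive; [repeat split; assumption|].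
      rewrite (proj2 (Cinv_parts z (punctured_neq_0 R0 z Hz))), Cmod_sq.
      assert (S := sqrt_sqrt (Re z * Re z + Im z * Im z) ltac:(lra)).
      rewrite <- S at 3. field. lra. }
    apply (rdiff_of_partials (fun z => ln (Cmod z)) (fun w => Re (/ w)%C) z _ d Hd).
    + intros w Hw. apply D1, HB, Hw.
    + exact D2.
    + apply (contC_2d (fun w => / w)%C z). apply (contC_inv (fun w => w)).
      * apply limC_id.
      * exact (punctured_neq_0 R0 z Hz).
Qed.

Lemma harm_pole_gradient (R0 : R) (h : C -> R) (F : C -> C) (A : C) : 0 < R0 ->
  harm (punctured_disk R0) h F ->
  limC (fun z => z * RtoC (h z - Re (A / z)%C))%C 0 0 ->
  limC (fun z => z * z * F z)%C 0 (- A)%C.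
Proof.
  intros HR Hh Hl.
  assert (H := harm_lin _ _ _ _ _ 1 (-1) Hh (harm_Re_inv R0 A)). cbv beta in H.
  assert (L := harm_limit_gradient2 R0 _ _ HR H).
  apply limC_0_minus.
  apply (limC_ext_0 (fun z => z * z * (RtoC 1 * F z + RtoC (-1) * (- A / (z * z))))%C _ _ 1 Rlt_0_1).
  - intros w Hw. assert (Nw : w <> 0) by (apply Cmod_gt_0; lra).
    replace (RtoC (-1)) with (- RtoC 1)%C by (apply C_eq; Csimp; ring). field. exact Nw.
  - apply L. apply (limC_ext_0 (fun z => z * RtoC (h z - Re (A / z)%C))%C _ _ 1 Rlt_0_1); [|exact Hl].
    intros w _. f_equal. f_equal. ring.
Qed.

(** * Frames adapted to a catenoid *)

Lemma norm3_eq_dot (p q : vec) : norm3 p = norm3 q -> dot p p = dot q q.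
Proof. intros H. rewrite <- !norm3_sq. now rewrite H. Qed.

Definition frame_map (be a b n : vec) (sg : R) (p : vec) : vec :=
  plus be (plus (plus (scal (x1 p) a) (scal (x2 p) b)) (scal (sg * x3 p) n)).

(* The frame is direct, so that an improper isometry shows up as [sg = -1]. *)
Lemma rigid_frame (T : vec -> vec) : rigid_motion T ->
  exists be a b n sg, oframe a b n 1 /\ sg * sg = 1 /\ forall p, T p = frame_map be a b n sg p.
Proof.
  intros HT. set (o := (0, 0, 0) : vec).
  pose (L := fun p => minus (T p) (T o) : vec).
  assert (L1 : forall p, dot (L p) (L p) = dot p p).
  { intros p. unfold L. rewrite (norm3_eq_dot _ _ (HT p o)). unfold o. vsimp. ring. }
  assert (L2 : forall p q, dot (L p) (L q) = dot p q).
  { intros p q.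
    assert (Q := norm3_eq_dot _ _ (HT p q)).
    replace (minus (T p) (T q)) with (minus (L p) (L q)) in Q
      by (unfold L; apply vec_eq; autorewrite with vecs; ring).
    autorewrite with dots in Q. rewrite (dot_comm (L q) (L p)), (dot_comm q p), !L1 in Q. lra. }
  set (i1 := (1, 0, 0) : vec). set (i2 := (0, 1, 0) : vec). set (i3 := (0, 0, 1) : vec).
  assert (F : oframe (L i1) (L i2) (cross (L i1) (L i2)) 1).
  { constructor; rewrite ?L2; unfold i1, i2; try (vsimp; ring); try lra.
    apply vec_eq; autorewrite with vecs; ring. }
  set (n := cross (L i1) (L i2)) in *.
  set (sg := dot (L i3) n).
  assert (PV : forall p q, dot p q = dot p (L i1) * dot q (L i1) + dot p (L i2) * dot q (L i2)
     + dot p n * dot q n).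
  { intros p q. assert (Q := of_parseval _ _ _ _ p q F). lra. }
  assert (D1 : forall p, dot (L p) (L i1) = x1 p) by (intros p; rewrite L2; unfold i1; vsimp; ring).
  assert (D2 : forall p, dot (L p) (L i2) = x2 p) by (intros p; rewrite L2; unfold i2; vsimp; ring).
  assert (D3 : forall p, dot (L p) (L i3) = x3 p) by (intros p; rewrite L2; unfold i3; vsimp; ring).
  assert (HS : sg * sg = 1).
  { assert (Q := PV (L i3) (L i3)). rewrite D3, D1, D2 in Q. fold sg in Q.
    unfold i3 in Q. autorewrite with vecs in Q. lra. }
  exists (T o), (L i1), (L i2), n, sg. split; [exact F|split; [exact HS|]].
  intros p. unfold frame_map.
  assert (E : L p = plus (plus (scal (x1 p) (L i1)) (scal (x2 p) (L i2))) (scal (sg * x3 p) n)).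
  { destruct (of_n _ _ _ _ F) as [N1 [N2 N3]].
    apply (of_eq _ _ _ _ _ _ F); autorewrite with dots.
    - rewrite D1, (L2 i2 i1), (L2 i1 i1), N2. unfold i1, i2. vsimp. ring.
    - rewrite D2, (L2 i2 i2), (L2 i1 i2), N3. unfold i1, i2. vsimp. ring.
    - rewrite N1, (dot_comm (L i1)), (dot_comm (L i2)), N2, N3.
      assert (Q := PV (L p) (L i3)). rewrite D3, !D1, !D2 in Q. fold sg in Q.
      unfold i3 in Q. autorewrite with vecs in Q.
      rewrite Q. transitivity (dot (L p) n * (sg * sg)); [rewrite HS|]; ring. }
  rewrite <- E. unfold L. apply vec_eq; autorewrite with vecs; ring.
Qed.

Lemma frame_map_dot (be a b n : vec) (sg : R) (p : vec) : oframe a b n 1 ->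
  dot (frame_map be a b n sg p) a = dot be a + x1 p /\
  dot (frame_map be a b n sg p) b = dot be b + x2 p /\
  dot (frame_map be a b n sg p) n = dot be n + sg * x3 p.
Proof.
  intros F. destruct (of_n _ _ _ _ F) as [N1 [N2 N3]]. destruct F as [_ F1 F2 F3 _].
  unfold frame_map. autorewrite with dots.
  rewrite N1, N2, N3, (dot_comm a n), (dot_comm b n), N2, N3, (dot_comm b a), F1, F2, F3.
  repeat split; ring.
Qed.

Lemma cosh_ln (z : C) : z <> 0 -> cosh (ln (Cmod z)) = (Cmod z + / Cmod z) / 2.
Proof.
  intros Hz. assert (P : 0 < Cmod z) by now apply Cmod_gt_0.
  unfold cosh. rewrite exp_ln, exp_Ropp, exp_ln by exact P. reflexivity.
Qed.

(** The left side is [cosh (ln |w|) conj w / |w|], and [conj w / |w|^2 = 1 / w]. *)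
Lemma catenoid_horizontal (w : C) : w <> 0 ->
  ((x1 (catenoid w), - x2 (catenoid w)) : C) = ((Cconj w + / w) / 2)%C.
Proof.
  intros Hw. assert (P : 0 < Cmod w) by now apply Cmod_gt_0.
  destruct (Cinv_parts w Hw) as [I1 I2].
  unfold catenoid. autorewrite with vecs. rewrite cosh_ln by exact Hw.
  replace ((Cconj w + / w) / 2)%C with (RtoC (/ 2) * (Cconj w + / w))%C.
  2:{ rewrite RtoC_inv by lra. field.
      repeat split; try exact Hw; intros E; apply RtoC_inj in E; lra. }
  apply C_eq; Csimp; rewrite ?I1, ?I2; field; lra.
Qed.

(** The neighbourhoods of the filter are squares; the square of half-side [d / 2] lies in the disk
    of radius [d]. *)
Lemma locally'_iff (P : C -> Prop) :
  locally' (RtoC 0) P <-> exists d, 0 < d /\ forall w, 0 < Cmod w < d -> P w.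
Proof.
  split.
  - intros [d H]. exists d. split; [apply cond_pos|]. intros w Hw. apply H.
    + split.
      * change (Rabs (Re w - 0) < d). rewrite Rminus_0_r.
        eapply Rle_lt_trans; [apply re_le_Cmod|apply Hw].
      * change (Rabs (Im w - 0) < d). rewrite Rminus_0_r.
        eapply Rle_lt_trans; [apply im_le_Cmod|apply Hw].
    + apply Cmod_gt_0, Hw.
  - intros [d [Hd H]]. assert (Hd2 : 0 < d / 2) by lra. exists (mkposreal _ Hd2).
    intros w [H1 H2] Hn. apply H. split; [now apply Cmod_gt_0|].
    change (Rabs (Re w - 0) < d / 2) in H1. change (Rabs (Im w - 0) < d / 2) in H2.
    rewrite Rminus_0_r in H1, H2.
    eapply Rle_lt_trans; [apply Cmod_le_Re_Im|]. lra.
Qed.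

Lemma filterlim_limC (f : C -> R) (l : R) :
  filterlim f (locally' (RtoC 0)) (locally l) <-> limC (fun z => RtoC (f z)) 0 (RtoC l).
Proof.
  split.
  - intros H e He.
    assert (Q : locally' (RtoC 0) (fun z => Rabs (f z - l) < e)).
    { apply (H (fun y => Rabs (y - l) < e)). exists (mkposreal e He). intros y Hy. exact Hy. }
    apply locally'_iff in Q. destruct Q as [d [Hd Q]]. exists d. split; [exact Hd|].
    intros w. rewrite Cminus_0. intros Hw. rewrite <- RtoC_minus, Cmod_R. now apply Q.
  - intros H P [e HP].
    destruct (H e (cond_pos e)) as [d [Hd Q]]. apply locally'_iff. exists d. split; [exact Hd|].
    intros w Hw. apply HP. specialize (Q w). rewrite Cminus_0, <- RtoC_minus, Cmod_R in Q.
    exact (Q Hw).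
Qed.

Lemma frame_norm (a b n p : vec) : oframe a b n 1 ->
  norm3 p <= Rabs (dot p a) + Rabs (dot p b) + Rabs (dot p n).
Proof.
  intros F. assert (Q := of_parseval _ _ _ _ p p F).
  assert (P1 := Rabs_pos (dot p a)). assert (P2 := Rabs_pos (dot p b)).
  assert (P3 := Rabs_pos (dot p n)).
  apply Rsqr_incr_0_var; [|lra]. unfold Rsqr. rewrite norm3_sq.
  assert (forall x, x * x = Rabs x * Rabs x).
  { intros x. rewrite <- Rabs_mult, Rabs_pos_eq; nra. }
  rewrite (H (dot p a)), (H (dot p b)), (H (dot p n)) in Q. nra.
Qed.

Lemma frame_norm_ge (a b n p : vec) : oframe a b n 1 ->
  Rabs (dot p a) <= norm3 p /\ Rabs (dot p b) <= norm3 p /\ Rabs (dot p n) <= norm3 p.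
Proof.
  intros F. assert (Q := of_parseval _ _ _ _ p p F).
  assert (P : 0 <= norm3 p) by apply sqrt_pos.
  assert (H : forall x, x * x <= dot p p -> Rabs x <= norm3 p).
  { intros x Hx. apply Rsqr_incr_0_var; [|exact P]. unfold Rsqr. rewrite norm3_sq.
    rewrite <- Rabs_mult, Rabs_pos_eq; nra. }
  repeat split; apply H; nra.
Qed.

(** The conjugate of the usual horizontal coordinate: on a catenoid end its polar part is the
    meromorphic function [1 / (2 w)]. *)
Definition hvec (a b p : vec) : C := (dot p a, - dot p b).

Definition hcoord (X : C -> vec) (a b : vec) (z : C) : C := hvec a b (X z).

(** * Being asymptotic to a catenoid, in coordinates *)

Lemma conformal_change_limit (w : C -> C) : conformal_change w ->
  exists al : C, al <> 0 /\ w 0 = 0 /\ limC (fun z => w z / z)%C 0 al.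
Proof.
  intros [W0 [_ [al [Hal D]]]]. exists al. split; [exact Hal|split; [exact W0|]].
  apply cdiff_is_derive in D.
  apply (limC_ext_0 (fun z => (w z - w 0) / (z - 0))%C _ _ 1 Rlt_0_1); [|exact D].
  intros z _. rewrite W0, !Cminus_0. reflexivity.
Qed.

Lemma change_small (w : C -> C) (al : C) : limC (fun z => w z / z)%C 0 al -> limC w 0 0.
Proof.
  intros H. assert (L := limC_mult _ _ _ _ _ H (limC_id 0)).
  replace (al * 0)%C with (RtoC 0) in L by ring.
  apply (limC_ext_0 (fun z => w z / z * z)%C _ _ 1 Rlt_0_1); [|exact L].
  intros z Hz. field. apply Cmod_gt_0. lra.
Qed.

Lemma change_neq_0 (w : C -> C) (al : C) : al <> 0 -> limC (fun z => w z / z)%C 0 al ->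
  exists d, 0 < d /\ forall z, 0 < Cmod z < d -> w z <> 0.
Proof.
  intros Ha H. destruct (limC_apart _ _ _ H Ha) as [d [Hd Q]]. exists d. split; [exact Hd|].
  intros z Hz E. specialize (Q z). rewrite Cminus_0 in Q. specialize (Q Hz).
  rewrite E in Q. replace (0 / z)%C with (RtoC 0) in Q by (unfold Cdiv; ring).
  rewrite Cmod_0 in Q. assert (P := Cmod_ge_0 al). lra.
Qed.

Lemma limC_of_norm (X Y : C -> vec) (e : vec) : (forall p, Rabs (dot p e) <= norm3 p) ->
  filterlim (fun z => norm3 (minus (X z) (Y z))) (locally' (RtoC 0)) (locally 0) ->
  limC (fun z => RtoC (dot (X z) e - dot (Y z) e)) 0 0.
Proof.
  intros He H. apply filterlim_limC in H.
  apply (limC_Cmod_le _ (fun z => RtoC (norm3 (minus (X z) (Y z)))) 0 1 1 Rlt_0_1); [|exact H].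
  intros z _. rewrite !Cmod_R, Rmult_1_l, (Rabs_pos_eq (norm3 _)) by apply sqrt_pos.
  rewrite <- dot_minus_l. apply He.
Qed.

Lemma limC_pair (f g : C -> R) (a b : R) :
  limC (fun z => RtoC (f z)) 0 (RtoC a) -> limC (fun z => RtoC (g z)) 0 (RtoC b) ->
  limC (fun z => (f z, g z)) 0 (a, b).
Proof.
  intros Hf Hg.
  replace ((a, b) : C) with (RtoC a + Ci * RtoC b)%C by (apply C_eq; Csimp; ring).
  apply (limC_ext_0 (fun z => RtoC (f z) + Ci * RtoC (g z))%C _ _ 1 Rlt_0_1).
  - intros z _. apply C_eq; Csimp; ring.
  - apply limC_plus; [exact Hf|]. apply limC_mult; [apply limC_const|exact Hg].
Qed.

Lemma catenoid_coordinates (be a b n : vec) (sg r : R) (w : C) : oframe a b n 1 -> w <> 0 ->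
  hvec a b (frame_map be a b n sg (scal r (catenoid w))) =
    (hvec a b be + RtoC (r / 2) * (Cconj w + / w))%C /\
  dot (frame_map be a b n sg (scal r (catenoid w))) n = dot be n + sg * r * ln (Cmod w).
Proof.
  intros F Hw.
  destruct (frame_map_dot be a b n sg (scal r (catenoid w)) F) as [D1 [D2 D3]].
  assert (CH := catenoid_horizontal w Hw). split.
  - unfold hcoord, hvec at 1. rewrite D1, D2. autorewrite with vecs.
    transitivity (hvec a b be + RtoC r * (x1 (catenoid w), (- x2 (catenoid w))%R))%C.
    + apply C_eq; unfold hvec; Csimp; ring.
    + rewrite CH. unfold Rdiv. rewrite RtoC_mult, RtoC_inv by lra. field.
      repeat split; try exact Hw; intros E; apply RtoC_inj in E; lra.
  - rewrite D3. autorewrite with vecs. unfold catenoid at 1. autorewrite with vecs. ring.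
Qed.

(** Convergence in norm is split along the adapted frame. Of the horizontal part
    [(r / 2) (conj w + 1 / w)] of the catenoid only the pole matters, as [conj w] tends to 0. *)
Lemma end_asymptotics (X : C -> vec) : asymptotic_to_catenoid X ->
  exists (be a b n : vec) (sg r : R) (w : C -> C) (al : C),
    rigid_motion (frame_map be a b n sg) /\ oframe a b n 1 /\ sg * sg = 1 /\ 0 < r /\
    conformal_change w /\ al <> 0 /\ limC (fun z => w z / z)%C 0 al /\
    limC (fun z => hcoord X a b z - RtoC (r / 2) / w z)%C 0 (hvec a b be) /\
    limC (fun z => RtoC (dot (X z) n - sg * r * ln (Cmod (w z)))) 0 (RtoC (dot be n)).
Proof.
  intros [T [r [w [HT [Hr [Hw HL]]]]]].
  destruct (rigid_frame T HT) as [be [a [b [n [sg [F [HS HTp]]]]]]].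
  destruct (conformal_change_limit w Hw) as [al [Hal [W0 Hwl]]].
  destruct (change_neq_0 w al Hal Hwl) as [d [Hd Nw]].
  exists be, a, b, n, sg, r, w, al.
  split.
  { intros p q. rewrite <- !HTp. apply HT. }
  split; [exact F|]. split; [exact HS|]. split; [exact Hr|]. split; [exact Hw|].
  split; [exact Hal|]. split; [exact Hwl|].
  assert (L1 := limC_of_norm X _ a (fun p => proj1 (frame_norm_ge a b n p F)) HL).
  assert (L2 := limC_of_norm X _ b (fun p => proj1 (proj2 (frame_norm_ge a b n p F))) HL).
  assert (L3 := limC_of_norm X _ n (fun p => proj2 (proj2 (frame_norm_ge a b n p F))) HL).
  split.
  - assert (L2' := limC_opp _ _ _ L2).
    replace (- 0)%C with (RtoC 0) in L2' by ring.
    assert (L2'' : limC (fun z => RtoC (- (dot (X z) b - dot (T (scal r (catenoid (w z)))) b))) 0 0).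
    { apply (limC_ext_0 (fun z => - RtoC (dot (X z) b - dot (T (scal r (catenoid (w z)))) b))%C
        _ _ 1 Rlt_0_1); [|exact L2']. intros z _. now rewrite RtoC_opp. }
    assert (L12 := limC_pair _ _ _ _ L1 L2'').
    assert (LW : limC (fun z => RtoC (r / 2) * Cconj (w z))%C 0 0).
    { assert (Q := limC_mult _ _ _ _ _ (limC_const (RtoC (r / 2)) 0)
        (limC_conj _ _ _ (change_small w al Hwl))).
      replace (RtoC (r / 2) * Cconj 0)%C with (RtoC 0) in Q by (apply C_eq; Csimp; ring).
      exact Q. }
    assert (LL := limC_plus _ _ _ _ _ (limC_plus _ _ _ _ _ L12 LW)
       (limC_const (hvec a b be) 0)).
    replace ((0, 0) + 0 + hvec a b be)%C with (hvec a b be) in LL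
      by (apply C_eq; unfold hvec; Csimp; ring).
    refine (limC_ext_0 _ _ _ d Hd _ LL).
    intros z Hz. specialize (Nw z Hz). cbv beta. rewrite HTp.
    destruct (catenoid_coordinates be a b n sg r (w z) F Nw) as [Q _].
    unfold hcoord in *.
    set (p := frame_map be a b n sg (scal r (catenoid (w z)))) in *.
    transitivity (hvec a b (X z) - hvec a b p +
      RtoC (r / 2) * Cconj (w z) + hvec a b be)%C.
    { apply C_eq; unfold hvec; Csimp; ring. }
    rewrite Q. field. exact Nw.
  - assert (LL := limC_plus _ _ _ _ _ L3 (limC_const (RtoC (dot be n)) 0)).
    replace (0 + RtoC (dot be n))%C with (RtoC (dot be n)) in LL by ring.
    refine (limC_ext_0 _ _ _ d Hd _ LL).
    intros z Hz. specialize (Nw z Hz). cbv beta. rewrite HTp.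
    rewrite (proj2 (catenoid_coordinates be a b n sg r (w z) F Nw)).
    rewrite <- RtoC_plus. f_equal. ring.
Qed.

(** Additive constants are absorbed by a translation: the linear part of the given motion is kept
    and its origin is rebuilt from the limits. *)
Lemma asymptotic_of_limits (X : C -> vec) (be a b n : vec) (sg r : R) (w : C -> C)
    (k : C) (k3 : R) :
  rigid_motion (frame_map be a b n sg) -> oframe a b n 1 -> 0 < r -> conformal_change w ->
  limC (fun z => hcoord X a b z - RtoC (r / 2) / w z)%C 0 k ->
  limC (fun z => RtoC (dot (X z) n - sg * r * ln (Cmod (w z)))) 0 (RtoC k3) ->
  asymptotic_to_catenoid X.
Proof.
  intros HT F Hr Hw H1 H2.
  destruct (conformal_change_limit w Hw) as [al [Hal [W0 Hwl]]].
  destruct (change_neq_0 w al Hal Hwl) as [d [Hd Nw]].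
  (* The sign of [Im k] compensates the conjugation in [hvec], so that [hvec a b be' = k]. *)
  set (be' := plus (plus (scal (Re k) a) (scal (- Im k) b)) (scal k3 n) : vec).
  assert (B : dot be' a = Re k /\ dot be' b = - Im k /\ dot be' n = k3).
  { destruct (of_n _ _ _ _ F) as [N1 [N2 N3]]. destruct F as [_ F1 F2 F3 _].
    unfold be'. autorewrite with dots.
    rewrite N1, N2, N3, (dot_comm a n), (dot_comm b n), N2, N3, (dot_comm b a), F1, F2, F3.
    repeat split; ring. }
  destruct B as [B1 [B2 B3]].
  exists (frame_map be' a b n sg), r, w.
  split.
  { intros p q. rewrite <- (HT p q). f_equal.
    unfold frame_map. apply vec_eq; autorewrite with vecs; ring. }
  split; [exact Hr|]. split; [exact Hw|].
  pose (Y := fun z => frame_map be' a b n sg (scal r (catenoid (w z)))).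
  assert (LW : limC (fun z => RtoC (r / 2) * Cconj (w z))%C 0 0).
  { assert (Q := limC_mult _ _ _ _ _ (limC_const (RtoC (r / 2)) 0)
      (limC_conj _ _ _ (change_small w al Hwl))).
    replace (RtoC (r / 2) * Cconj 0)%C with (RtoC 0) in Q by (apply C_eq; Csimp; ring).
    exact Q. }
  assert (LH : limC (fun z => hcoord X a b z - hcoord Y a b z)%C 0 0).
  { assert (Q := limC_minus _ _ _ _ _ (limC_minus _ _ _ _ _ H1 LW) (limC_const k 0)).
    replace (k - 0 - k)%C with (RtoC 0) in Q by ring.
    refine (limC_ext_0 _ _ _ d Hd _ Q). intros z Hz. specialize (Nw z Hz). cbv beta.
    destruct (catenoid_coordinates be' a b n sg r (w z) F Nw) as [Q1 _].
    assert (Q2 : hcoord Y a b z = (k + RtoC (r / 2) * (Cconj (w z) + / w z))%C).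
    { transitivity (hvec a b be' + RtoC (r / 2) * (Cconj (w z) + / w z))%C;
        [exact Q1|]. unfold hvec. rewrite B1, B2, Ropp_involutive. reflexivity. }
    rewrite Q2. field. exact Nw. }
  assert (LV : limC (fun z => RtoC (dot (X z) n - dot (Y z) n)) 0 0).
  { assert (Q := limC_minus _ _ _ _ _ H2 (limC_const (RtoC k3) 0)).
    replace (RtoC k3 - RtoC k3)%C with (RtoC 0) in Q by ring.
    refine (limC_ext_0 _ _ _ d Hd _ Q). intros z Hz. specialize (Nw z Hz). cbv beta.
    unfold Y. rewrite (proj2 (catenoid_coordinates be' a b n sg r (w z) F Nw)), B3.
    rewrite <- RtoC_minus. f_equal. ring. }
  apply filterlim_limC. apply limC_0_intro. intros e He.
  destruct (limC_0_elim _ (e / 3) LH ltac:(lra)) as [d1 [Hd1 Q1]].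
  destruct (limC_0_elim _ (e / 3) LV ltac:(lra)) as [d2 [Hd2 Q2]].
  exists (Rmin d1 d2). split; [now apply Rmin_pos|]. intros z Hz.
  assert (A1 := Rmin_l d1 d2). assert (A2 := Rmin_r d1 d2).
  specialize (Q1 z ltac:(lra)). specialize (Q2 z ltac:(lra)). cbv beta in Q1, Q2.
  rewrite Cmod_R in Q2.
  rewrite Cmod_R, (Rabs_pos_eq (norm3 _)) by apply sqrt_pos.
  eapply Rle_trans; [apply (frame_norm a b n _ F)|]. rewrite !dot_minus_l.
  fold (Y z).
  assert (R1 : Rabs (dot (X z) a - dot (Y z) a) <= Cmod (hcoord X a b z - hcoord Y a b z)%C)
    by exact (re_le_Cmod (hcoord X a b z - hcoord Y a b z)%C).
  assert (R2 : Rabs (- dot (X z) b - - dot (Y z) b) <= Cmod (hcoord X a b z - hcoord Y a b z)%C)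
    by exact (im_le_Cmod (hcoord X a b z - hcoord Y a b z)%C).
  replace (- dot (X z) b - - dot (Y z) b) with (- (dot (X z) b - dot (Y z) b)) in R2 by ring.
  rewrite Rabs_Ropp in R2.
  lra.
Qed.

(** * Weierstrass data of an end *)

(** The Weierstrass-Enneper representation in the frame [a], [b], [n], on a disk small enough for
    [f] to have no zero and [g] no pole off the puncture. *)
Record weierstrass (dl : R) (X : C -> vec) (a b n : vec) (f g dg : C -> C) : Prop := {
  we_f : exists df, hol (punctured_disk dl) f df;
  we_f_neq_0 : forall z, punctured_disk dl z -> f z <> 0;
  we_g : hol (punctured_disk dl) g dg;
  we_a : forall z, punctured_disk dl z -> hgrad X a z = (f z * (1 - g z * g z) / 2)%C;
  we_b : forall z, punctured_disk dl z -> hgrad X b z = (Ci * f z * (1 + g z * g z) / 2)%C;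
  we_n : forall z, punctured_disk dl z -> hgrad X n z = (f z * g z)%C
}.

(** Since [<X, b>] is minus the imaginary part of [hcoord], its polar model is [Re (i A / z)]. *)
Lemma pole_gradients (R0 : R) (X : C -> vec) (a b : vec) (A : C) : 0 < R0 ->
  harm (punctured_disk R0) (fun z => dot (X z) a) (hgrad X a) ->
  harm (punctured_disk R0) (fun z => dot (X z) b) (hgrad X b) ->
  limC (fun z => z * hcoord X a b z)%C 0 A ->
  limC (fun z => z * z * hgrad X a z)%C 0 (- A)%C /\
  limC (fun z => z * z * hgrad X b z)%C 0 (- (Ci * A))%C.
Proof.
  intros HR Ha Hb HL. apply limC_0_minus in HL. split.
  - apply (harm_pole_gradient R0 _ _ _ HR Ha).
    apply (limC_Cmod_le _ (fun z => z * hcoord X a b z - A)%C 0 1 1 Rlt_0_1); [|exact HL].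
    intros z. rewrite Cminus_0. intros Hz.
    assert (Nz : z <> 0) by now apply Cmod_gt_0.
    replace (z * hcoord X a b z - A)%C with (z * (hcoord X a b z - A / z))%C by (field; exact Nz).
    rewrite !Cmod_mult, Cmod_R, Rmult_1_l. apply Rmult_le_compat_l; [apply Cmod_ge_0|].
    exact (re_le_Cmod (hcoord X a b z - A / z)%C).
  - apply (harm_pole_gradient R0 _ _ _ HR Hb).
    apply (limC_Cmod_le _ (fun z => z * hcoord X a b z - A)%C 0 1 1 Rlt_0_1); [|exact HL].
    intros z. rewrite Cminus_0. intros Hz.
    assert (Nz : z <> 0) by now apply Cmod_gt_0.
    replace (z * hcoord X a b z - A)%C with (z * (hcoord X a b z - A / z))%C by (field; exact Nz).
    rewrite !Cmod_mult, Cmod_R, Rmult_1_l. apply Rmult_le_compat_l; [apply Cmod_ge_0|].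
    assert (Q := im_le_Cmod (hcoord X a b z - A / z)%C).
    replace (Im (hcoord X a b z - A / z)%C) with (- (dot (X z) b - Re (Ci * A / z)%C)) in Q.
    + now rewrite Rabs_Ropp in Q.
    + unfold hcoord, hvec, Cdiv. rewrite <- Cmult_assoc. generalize (A * / z)%C. intros q.
      Csimp. ring.
Qed.

Lemma harm_const (U : C -> Prop) (c : R) : harm U (fun _ => c) (fun _ => RtoC 0).
Proof. exact (harm_Re U _ _ _ (hol_const U (RtoC c)) (hol_const U 0)). Qed.

Lemma log_gradient (R0 : R) (h : C -> R) (F : C -> C) (s l : R) : 0 < R0 ->
  harm (punctured_disk R0) h F ->
  limC (fun z => RtoC (h z - s * ln (Cmod z))) 0 (RtoC l) ->
  limC (fun z => z * F z)%C 0 (RtoC s).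
Proof.
  intros HR Hh HL.
  assert (H1 := harm_lin _ _ _ _ _ 1 (- s) Hh (harm_ln R0)).
  assert (H2 := harm_lin _ _ _ _ _ 1 (-1) H1 (harm_const _ l)). cbv beta in H2.
  assert (Q := harm_limit_gradient R0 _ _ HR H2).
  apply limC_0_minus.
  apply (limC_ext_0 (fun z => z * (RtoC 1 * (RtoC 1 * F z + RtoC (- s) * / z) + RtoC (-1) * 0))%C
    _ _ 1 Rlt_0_1).
  - intros z Hz. rewrite RtoC_opp. field. apply Cmod_gt_0. lra.
  - apply Q. apply limC_0_minus in HL.
    apply (limC_ext_0 (fun z => RtoC (h z - s * ln (Cmod z)) - RtoC l)%C _ _ 1 Rlt_0_1); [|exact HL].
    intros z _. rewrite <- RtoC_minus. f_equal. ring.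
Qed.

(** Conformality in complex form: [dX/dz] is an isotropic vector. *)
Lemma hgrad_null (U : C -> Prop) (X : C -> vec) (a b n : vec) (z : C) :
  immersion_on U X -> conformal_on U X -> oframe a b n 1 -> U z ->
  (hgrad X a z * hgrad X a z + hgrad X b z * hgrad X b z + hgrad X n z * hgrad X n z)%C = 0.
Proof.
  intros HX HC F Hz. assert (FX := conformal_frame U X z HX HC Hz).
  assert (P11 := of_parseval _ _ _ _ (vdiff X z e1) (vdiff X z e1) F).
  assert (P12 := of_parseval _ _ _ _ (vdiff X z e1) (vdiff X z e2) F).
  assert (P22 := of_parseval _ _ _ _ (vdiff X z e2) (vdiff X z e2) F).
  rewrite (of_aa _ _ _ _ FX) in P11. rewrite (of_bb _ _ _ _ FX) in P22.
  rewrite (of_ab _ _ _ _ FX) in P12.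
  unfold hgrad. apply C_eq; Csimp; lra.
Qed.

Lemma oframe_cross (a b n : vec) : oframe a b n 1 -> cross b n = a /\ cross n a = b.
Proof.
  intros [_ F1 F2 F3 F4].
  assert (N : n = cross a b) by (rewrite F4; apply vec_eq; autorewrite with vecs; ring).
  rewrite N.
  assert (E1 : cross b (cross a b) = minus (scal (dot b b) a) (scal (dot a b) b)).
  { apply vec_eq; vsimp; ring. }
  assert (E2 : cross (cross a b) a = minus (scal (dot a a) b) (scal (dot a b) a)).
  { apply vec_eq; vsimp; ring. }
  rewrite E1, E2, F1, F2, F3. split; apply vec_eq; autorewrite with vecs; ring.
Qed.

Lemma C2_neq_0 : RtoC 2 <> 0.
Proof. intros E. apply RtoC_inj in E. lra. Qed.

Lemma half_RtoC (q : C) : (q / 2)%C = (RtoC (/ 2) * q)%C.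
Proof. rewrite RtoC_inv by lra. unfold Cdiv. ring. Qed.

(** [E N] is the cross product of the coordinate vectors. Writing [a], [b], [n] as cross products of
    one another turns its components into 2 by 2 determinants by Lagrange's identity. The outcome is
    [N] as the inverse stereographic image of [g], projected from [n]. *)
Lemma weierstrass_gauss (dl : R) (X : C -> vec) (a b n : vec) (f g dg : C -> C) (z : C) :
  immersion_on (punctured_disk dl) X -> conformal_on (punctured_disk dl) X ->
  oframe a b n 1 -> weierstrass dl X a b n f g dg -> punctured_disk dl z ->
  let S := 1 + (Re (g z) * Re (g z) + Im (g z) * Im (g z)) in
  first_form X z e1 e1 = (Re (f z) * Re (f z) + Im (f z) * Im (f z)) * (S * S) / 4 /\
  dot (gauss_map X z) a = 2 * Re (g z) / S /\ dot (gauss_map X z) b = 2 * Im (g z) / S /\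
  dot (gauss_map X z) n = 1 - 2 / S.
Proof.
  intros HX HC F W Hz S. assert (FX := conformal_frame _ X z HX HC Hz).
  destruct (oframe_cross a b n F) as [Xa Xb].
  assert (Xn : cross a b = n).
  { rewrite (of_cross _ _ _ _ F). apply vec_eq; autorewrite with vecs; ring. }
  assert (Wa := we_a _ _ _ _ _ _ _ _ W z Hz). assert (Wb := we_b _ _ _ _ _ _ _ _ W z Hz).
  assert (Wn := we_n _ _ _ _ _ _ _ _ W z Hz).
  rewrite half_RtoC in Wa, Wb. unfold hgrad in Wa, Wb, Wn.
  assert (Nf := we_f_neq_0 _ _ _ _ _ _ _ _ W z Hz).
  assert (Pf : 0 < Re (f z) * Re (f z) + Im (f z) * Im (f z)).
  { rewrite <- Cmod_sq. apply Cmod_gt_0 in Nf. nra. }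
  assert (PS : 1 <= S) by (unfold S; nra).
  assert (PE := of_pos _ _ _ _ FX).
  assert (P11 := of_parseval _ _ _ _ (vdiff X z e1) (vdiff X z e1) F).
  rewrite (of_aa _ _ _ _ FX) in P11.
  assert (CR := of_cross _ _ _ _ FX).
  assert (DA : first_form X z e1 e1 * dot (gauss_map X z) a =
     dot (vdiff X z e1) b * dot (vdiff X z e2) n - dot (vdiff X z e1) n * dot (vdiff X z e2) b).
  { rewrite <- dot_scal_l, <- CR, <- Xa at 1. apply dot_cross_cross. }
  assert (DB : first_form X z e1 e1 * dot (gauss_map X z) b =
     dot (vdiff X z e1) n * dot (vdiff X z e2) a - dot (vdiff X z e1) a * dot (vdiff X z e2) n).
  { rewrite <- dot_scal_l, <- CR, <- Xb at 1. apply dot_cross_cross. }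
  assert (DN : first_form X z e1 e1 * dot (gauss_map X z) n =
     dot (vdiff X z e1) a * dot (vdiff X z e2) b - dot (vdiff X z e1) b * dot (vdiff X z e2) a).
  { rewrite <- dot_scal_l, <- CR, <- Xn at 1. apply dot_cross_cross. }
  assert (A1 := f_equal Re Wa). assert (A2 := f_equal Im Wa).
  assert (B1 := f_equal Re Wb). assert (B2 := f_equal Im Wb).
  assert (N1 := f_equal Re Wn). assert (N2 := f_equal Im Wn).
  clear Wa Wb Wn. autorewrite with csimp in A1, A2, B1, B2, N1, N2.
  apply Ropp_eq_compat in A2, B2, N2. rewrite Ropp_involutive in A2, B2, N2.
  rewrite A1, B1, N1 in *. rewrite A2, B2, N2 in *.
  set (p := Re (f z)) in *. set (q := Im (f z)) in *.
  set (x := Re (g z)) in *. set (y := Im (g z)) in *.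
  assert (HE : first_form X z e1 e1 = (p * p + q * q) * (S * S) / 4).
  { rewrite Rmult_1_l in P11. rewrite P11. unfold S. field. }
  assert (NE : first_form X z e1 e1 <> 0) by lra.
  split; [exact HE|].
  split; [|split]; apply Rmult_eq_reg_l with (first_form X z e1 e1); try exact NE.
  - rewrite DA, HE. unfold S in *. field. lra.
  - rewrite DB, HE. unfold S in *. field. lra.
  - rewrite DN, HE. unfold S in *. field. lra.
Qed.

(** The poles of the horizontal coordinates give [f] a double pole, the logarithm of the height
    gives [f g] a simple one, and so [g] has a simple zero. *)
Lemma end_weierstrass (eps : R) (X : C -> vec) (be a b n : vec) (sg r : R) (w : C -> C) (al : C) :
  0 < eps -> minimal_immersion_on (punctured_disk eps) X ->
  conformal_on (punctured_disk eps) X -> oframe a b n 1 -> 0 < r -> al <> 0 ->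
  limC (fun z => w z / z)%C 0 al ->
  limC (fun z => hcoord X a b z - RtoC (r / 2) / w z)%C 0 (hvec a b be) ->
  limC (fun z => RtoC (dot (X z) n - sg * r * ln (Cmod (w z)))) 0 (RtoC (dot be n)) ->
  limC (fun z => z * hcoord X a b z)%C 0 (RtoC (r / 2) / al)%C /\
  limC (fun z => RtoC (dot (X z) n - sg * r * ln (Cmod z))) 0
    (RtoC (dot be n + sg * r * ln (Cmod al))) /\
  exists dl f g dg, 0 < dl <= eps /\ weierstrass dl X a b n f g dg /\
    limC (fun z => z * z * f z)%C 0 (- (RtoC r / al))%C /\
    limC (fun z => g z / z)%C 0 (- (RtoC sg * al))%C.
Proof.
  intros He HX HC F Hr Hal Hw H1 H2.
  assert (HU := open_punctured eps).
  destruct (change_neq_0 w al Hal Hw) as [d [Hd Nw]].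
  assert (Pal : 0 < Cmod al) by now apply Cmod_gt_0.
  assert (L1 : limC (fun z => z * hcoord X a b z)%C 0 (RtoC (r / 2) / al)%C).
  { assert (Q1 := limC_mult _ _ _ _ _ (limC_id 0) H1).
    assert (Q2 := limC_mult _ _ _ _ _ (limC_const (RtoC (r / 2)) 0) (limC_inv _ _ _ Hw Hal)).
    assert (Q := limC_plus _ _ _ _ _ Q1 Q2).
    replace (0 * hvec a b be + RtoC (r / 2) * / al)%C with (RtoC (r / 2) / al)%C in Q
      by (field; exact Hal).
    refine (limC_ext_0 _ _ _ d Hd _ Q). intros z Hz. specialize (Nw z Hz). cbv beta.
    assert (Nz : z <> 0) by (apply Cmod_gt_0; lra).
    field. repeat split; assumption. }
  assert (L2 : limC (fun z => RtoC (dot (X z) n - sg * r * ln (Cmod z))) 0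
    (RtoC (dot be n + sg * r * ln (Cmod al)))).
  { assert (Q1 := limC_real_comp ln _ _ _ (limC_Cmod _ _ _ Hw)
      (derivable_continuous_pt _ _ (exist _ _ (derivable_pt_lim_ln _ Pal)))).
    assert (Q := limC_plus _ _ _ _ _ H2 (limC_mult _ _ _ _ _ (limC_const (RtoC (sg * r)) 0) Q1)).
    rewrite <- RtoC_mult, <- RtoC_plus in Q.
    refine (limC_ext_0 _ _ _ d Hd _ Q). intros z Hz. specialize (Nw z Hz). cbv beta.
    rewrite <- RtoC_mult, <- RtoC_plus. f_equal.
    assert (Nz : z <> 0) by (apply Cmod_gt_0; lra).
    rewrite Cmod_div by exact Nz. apply Cmod_gt_0 in Nw.
    unfold Rdiv. rewrite ln_mult, ln_Rinv; [ring| | |]; try lra.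
    apply Rinv_0_lt_compat. lra. }
  split; [exact L1|]. split; [exact L2|].
  assert (Ha := minimal_harm _ X a HU HX HC). assert (Hb := minimal_harm _ X b HU HX HC).
  assert (Hn := minimal_harm _ X n HU HX HC).
  destruct (pole_gradients eps X a b _ He Ha Hb L1) as [Ga Gb].
  assert (Gn := log_gradient eps _ _ _ _ He Hn L2).
  (* With [A = r / (2 al)], the gradients behave as [- A / z^2] and [- i A / z^2]; they add up here
     to [- 2 A / z^2], whereas the opposite sign would cancel the double poles. *)
  pose (f := fun z => (hgrad X a z + - Ci * hgrad X b z)%C).
  assert (Lf : limC (fun z => z * z * f z)%C 0 (- (RtoC r / al))%C).
  { assert (Q := limC_plus _ _ _ _ _ Ga (limC_mult _ _ _ _ _ (limC_const (- Ci)%C 0) Gb)).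
    replace (- (RtoC (r / 2) / al) + - Ci * - (Ci * (RtoC (r / 2) / al)))%C
      with (- (RtoC r / al))%C in Q.
    - refine (limC_ext_0 _ _ _ 1 Rlt_0_1 _ Q). intros z _. unfold f. ring.
    - unfold Cdiv. generalize (/ al)%C. intros q. apply C_eq; Csimp; field. }
  assert (Nlf : (- (RtoC r / al))%C <> 0).
  { intros E. apply (f_equal Cmod) in E.
    rewrite Cmod_opp, Cmod_div, Cmod_R, Cmod_0, Rabs_pos_eq in E by (try exact Hal; lra).
    assert (0 < r / Cmod al) by now apply Rdiv_lt_0_compat. lra. }
  (* The double pole keeps [f] from vanishing near 0, which fixes the smaller disk [dl]. *)
  destruct (limC_apart _ _ _ Lf Nlf) as [d1 [Hd1 Af]].
  set (dl := Rmin d1 eps). assert (B1 : dl <= d1) by apply Rmin_l.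
  assert (B2 : dl <= eps) by apply Rmin_r.
  assert (Hdl : 0 < dl) by now apply Rmin_pos.
  assert (SUB : forall z, punctured_disk dl z -> punctured_disk eps z).
  { intros z [Q1 Q2]. split; lra. }
  assert (Nf : forall z, punctured_disk dl z -> f z <> 0).
  { intros z [Q1 Q2] E. specialize (Af z). rewrite Cminus_0, E in Af.
    specialize (Af ltac:(lra)).
    replace (z * z * 0)%C with (RtoC 0) in Af by ring. rewrite Cmod_0 in Af.
    assert (P := Cmod_ge_0 (- (RtoC r / al))%C). lra. }
  destruct Ha as [[da Da] _]. destruct Hb as [[db Db] _]. destruct Hn as [[dn Dn] _].
  assert (Hf := hol_plus _ _ _ _ _ (hol_sub _ _ _ _ SUB Da)
     (hol_scal _ (- Ci)%C _ _ (hol_sub _ _ _ _ SUB Db))).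
  change (fun z => (hgrad X a z + - Ci * hgrad X b z)%C) with f in Hf.
  assert (Hg := hol_div _ _ _ _ _ (hol_sub _ _ _ _ SUB Dn) Hf Nf).
  exists dl, f, (fun z => hgrad X n z / f z)%C. eexists. split; [lra|]. split.
  - assert (NULL := fun z Hz => hgrad_null _ X a b n z (proj1 HX) HC F (SUB z Hz)).
    assert (II : (Ci * Ci)%C = (- RtoC 1)%C) by (apply C_eq; Csimp; ring).
    (* Isotropy factors as [(Fa - i Fb) (Fa + i Fb) = - Fn^2], where the first factor is [f]. *)
    assert (KEY : forall z, punctured_disk dl z ->
      (hgrad X a z + Ci * hgrad X b z)%C =
      (- (f z * (hgrad X n z / f z * (hgrad X n z / f z))))%C).
    { intros z Hz. specialize (Nf z Hz).
      transitivity ((hgrad X a z + Ci * hgrad X b z) * f z / f z)%C; [field; exact Nf|].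
      assert (K2 : ((hgrad X a z + Ci * hgrad X b z) * f z = - (hgrad X n z * hgrad X n z))%C).
      { specialize (NULL z Hz). unfold f.
        transitivity (hgrad X a z * hgrad X a z - (Ci * Ci) * (hgrad X b z * hgrad X b z))%C; [ring|].
        rewrite II.
        transitivity ((hgrad X a z * hgrad X a z + hgrad X b z * hgrad X b z +
           hgrad X n z * hgrad X n z) - hgrad X n z * hgrad X n z)%C; [ring|].
        rewrite NULL. ring. }
      rewrite K2. field. exact Nf. }
    constructor.
    + eexists. exact Hf.
    + exact Nf.
    + exact Hg.
    + intros z Hz. specialize (KEY z Hz).
      transitivity ((f z + (hgrad X a z + Ci * hgrad X b z)) / 2)%C.
      * unfold f. field.
      * rewrite KEY. field. repeat split; first [apply C2_neq_0|now apply Nf].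
    + intros z Hz. specialize (KEY z Hz).
      transitivity (- (Ci * Ci) * hgrad X b z)%C; [rewrite II; ring|].
      transitivity (Ci * (f z - (hgrad X a z + Ci * hgrad X b z)) / 2)%C.
      * unfold f. field.
      * rewrite KEY. field. repeat split; first [apply C2_neq_0|now apply Nf].
    + intros z Hz. field. now apply Nf.
  - split; [exact Lf|].
    assert (Q := limC_div _ _ _ _ _ Gn Lf Nlf).
    replace (RtoC (sg * r) / - (RtoC r / al))%C with (- (RtoC sg * al))%C in Q.
    + refine (limC_ext_0 _ _ _ dl Hdl _ Q). intros z Hz.
      assert (Nz : z <> 0) by (apply Cmod_gt_0; lra). specialize (Nf z Hz).
      field. repeat split; assumption.
    + assert (Nr : RtoC r <> 0) by (intros E; apply RtoC_inj in E; lra).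
      rewrite RtoC_mult. field. repeat split; assumption.
Qed.

(** * The Riccati equation *)

(** Conjugates are treated as independent variables (suffix [b]), which makes the identity rational.
    Here [vb], [vh], [v3] are the components of [V], those in [dn] the components of [dN],
    [q = |V|^2], [al = <V, dN>], and [k] stands for [g' e]. The right-hand side is free of [kb],
    [fb] and [eb]: this disappearance is the holomorphy of [u]. *)
Lemma Riccati_identity (g gb u ub k kb f fb e eb c : C) : (1 + g * gb)%C <> 0 ->
  let S := (1 + g * gb)%C in
  let dS := (k * gb + g * kb)%C in
  let vb := (u - gb - gb * gb * ub)%C in
  let vh := (ub - g - g * g * u)%C in
  let v3 := (1 + g * u + gb * ub)%C in
  let dnb := ((2 * kb * S - 2 * gb * dS) / (S * S))%C in
  let dnh := ((2 * k * S - 2 * g * dS) / (S * S))%C in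
  let dn3 := (2 * dS / (S * S))%C in
  let q := (vb * vh + v3 * v3)%C in
  let al := ((vb * dnh + vh * dnb) / 2 + v3 * dn3)%C in
  let dvb := (- (q / 2) * dnb + al * vb - c * ((f * e - fb * gb * gb * eb) / 2))%C in
  let dv3 := (- (q / 2) * dn3 + al * v3 - c * ((f * g * e + fb * gb * eb) / 2))%C in
  (((dvb + (kb * v3 + gb * dv3)) * S - (vb + gb * v3) * dS) / (S * S))%C
  = (k * u * u - c / 2 * f * e)%C.
Proof.
  intros HS. cbv zeta. field. exact HS.
Qed.

(** With [g] and [gt] the stereographic Gauss maps of [Z] and [Zt] in the frame
    [a, b, n], this is [1 / (gt - g)]. *)
Definition rib_u (c : R) (Z Zt : C -> vec) (a b n : vec) (g : C -> C) (z : C) : C :=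
  ((hvec a b (rib_vec c Z Zt z) + Cconj (g z) * RtoC (dot (rib_vec c Z Zt z) n)) /
   (1 + g z * Cconj (g z)))%C.

Lemma one_plus_sq (x : C) :
  (1 + x * Cconj x)%C = RtoC (1 + (Re x * Re x + Im x * Im x)).
Proof. apply C_eq; Csimp; ring. Qed.

Lemma one_plus_sq_neq_0 (x : C) : (1 + x * Cconj x)%C <> 0.
Proof. rewrite one_plus_sq. intros E. apply RtoC_inj in E. nra. Qed.

Lemma hvec_dot (a b p q : vec) :
  RtoC (dot p a * dot q a + dot p b * dot q b) =
  ((hvec a b p * Cconj (hvec a b q) + Cconj (hvec a b p) * hvec a b q) / 2)%C.
Proof. rewrite half_RtoC. unfold hvec. apply C_eq; Csimp; field. Qed.

Lemma hvec_scal (a b p : vec) (c : R) : hvec a b (scal c p) = (RtoC c * hvec a b p)%C.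
Proof. unfold hvec. rewrite !dot_scal_l. apply C_eq; Csimp; ring. Qed.

Lemma hvec_plus (a b p q : vec) : hvec a b (plus p q) = (hvec a b p + hvec a b q)%C.
Proof. unfold hvec. rewrite !dot_plus_l. apply C_eq; Csimp; ring. Qed.

Lemma hvec_minus (a b p q : vec) : hvec a b (minus p q) = (hvec a b p - hvec a b q)%C.
Proof. unfold hvec. rewrite !dot_minus_l. apply C_eq; Csimp; ring. Qed.

(** A certificate scheme: an equation is proved by exhibiting it as the multiple [k] of a known
    relation. *)
Lemma C_eq_of_diff (x y k l r : C) : (x - y = k * (l - r))%C -> l = r -> x = y.
Proof.
  intros H ->. apply Cmod_minus_eq_0. rewrite H.
  replace (k * (r - r))%C with (RtoC 0) by ring. apply Cmod_0.
Qed.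

Lemma conj_RtoC (x : R) : Cconj (RtoC x) = RtoC x.
Proof. apply C_eq; Csimp; ring. Qed.

Lemma weierstrass_normal (dl : R) (X : C -> vec) (a b n : vec) (f g dg : C -> C) (z : C) :
  immersion_on (punctured_disk dl) X -> conformal_on (punctured_disk dl) X ->
  oframe a b n 1 -> weierstrass dl X a b n f g dg -> punctured_disk dl z ->
  hvec a b (gauss_map X z) = (2 * Cconj (g z) / (1 + g z * Cconj (g z)))%C /\
  RtoC (dot (gauss_map X z) n) = (1 - 2 / (1 + g z * Cconj (g z)))%C.
Proof.
  intros HX HC F W Hz.
  destruct (weierstrass_gauss dl X a b n f g dg z HX HC F W Hz) as [_ [G1 [G2 G3]]].
  rewrite one_plus_sq. set (S := 1 + _) in *.
  assert (PS : S <> 0) by (unfold S; nra).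
  unfold Cdiv. rewrite <- RtoC_inv by exact PS. unfold hvec. rewrite G1, G2, G3. split.
  - apply C_eq; Csimp; field; exact PS.
  - apply C_eq; Csimp; field; exact PS.
Qed.

(** [V] has three real components bound by the single relation [<V, N> = -1]; the two remaining
    degrees of freedom are those of [u]. Both formulas differ from the definition of [u] by a
    multiple of that relation. *)
Lemma rib_u_vec (dl c : R) (Z Zt : C -> vec) (a b n : vec) (f g dg : C -> C) (z : C) :
  immersion_on (punctured_disk dl) Z -> conformal_on (punctured_disk dl) Z ->
  oframe a b n 1 -> weierstrass dl Z a b n f g dg -> rib_pair (punctured_disk dl) c Z Zt ->
  punctured_disk dl z ->
  let u := rib_u c Z Zt a b n g z in
  hvec a b (rib_vec c Z Zt z) = (u - Cconj (g z) - Cconj (g z) * Cconj (g z) * Cconj u)%C /\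
  RtoC (dot (rib_vec c Z Zt z) n) = (1 + g z * u + Cconj (g z) * Cconj u)%C.
Proof.
  intros HX HC F W RP Hz u.
  destruct (weierstrass_normal dl Z a b n f g dg z HX HC F W Hz) as [N1 N2].
  assert (NS := one_plus_sq_neq_0 (g z)).
  assert (VN := rp_normal _ _ _ _ RP z Hz).
  assert (P := of_parseval _ _ _ _ (rib_vec c Z Zt z) (gauss_map Z z) F).
  rewrite VN in P.
  apply (f_equal RtoC) in P. rewrite Rmult_1_l, Rmult_1_l, RtoC_plus, hvec_dot, N1, RtoC_mult, N2 in P.
  assert (Hu : Cconj u = ((Cconj (hvec a b (rib_vec c Z Zt z)) +
     g z * RtoC (dot (rib_vec c Z Zt z) n)) / (1 + g z * Cconj (g z)))%C).
  { unfold u, rib_u. rewrite Cdiv_conj by exact NS.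
    rewrite !Cplus_conj, !Cmult_conj, Cconj_conj, !conj_RtoC. f_equal. f_equal. ring. }
  rewrite Cdiv_conj, Cmult_conj, Cplus_conj, Cmult_conj, !conj_RtoC, Cconj_conj in P by exact NS.
  rewrite Hu. unfold u, rib_u. clear u Hu.
  set (vb := hvec a b (rib_vec c Z Zt z)) in *. set (vh := Cconj vb) in *.
  set (v3 := RtoC (dot (rib_vec c Z Zt z) n)) in *.
  clear N1 N2. generalize dependent (Cconj (g z)). intros gb NS' P. subst vh.
  assert (P' : (vb * g z + Cconj vb * gb + v3 * (g z * gb - 1) = - (1 + g z * gb))%C).
  { transitivity ((1 + g z * gb) * RtoC (-1))%C.
    - rewrite P. field. exact NS'.
    - replace (RtoC (-1)) with (- RtoC 1)%C by (apply C_eq; Csimp; ring). ring. }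
  split.
  - eapply C_eq_of_diff; [|exact P'].
    instantiate (1 := (gb / (1 + g z * gb))%C). field. exact NS'.
  - eapply C_eq_of_diff; [|exact P'].
    instantiate (1 := (- RtoC 1 / (1 + g z * gb))%C). field. exact NS'.
Qed.

Lemma ldiff_dot_const (X : C -> vec) (z e : C) (v p : vec) :
  vldiff X z e v -> ldiff (fun w => dot (X w) p) z e (dot v p).
Proof.
  intros H. eapply ldiff_eq; [exact (ldiff_dot _ _ _ _ _ _ H (vldiff_const p z e))|].
  unfold dot at 2. autorewrite with vecs. ring.
Qed.

Lemma pdiff_hvec (X : C -> vec) (z e : C) (v a b : vec) :
  vldiff X z e v -> pdiff (fun t => hvec a b (X (line z e t))) 0 (hvec a b v).
Proof.
  intros H. assert (H1 := ldiff_dot_const X z e v a H). assert (H2 := ldiff_dot_const X z e v b H).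
  split; [exact H1|exact (ldiff_opp _ _ _ _ H2)].
Qed.

Lemma pdiff_dot (X : C -> vec) (z e : C) (v p : vec) :
  vldiff X z e v -> pdiff (fun t => RtoC (dot (X (line z e t)) p)) 0 (RtoC (dot v p)).
Proof. intros H. apply pdiff_RtoC. exact (ldiff_dot_const X z e v p H). Qed.

Lemma line_in (U : C -> Prop) (z e : C) : openC U -> U z -> axis e ->
  locally 0 (fun t => U (line z e t)).
Proof.
  intros HU Hz He. destruct (HU z Hz) as [d [Hd HB]].
  eapply filter_imp; [|exact (line_near z e d He Hd)]. intros t Ht. now apply HB.
Qed.

Lemma hgrad_dot (X : C -> vec) (z e : C) (p : vec) : axis e ->
  dot (vdiff X z e) p = Re (hgrad X p z * e)%C.
Proof. intros [->| ->]; unfold hgrad, e1, e2; Csimp; ring. Qed.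

(** The derivative of [V] comes from [rp_derive] and that of [N] from [g], so all ingredients of [u]
    are differentiated explicitly and [Riccati_identity] evaluates the quotient. The result is
    complex linear in [e]. *)
Lemma rib_u_derive (dl c : R) (Z Zt : C -> vec) (a b n : vec) (f g dg : C -> C) (z e : C) :
  immersion_on (punctured_disk dl) Z -> conformal_on (punctured_disk dl) Z ->
  vsmooth_on (punctured_disk dl) Zt ->
  oframe a b n 1 -> weierstrass dl Z a b n f g dg -> rib_pair (punctured_disk dl) c Z Zt ->
  punctured_disk dl z -> axis e ->
  let u := rib_u c Z Zt a b n g in
  pdiff (fun t => u (line z e t)) 0 ((dg z * u z * u z - RtoC c / 2 * f z) * e)%C.
Proof.
  intros HX HC HZt F W RP Hz He u.
  assert (HU := open_punctured dl).
  assert (LIN := line_in _ z e HU Hz He).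
  assert (Dg : pdiff (fun t => g (line z e t)) 0 (dg z * e)%C).
  { apply (pdiff_comp g (line z e)); [|apply pdiff_line]. rewrite line_0.
    exact (proj1 (we_g _ _ _ _ _ _ _ _ W z Hz)). }
  assert (Dgb := pdiff_conj _ _ _ Dg). cbv beta in Dgb.
  pose (S := fun w => (1 + g w * Cconj (g w))%C).
  assert (NS : forall w, S w <> 0) by (intros w; apply one_plus_sq_neq_0).
  assert (DS : pdiff (fun t => S (line z e t)) 0
    (dg z * e * Cconj (g z) + g z * Cconj (dg z * e))%C).
  { eapply pdiff_eq; [apply pdiff_plus; [apply pdiff_const|apply pdiff_mult; [exact Dg|exact Dgb]]|].
    cbv beta. rewrite line_0. ring. }
  set (dS := (dg z * e * Cconj (g z) + g z * Cconj (dg z * e))%C) in *.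
  assert (DN := gauss_vldiff _ Z z e HX Hz He).
  assert (DV := rib_vec_vldiff _ c Z Zt z e (proj1 HX) HZt Hz He).
  set (V := rib_vec c Z Zt) in *. set (N := gauss_map Z) in *.
  (* [dN] is found by differentiating the expression of [N] in [g], which agrees with [N] along the
     line near [z]. *)
  assert (EN1 : hvec a b (vdiff N z e) =
    ((2 * Cconj (dg z * e) * S z - 2 * Cconj (g z) * dS) / (S z * S z))%C).
  { apply (pdiff_unique (fun t => hvec a b (N (line z e t))) 0); [apply pdiff_hvec; exact DN|].
    apply (pdiff_ext_loc (fun t => 2 * Cconj (g (line z e t)) / S (line z e t))%C).
    - eapply filter_imp; [|exact LIN]. intros t Ht. symmetry.
      exact (proj1 (weierstrass_normal dl Z a b n f g dg _ HX HC F W Ht)).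
    - eapply pdiff_eq.
      + apply pdiff_div; [apply pdiff_mult; [apply pdiff_const|exact Dgb]|exact DS|apply NS].
      + cbv beta. rewrite line_0. field. apply NS. }
  assert (EN3 : RtoC (dot (vdiff N z e) n) = (2 * dS / (S z * S z))%C).
  { apply (pdiff_unique (fun t => RtoC (dot (N (line z e t)) n)) 0); [apply pdiff_dot; exact DN|].
    apply (pdiff_ext_loc (fun t => 1 - 2 / S (line z e t))%C).
    - eapply filter_imp; [|exact LIN]. intros t Ht. symmetry.
      exact (proj2 (weierstrass_normal dl Z a b n f g dg _ HX HC F W Ht)).
    - eapply pdiff_eq.
      + apply pdiff_minus; [apply pdiff_const|].
        apply pdiff_div; [apply pdiff_const|exact DS|apply NS].
      + cbv beta. rewrite line_0. field. apply NS. }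
  assert (DVh := pdiff_hvec _ _ _ _ a b DV). assert (DV3 := pdiff_dot _ _ _ _ n DV).
  set (dV := scal c (minus (vdiff Zt z e) (vdiff Z z e))) in *.
  assert (HdV : dV = minus (plus (scal (- (dot (V z) (V z) / 2)) (vdiff N z e))
     (scal (dot (V z) (vdiff N z e)) (V z))) (scal c (vdiff Z z e))).
  { assert (RD := rp_derive _ _ _ _ RP z e Hz He).
    etransitivity; [|exact (f_equal (fun q => minus q (scal c (vdiff Z z e))) RD)].
    unfold dV. apply vec_eq; autorewrite with vecs; ring. }
  destruct (rib_u_vec dl c Z Zt a b n f g dg z HX HC F W RP Hz) as [U1 U2].
  fold V u in U1, U2.
  assert (U1c : Cconj (hvec a b (V z)) = (Cconj (u z) - g z - g z * g z * u z)%C).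
  { rewrite U1. now rewrite !Cminus_conj, !Cmult_conj, !Cconj_conj. }
  assert (EN1c : Cconj (hvec a b (vdiff N z e)) =
    ((2 * (dg z * e) * S z - 2 * g z * dS) / (S z * S z))%C).
  { assert (Sc : Cconj (S z) = S z) by (unfold S; rewrite one_plus_sq; apply conj_RtoC).
    assert (dSc : Cconj dS = dS).
    { unfold dS. rewrite Cplus_conj, !Cmult_conj, !Cconj_conj. ring. }
    rewrite EN1, Cdiv_conj.
    - rewrite Cminus_conj, !Cmult_conj, !Cconj_conj, Sc, dSc, !conj_RtoC. reflexivity.
    - apply Cmult_neq_0; apply NS. }
  assert (Pq : RtoC (dot (V z) (V z)) =
    (hvec a b (V z) * Cconj (hvec a b (V z)) + RtoC (dot (V z) n) * RtoC (dot (V z) n))%C).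
  { assert (Q := of_parseval _ _ _ _ (V z) (V z) F). rewrite !Rmult_1_l in Q.
    rewrite Q, RtoC_plus, hvec_dot, RtoC_mult. field. }
  assert (Pal : RtoC (dot (V z) (vdiff N z e)) =
    ((hvec a b (V z) * Cconj (hvec a b (vdiff N z e)) +
      Cconj (hvec a b (V z)) * hvec a b (vdiff N z e)) / 2
      + RtoC (dot (V z) n) * RtoC (dot (vdiff N z e) n))%C).
  { assert (Q := of_parseval _ _ _ _ (V z) (vdiff N z e) F). rewrite !Rmult_1_l in Q.
    rewrite Q, RtoC_plus, hvec_dot, RtoC_mult. reflexivity. }
  assert (Zh : hvec a b (vdiff Z z e) =
    ((f z * e - Cconj (f z) * Cconj (g z) * Cconj (g z) * Cconj e) / 2)%C).
  { transitivity (RtoC (Re (hgrad Z a z * e)%C) - Ci * RtoC (Re (hgrad Z b z * e)%C))%C.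
    - unfold hvec. rewrite !(hgrad_dot Z z e) by exact He. apply C_eq; Csimp; ring.
    - rewrite !re_alt, (we_a _ _ _ _ _ _ _ _ W z Hz), (we_b _ _ _ _ _ _ _ _ W z Hz).
      rewrite !half_RtoC. repeat rewrite ?Cmult_conj, ?Cplus_conj, ?Cminus_conj, ?conj_RtoC.
      replace (Cconj Ci) with (- Ci)%C by (apply C_eq; Csimp; ring).
      generalize (Cconj (f z)) (Cconj (g z)) (Cconj e). intros fb gb eb.
      rewrite RtoC_inv by lra.
      transitivity ((((f z * (1 - g z * g z) * e + fb * (1 - gb * gb) * eb) -
        (Ci * Ci) * (f z * (1 + g z * g z) * e - fb * (1 + gb * gb) * eb)) / (2 * 2)))%C;
        [field|].
      replace (Ci * Ci)%C with (- RtoC 1)%C by (apply C_eq; Csimp; ring). field. }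
  assert (Z3 : RtoC (dot (vdiff Z z e) n) =
    ((f z * g z * e + Cconj (f z) * Cconj (g z) * Cconj e) / 2)%C).
  { rewrite (hgrad_dot Z z e n He), re_alt, (we_n _ _ _ _ _ _ _ _ W z Hz).
    rewrite !Cmult_conj. reflexivity. }
  assert (DUu : pdiff (fun t => u (line z e t)) 0
    (((hvec a b dV + (Cconj (dg z * e) * RtoC (dot (V z) n) + Cconj (g z) * RtoC (dot dV n))) * S z
     - (hvec a b (V z) + Cconj (g z) * RtoC (dot (V z) n)) * dS) / (S z * S z))%C).
  { eapply pdiff_eq.
    - apply pdiff_div; [apply pdiff_plus; [exact DVh|apply pdiff_mult; [exact Dgb|exact DV3]]
                      |exact DS|apply NS].
    - cbv beta. rewrite line_0. reflexivity. }
  eapply pdiff_eq; [exact DUu|].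
  assert (EdVh : hvec a b dV = (- (RtoC (dot (V z) (V z)) / 2) * hvec a b (vdiff N z e) +
     RtoC (dot (V z) (vdiff N z e)) * hvec a b (V z) - RtoC c * hvec a b (vdiff Z z e))%C).
  { rewrite HdV, hvec_minus, hvec_plus, !hvec_scal. f_equal. f_equal. f_equal.
    rewrite RtoC_opp. f_equal. unfold Rdiv. rewrite RtoC_mult, RtoC_inv by lra. reflexivity. }
  assert (EdV3 : RtoC (dot dV n) = (- (RtoC (dot (V z) (V z)) / 2) * RtoC (dot (vdiff N z e) n) +
     RtoC (dot (V z) (vdiff N z e)) * RtoC (dot (V z) n) - RtoC c * RtoC (dot (vdiff Z z e) n))%C).
  { rewrite HdV, dot_minus_l, dot_plus_l, !dot_scal_l, RtoC_minus, RtoC_plus, !RtoC_mult.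
    f_equal. f_equal. f_equal.
    rewrite RtoC_opp. f_equal. unfold Rdiv. rewrite RtoC_mult, RtoC_inv by lra. reflexivity. }
  rewrite EdVh, EdV3, Pal, Pq, EN1c, EN1, EN3, Zh, Z3, U1c, U1, U2.
  transitivity ((dg z * e) * u z * u z - RtoC c / 2 * f z * e)%C; [|ring].
  exact (Riccati_identity (g z) (Cconj (g z)) (u z) (Cconj (u z)) (dg z * e)%C
    (Cconj (dg z * e)) (f z) (Cconj (f z)) e (Cconj e) (RtoC c) (NS z)).
Qed.

Lemma contC_dot (U : C -> Prop) (X : C -> vec) (p : vec) (z : C) :
  vsmooth_on U X -> U z -> contC (fun w => RtoC (dot (X w) p)) z.
Proof.
  intros [H1 [H2 H3]] Hz.
  apply (contC_ext (fun w => RtoC (x1 (X w)) * RtoC (x1 p) + RtoC (x2 (X w)) * RtoC (x2 p)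
     + RtoC (x3 (X w)) * RtoC (x3 p))%C _ z 1 Rlt_0_1).
  - intros w _. unfold dot. now rewrite !RtoC_plus, !RtoC_mult.
  - repeat apply contC_plus; (apply contC_mult; [|apply contC_const]).
    + exact (smooth_contC U _ z H1 Hz).
    + exact (smooth_contC U _ z H2 Hz).
    + exact (smooth_contC U _ z H3 Hz).
Qed.

Lemma contC_rib_dot (U : C -> Prop) (c : R) (Z Zt : C -> vec) (p : vec) (z : C) :
  vsmooth_on U Z -> vsmooth_on U Zt -> U z ->
  contC (fun w => RtoC (dot (rib_vec c Z Zt w) p)) z.
Proof.
  intros H1 H2 Hz.
  apply (contC_ext (fun w => RtoC c * (RtoC (dot (Zt w) p) - RtoC (dot (Z w) p)))%C _ z 1 Rlt_0_1).
  - intros w _. unfold rib_vec. autorewrite with dots. now rewrite RtoC_mult, RtoC_minus.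
  - apply contC_mult; [apply contC_const|]. apply contC_minus; eapply contC_dot; eassumption.
Qed.

Lemma contC_hvec (Y : C -> vec) (a b : vec) (z : C) :
  contC (fun w => RtoC (dot (Y w) a)) z -> contC (fun w => RtoC (dot (Y w) b)) z ->
  contC (fun w => hvec a b (Y w)) z.
Proof.
  intros H1 H2.
  apply (contC_ext (fun w => RtoC (dot (Y w) a) - Ci * RtoC (dot (Y w) b))%C _ z 1 Rlt_0_1).
  - intros w _. unfold hvec. apply C_eq; Csimp; ring.
  - apply contC_minus; [exact H1|apply contC_mult; [apply contC_const|exact H2]].
Qed.

(** The derivatives along the axes are [du] and [i du], which is the Cauchy-Riemann system;
    continuity of [du] upgrades these partial derivatives to complex differentiability. *)
Lemma rib_u_hol (dl c : R) (Z Zt : C -> vec) (a b n : vec) (f g dg : C -> C) :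
  immersion_on (punctured_disk dl) Z -> conformal_on (punctured_disk dl) Z ->
  vsmooth_on (punctured_disk dl) Zt ->
  oframe a b n 1 -> weierstrass dl Z a b n f g dg -> rib_pair (punctured_disk dl) c Z Zt ->
  let u := rib_u c Z Zt a b n g in
  hol (punctured_disk dl) u (fun z => dg z * u z * u z - RtoC c / 2 * f z)%C.
Proof.
  intros HX HC HZt F W RP u.
  pose (du := fun z => (dg z * u z * u z - RtoC c / 2 * f z)%C).
  assert (HU := open_punctured dl).
  assert (Cu : forall z, punctured_disk dl z -> contC u z).
  { intros z Hz. assert (Cg := cdiff_contC _ _ _ (proj1 (we_g _ _ _ _ _ _ _ _ W z Hz))).
    assert (CV := fun p => contC_rib_dot _ c Z Zt p z (proj1 HX) HZt Hz).
    unfold u, rib_u. apply contC_div; [| |apply one_plus_sq_neq_0].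
    - apply contC_plus; [apply contC_hvec; apply CV|].
      apply contC_mult; [now apply contC_conj|apply CV].
    - apply contC_plus; [apply contC_const|]. apply contC_mult; [exact Cg|now apply contC_conj]. }
  assert (Cdu : forall z, punctured_disk dl z -> contC du z).
  { intros z Hz. destruct (we_f _ _ _ _ _ _ _ _ W) as [df Hf].
    unfold du. apply contC_minus.
    - apply contC_mult; [apply contC_mult|]; try now apply Cu.
      exact (proj2 (we_g _ _ _ _ _ _ _ _ W z Hz)).
    - apply contC_mult; [apply contC_const|]. exact (cdiff_contC _ _ _ (proj1 (Hf z Hz))). }
  intros z Hz. split; [|exact (Cdu z Hz)].
  assert (DU : forall w e, punctured_disk dl w -> axis e ->
     pdiff (fun t => u (line w e t)) 0 (du w * e)%C).
  { intros w e Hw He. exact (rib_u_derive dl c Z Zt a b n f g dg w e HX HC HZt F W RP Hw He). }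
  assert (A1 : axis e1) by now left. assert (A2 : axis e2) by now right.
  destruct (HU z Hz) as [d [Hd HB]].
  change (cdiff u z (du z)).
  apply cdiff_of_rdiff.
  - apply (rdiff_of_partials (fun w => Re (u w)) (fun w => Re (du w)) z _ d Hd).
    + intros w Hw. eapply ldiff_eq; [exact (proj1 (DU w e1 (HB w Hw) A1))|].
      unfold e1. Csimp. ring.
    + eapply ldiff_eq; [exact (proj1 (DU z e2 Hz A2))|]. unfold e2. Csimp. ring.
    + exact (proj1 (contC_2d du z (Cdu z Hz))).
  - apply (rdiff_of_partials (fun w => Im (u w)) (fun w => Im (du w)) z _ d Hd).
    + intros w Hw. eapply ldiff_eq; [exact (proj2 (DU w e1 (HB w Hw) A1))|].
      unfold e1. Csimp. ring.
    + eapply ldiff_eq; [exact (proj2 (DU z e2 Hz A2))|]. unfold e2. Csimp. ring.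
    + exact (proj2 (contC_2d du z (Cdu z Hz))).
Qed.

(** * The pole of [u] at the puncture *)

Lemma RtoC_neq_0 (x : R) : x <> 0 -> RtoC x <> 0.
Proof. intros H E. apply RtoC_inj in E. contradiction. Qed.

Lemma Cmult_eq_0 (x y : C) : (x * y)%C = 0 -> x = 0 \/ y = 0.
Proof.
  intros H. apply (f_equal Cmod) in H. rewrite Cmod_mult, Cmod_0 in H.
  apply Rmult_integral in H. destruct H as [H|H]; [left|right]; now apply Cmod_eq_0.
Qed.

Lemma punctured_disk_sub (d1 d2 : R) : d1 <= d2 -> forall z, punctured_disk d1 z -> punctured_disk d2 z.
Proof. intros H z [H1 H2]. split; lra. Qed.

(** The two exclusions are what the second surface needs: [p0 <> 0] gives [V] a genuine pole, and
    the last one says that the pole coefficient [r / (2 al) + p0 / c] of [Zt] does not vanish. *)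
Lemma rib_u_limit (dl c r sg : R) (al : C) (f g u dg : C -> C) :
  0 < dl -> c <> 0 -> 0 < r -> sg * sg = 1 -> al <> 0 ->
  hol (punctured_disk dl) g dg ->
  hol (punctured_disk dl) u (fun z => dg z * u z * u z - RtoC c / 2 * f z)%C ->
  limC (fun z => z * z * f z)%C 0 (- (RtoC r / al))%C ->
  limC (fun z => g z / z)%C 0 (- (RtoC sg * al))%C ->
  exists p0, limC (fun z => z * u z)%C 0 p0 /\ p0 <> 0 /\
    (1 + RtoC (2 / (c * r)) * (al * p0))%C <> 0.
Proof.
  intros Hdl Hc Hr Hsg Hal Hg Hu Lf Lg.
  (* A nonzero limit of [g'] supplies the lower bound [a0] on the quadratic coefficient in
     [Riccati_bounded]. *)
  assert (Ldg := hol_limit_derivative dl g dg _ Hdl Hg Lg).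
  assert (Pal : 0 < Cmod al) by now apply Cmod_gt_0.
  assert (Nsg : sg <> 0) by (intros E; rewrite E in Hsg; lra).
  assert (Nl : (- (RtoC sg * al))%C <> 0).
  { intros E. assert (E' : (RtoC sg * al)%C = 0).
    { transitivity (- - (RtoC sg * al))%C; [ring|]. rewrite E. ring. }
    clear E. rename E' into E. apply Cmult_eq_0 in E. destruct E as [E|E]; [|contradiction].
    now apply (RtoC_neq_0 sg). }
  destruct (limC_apart _ _ _ Ldg Nl) as [d1 [Hd1 B1]].
  destruct (limC_bounded _ _ _ Lf) as [d2 [Hd2 B2]].
  set (R0 := Rmin dl (Rmin d1 d2)).
  assert (Q1 : R0 <= dl) by apply Rmin_l.
  assert (Q2 : R0 <= d1) by (eapply Rle_trans; [apply Rmin_r|apply Rmin_l]).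
  assert (Q3 : R0 <= d2) by (eapply Rle_trans; [apply Rmin_r|apply Rmin_r]).
  assert (HR0 : 0 < R0) by (repeat apply Rmin_pos; assumption).
  set (l := (- (RtoC sg * al))%C) in *. set (mf := (- (RtoC r / al))%C) in *.
  assert (Pl : 0 < Cmod l) by now apply Cmod_gt_0.
  assert (Pmf := Cmod_ge_0 mf). assert (Pc := Cmod_ge_0 (RtoC c / 2)%C).
  assert (BD := Riccati_bounded R0 (Cmod l / 2) (Cmod (RtoC c / 2)%C * (Cmod mf + 1)) u _ dg
    (fun z => RtoC c / 2 * f z)%C HR0 ltac:(lra) ltac:(nra)
    (hol_sub _ _ _ _ (punctured_disk_sub _ _ Q1) Hu)).
  cbv beta in BD. set (MM := 6 * _) in BD.
  assert (BD' : forall z, punctured_disk (R0 / 2) z -> Cmod (z * u z)%C <= MM).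
  { apply BD.
    - intros z _. reflexivity.
    - intros z [Z1 Z2]. left. apply B1. rewrite Cminus_0. lra.
    - intros z [Z1 Z2]. rewrite Cmod_mult, Rmult_assoc. apply Rmult_le_compat_l; [exact Pc|].
      specialize (B2 z). rewrite Cminus_0 in B2. specialize (B2 ltac:(lra)).
      rewrite !Cmod_mult in B2. lra. }
  assert (Hp := hol_mult _ _ _ _ _ (hol_id (punctured_disk (R0 / 2)))
    (hol_sub _ _ _ _ (punctured_disk_sub (R0 / 2) dl ltac:(lra)) Hu)).
  assert (HR2 : 0 < R0 / 2) by lra.
  destruct (bounded_hol_limit _ MM _ _ HR2 Hp BD') as [p0 Lp].
  assert (LG := hol_limit_gradient _ _ _ _ HR2 Hp Lp). cbv beta in LG, Lp.
  assert (LQ := limC_minus _ _ _ _ _ (limC_plus _ _ _ _ _ Lp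
     (limC_mult _ _ _ _ _ (limC_mult _ _ _ _ _ Ldg Lp) Lp))
     (limC_mult _ _ _ _ _ (limC_const (RtoC c / 2)%C 0) Lf)). cbv beta in LQ.
  (* For [p = z u] the equation reads [z p' = p + g' p^2 - (c / 2) z^2 f], and [z p'] tends to 0
     because [p] is holomorphic with a limit. *)
  assert (EQ : (p0 + l * p0 * p0 - RtoC c / 2 * mf)%C = 0).
  { apply (limC_unique _ _ _ _ LQ).
    refine (limC_ext_0 _ _ _ 1 Rlt_0_1 _ LG). intros z _. ring. }
  assert (N2 := C2_neq_0). assert (Nc := RtoC_neq_0 c Hc).
  assert (Nr := RtoC_neq_0 r (Rgt_not_eq _ _ Hr)).
  (* At [p0 = 0] the quadratic equation would reduce to [c r = 0]. *)
  assert (Np : p0 <> 0).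
  { intros E. rewrite E in EQ.
    assert (E2 : (RtoC c * RtoC r)%C = 0).
    { replace (RtoC c * RtoC r)%C with
        ((0 + l * 0 * 0 - RtoC c / 2 * mf) * (2 * al))%C
        by (unfold mf; field; repeat split; assumption).
      rewrite EQ. ring. }
    apply Cmult_eq_0 in E2. destruct E2; contradiction. }
  exists p0. split; [exact Lp|]. split; [exact Np|]. intros E.
  (* At the excluded value the linear and constant terms of the quadratic cancel, leaving
     [l p0^2 = 0]. *)
  assert (E1 : (RtoC c * RtoC r / 2 + al * p0)%C = 0).
  { transitivity ((1 + RtoC (2 / (c * r)) * (al * p0)) * (RtoC c * RtoC r / 2))%C.
    - unfold Rdiv. rewrite RtoC_mult, RtoC_inv, RtoC_mult
        by (apply Rmult_integral_contrapositive; split; lra).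
      field. repeat split; assumption.
    - rewrite E. ring. }
  assert (E2 : (l * p0 * p0)%C = 0).
  { transitivity ((p0 + l * p0 * p0 - RtoC c / 2 * mf) - (RtoC c * RtoC r / 2 + al * p0) / al)%C.
    - unfold mf. field. repeat split; assumption.
    - rewrite EQ, E1. field. exact Hal. }
  apply Cmult_eq_0 in E2. destruct E2 as [E2|E2]; [|contradiction].
  apply Cmult_eq_0 in E2. destruct E2; contradiction.
Qed.

(** * The second surface near the puncture *)

Lemma locally_C_iff (P : C -> Prop) :
  locally (RtoC 0) P <-> exists d, 0 < d /\ forall w, Cmod w < d -> P w.
Proof.
  split.
  - intros [d H]. exists d. split; [apply cond_pos|]. intros w Hw. apply H. split.
    + change (Rabs (Re w - 0) < d). rewrite Rminus_0_r.
      eapply Rle_lt_trans; [apply re_le_Cmod|apply Hw].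
    + change (Rabs (Im w - 0) < d). rewrite Rminus_0_r.
      eapply Rle_lt_trans; [apply im_le_Cmod|apply Hw].
  - intros [d [Hd H]]. assert (Hd2 : 0 < d / 2) by lra. exists (mkposreal _ Hd2).
    intros w [H1 H2]. apply H.
    change (Rabs (Re w - 0) < d / 2) in H1. change (Rabs (Im w - 0) < d / 2) in H2.
    rewrite Rminus_0_r in H1, H2.
    eapply Rle_lt_trans; [apply Cmod_le_Re_Im|]. lra.
Qed.

Lemma change_product (w u : C -> C) (al p0 : C) :
  limC (fun z => w z / z)%C 0 al -> limC (fun z => z * u z)%C 0 p0 ->
  limC (fun z => w z * u z)%C 0 (al * p0)%C.
Proof.
  intros H1 H2. refine (limC_ext_0 _ _ _ 1 Rlt_0_1 _ (limC_mult _ _ _ _ _ H1 H2)).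
  intros z Hz. cbv beta. field. apply Cmod_gt_0. lra.
Qed.

(* Chosen so that [1 / w' = 1 / w + k u]: with [k = 2 / (c r)] the pole of [Zt] is
   that of the catenoid reparametrized by [w']. *)
Lemma change_of_parameter (dl : R) (k : C) (w u du : C -> C) (al p0 : C) : 0 < dl ->
  conformal_change w -> al <> 0 -> hol (punctured_disk dl) u du ->
  limC (fun z => w z / z)%C 0 al -> limC (fun z => z * u z)%C 0 p0 ->
  (1 + k * (al * p0))%C <> 0 ->
  let w' := fun z => (w z / (1 + k * (w z * u z)))%C in
  conformal_change w' /\
  limC (fun z => 1 + k * (w z * u z))%C 0 (1 + k * (al * p0))%C.
Proof.
  intros Hdl Hw Hal Hu Lw Lp Nk w'.
  assert (LD := limC_plus _ _ _ _ _ (limC_const 1 0) (limC_mult _ _ _ _ _ (limC_const k 0)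
    (change_product w u al p0 Lw Lp))). cbv beta in LD.
  split; [|exact LD].
  destruct Hw as [W0 [WL _]].
  destruct (limC_apart _ _ _ LD Nk) as [d1 [Hd1 B1]].
  assert (PN : forall z, 0 < Cmod z < d1 -> (1 + k * (w z * u z))%C <> 0).
  { intros z Hz. apply Cmod_gt_0. specialize (B1 z). rewrite Cminus_0 in B1. specialize (B1 Hz).
    assert (Q := Cmod_ge_0 (1 + k * (al * p0))%C). lra. }
  assert (LW' := limC_div _ _ _ _ _ Lw LD Nk). cbv beta in LW'.
  assert (W'0 : w' 0 = 0) by (unfold w'; rewrite W0; unfold Cdiv; ring).
  assert (D0 : cdiff w' 0 (al / (1 + k * (al * p0)))%C).
  { refine (limC_ext_0 _ _ _ d1 Hd1 _ LW'). intros z Hz. specialize (PN z Hz).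
    rewrite W'0, !Cminus_0. unfold w'. field.
    assert (z <> 0) by (apply Cmod_gt_0; lra). now split. }
  split; [exact W'0|]. split.
  - apply locally_C_iff in WL. destruct WL as [d2 [Hd2 B2]].
    apply locally_C_iff. exists (Rmin dl (Rmin d1 d2)).
    assert (Q1 : Rmin dl (Rmin d1 d2) <= dl) by apply Rmin_l.
    assert (Q2 : Rmin dl (Rmin d1 d2) <= d1) by (eapply Rle_trans; [apply Rmin_r|apply Rmin_l]).
    assert (Q3 : Rmin dl (Rmin d1 d2) <= d2) by (eapply Rle_trans; [apply Rmin_r|apply Rmin_r]).
    split; [repeat apply Rmin_pos; assumption|]. intros z Hz.
    destruct (Req_dec (Cmod z) 0) as [E|E].
    + apply Cmod_eq_0 in E. subst z. eexists. apply cdiff_is_derive. exact D0.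
    + assert (P := Cmod_ge_0 z).
      destruct (B2 z ltac:(lra)) as [lw Hlw]. apply cdiff_is_derive in Hlw.
      assert (Hlu := proj1 (Hu z ltac:(split; lra))).
      specialize (PN z ltac:(lra)).
      eexists. apply cdiff_is_derive.
      apply cdiff_div; [exact Hlw| |exact PN].
      apply cdiff_plus; [apply cdiff_const|]. apply cdiff_scal. apply cdiff_mult; [exact Hlw|exact Hlu].
  - exists (al / (1 + k * (al * p0)))%C. split.
    + intros E. apply Hal. transitivity (al / (1 + k * (al * p0)) * (1 + k * (al * p0)))%C.
      * field. exact Nk.
      * rewrite E. ring.
    + apply cdiff_is_derive. exact D0.
Qed.

Lemma rib_coordinates (c : R) (Z Zt : C -> vec) (a b n : vec) (z : C) : c <> 0 ->
  hcoord Zt a b z = (hcoord Z a b z + RtoC (/ c) * hvec a b (rib_vec c Z Zt z))%C /\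
  dot (Zt z) n = dot (Z z) n + / c * dot (rib_vec c Z Zt z) n.
Proof.
  intros Hc. unfold hcoord, rib_vec. rewrite hvec_scal, hvec_minus. split.
  - rewrite RtoC_inv by exact Hc. field. now apply RtoC_neq_0.
  - autorewrite with dots. field. exact Hc.
Qed.

(** The zero of [g] balances the pole of [u] in [g u], so a further factor [g] makes the
    nonholomorphic part of [V] vanish in the limit. *)
Lemma gauss_u_limits (g u : C -> C) (l p0 : C) :
  limC (fun z => g z / z)%C 0 l -> limC (fun z => z * u z)%C 0 p0 ->
  limC g 0 0 /\ limC (fun z => g z * u z)%C 0 (l * p0)%C /\
  limC (fun z => Cconj (g z) + Cconj (g z) * Cconj (g z) * Cconj (u z))%C 0 0.
Proof.
  intros H1 H2. assert (L1 := change_small g l H1). assert (L2 := change_product g u l p0 H1 H2).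
  split; [exact L1|]. split; [exact L2|].
  assert (L := limC_plus _ _ _ _ _ (limC_conj _ _ _ L1)
    (limC_mult _ _ _ _ _ (limC_conj _ _ _ L1) (limC_conj _ _ _ L2))). cbv beta in L.
  replace (Cconj 0 + Cconj 0 * Cconj (l * p0))%C with (RtoC 0) in L.
  - refine (limC_ext_0 _ _ _ 1 Rlt_0_1 _ L). intros z _. rewrite Cmult_conj. ring.
  - rewrite conj_RtoC. ring.
Qed.

Lemma rib_vec_pole (dl : R) (V : C -> vec) (a b : vec) (g u : C -> C) (l p0 : C) : 0 < dl ->
  (forall z, punctured_disk dl z ->
    hvec a b (V z) = (u z - Cconj (g z) - Cconj (g z) * Cconj (g z) * Cconj (u z))%C) ->
  limC (fun z => g z / z)%C 0 l -> limC (fun z => z * u z)%C 0 p0 ->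
  limC (fun z => z * hvec a b (V z))%C 0 p0.
Proof.
  intros Hdl HV Lg Lp. destruct (gauss_u_limits g u l p0 Lg Lp) as [L1 [L2 L3]].
  assert (L := limC_minus _ _ _ _ _ Lp (limC_mult _ _ _ _ _ (limC_id 0) L3)). cbv beta in L.
  replace (p0 - 0 * 0)%C with p0 in L by ring.
  refine (limC_ext_0 _ _ _ dl Hdl _ L). intros z Hz. rewrite (HV z Hz). ring.
Qed.

(** Pole and logarithm of a catenoid are tied to the same [r]. The axial component of [V] has a
    limit, so the logarithmic coefficient [sg r] is inherited from [Z]; the change of the pole
    coefficient is absorbed by the parameter [w'], and [ln |w'| - ln |w|] converges. *)
Lemma rib_asymptotic (dl c r sg : R) (Z Zt : C -> vec) (be a b n : vec) (w g u du : C -> C)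
    (al l p0 : C) : 0 < dl -> c <> 0 ->
  rigid_motion (frame_map be a b n sg) -> oframe a b n 1 -> 0 < r -> conformal_change w ->
  al <> 0 -> limC (fun z => w z / z)%C 0 al ->
  limC (fun z => hcoord Z a b z - RtoC (r / 2) / w z)%C 0 (hvec a b be) ->
  limC (fun z => RtoC (dot (Z z) n - sg * r * ln (Cmod (w z)))) 0 (RtoC (dot be n)) ->
  hol (punctured_disk dl) u du ->
  (forall z, punctured_disk dl z ->
    hvec a b (rib_vec c Z Zt z) =
      (u z - Cconj (g z) - Cconj (g z) * Cconj (g z) * Cconj (u z))%C /\
    RtoC (dot (rib_vec c Z Zt z) n) = (1 + g z * u z + Cconj (g z) * Cconj (u z))%C) ->
  limC (fun z => g z / z)%C 0 l -> limC (fun z => z * u z)%C 0 p0 ->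
  (1 + RtoC (2 / (c * r)) * (al * p0))%C <> 0 ->
  asymptotic_to_catenoid Zt.
Proof.
  intros Hdl Hc HT F Hr Hw Hal Lw LH L3 Hu HV Lg Lp Nk.
  set (k := RtoC (2 / (c * r))) in *.
  destruct (change_of_parameter dl k w u du al p0 Hdl Hw Hal Hu Lw Lp Nk) as [Hw' LD].
  set (w' := fun z => (w z / (1 + k * (w z * u z)))%C) in *.
  destruct (gauss_u_limits g u l p0 Lg Lp) as [_ [Lgu Lgg]].
  destruct (change_neq_0 w al Hal Lw) as [d1 [Hd1 Nw]].
  destruct (limC_apart _ _ _ LD Nk) as [d2 [Hd2 B2]].
  assert (PN : forall z, 0 < Cmod z < d2 -> (1 + k * (w z * u z))%C <> 0).
  { intros z Hz. apply Cmod_gt_0. specialize (B2 z). rewrite Cminus_0 in B2. specialize (B2 Hz).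
    assert (Q := Cmod_ge_0 (1 + k * (al * p0))%C). lra. }
  set (d := Rmin dl (Rmin d1 d2)).
  assert (Q1 : d <= dl) by apply Rmin_l.
  assert (Q2 : d <= d1) by (eapply Rle_trans; [apply Rmin_r|apply Rmin_l]).
  assert (Q3 : d <= d2) by (eapply Rle_trans; [apply Rmin_r|apply Rmin_r]).
  assert (Hd : 0 < d) by (repeat apply Rmin_pos; assumption).
  assert (Nc := RtoC_neq_0 c Hc). assert (Nr := RtoC_neq_0 r (Rgt_not_eq _ _ Hr)).
  (* This choice of [k] makes [(r / 2) / w'] exceed [(r / 2) / w] by exactly [u / c], the polar part
     of [V / c]. *)
  assert (Ek : (RtoC (r / 2) * k = RtoC (/ c))%C).
  { unfold k. rewrite <- RtoC_mult. f_equal. field. split; lra. }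
  assert (Pk : 0 < Cmod (1 + k * (al * p0))%C) by now apply Cmod_gt_0.
  assert (Lv3 : limC (fun z => RtoC (dot (rib_vec c Z Zt z) n)) 0
     (RtoC (1 + 2 * Re (l * p0)%C))).
  { assert (L := limC_plus _ _ _ _ _ (limC_plus _ _ _ _ _ (limC_const 1 0) Lgu)
      (limC_conj _ _ _ Lgu)). cbv beta in L.
    replace (1 + l * p0 + Cconj (l * p0))%C with (RtoC (1 + 2 * Re (l * p0)%C)) in L
      by (apply C_eq; Csimp; ring).
    refine (limC_ext_0 _ _ _ dl Hdl _ L). intros z Hz.
    rewrite (proj2 (HV z Hz)), Cmult_conj. reflexivity. }
  assert (Lln := limC_real_comp ln _ _ _ (limC_Cmod _ _ _ LD)
      (derivable_continuous_pt _ _ (exist _ _ (derivable_pt_lim_ln _ Pk)))).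
  apply (asymptotic_of_limits Zt be a b n sg r w' (hvec a b be)
    (dot be n + / c * (1 + 2 * Re (l * p0)%C) + sg * r * ln (Cmod (1 + k * (al * p0))%C))
    HT F Hr Hw').
  - assert (L := limC_minus _ _ _ _ _ LH
      (limC_mult _ _ _ _ _ (limC_const (RtoC (/ c)) 0) Lgg)). cbv beta in L.
    replace (hvec a b be - RtoC (/ c) * 0)%C with (hvec a b be) in L by ring.
    refine (limC_ext_0 _ _ _ d Hd _ L). intros z Hz.
    rewrite (proj1 (rib_coordinates c Z Zt a b n z Hc)), (proj1 (HV z ltac:(split; lra))).
    specialize (Nw z ltac:(lra)). specialize (PN z ltac:(lra)).
    assert (E : (RtoC (r / 2) / w' z = RtoC (r / 2) / w z + RtoC (/ c) * u z)%C).
    { rewrite <- Ek. unfold w'. field. split; assumption. }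
    rewrite E. ring.
  - assert (L := limC_plus _ _ _ _ _ (limC_plus _ _ _ _ _ L3
      (limC_mult _ _ _ _ _ (limC_const (RtoC (/ c)) 0) Lv3))
      (limC_mult _ _ _ _ _ (limC_const (RtoC (sg * r)) 0) Lln)). cbv beta in L.
    rewrite <- !RtoC_mult, <- !RtoC_plus in L.
    refine (limC_ext_0 _ _ _ d Hd _ L). intros z Hz. cbv beta.
    rewrite <- !RtoC_mult, <- !RtoC_plus. f_equal.
    rewrite (proj2 (rib_coordinates c Z Zt a b n z Hc)).
    specialize (Nw z ltac:(lra)). specialize (PN z ltac:(lra)).
    unfold w'. rewrite Cmod_div by exact PN. apply Cmod_gt_0 in Nw. apply Cmod_gt_0 in PN.
    unfold Rdiv. rewrite ln_mult, ln_Rinv; [ring| | |]; try assumption.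
    now apply Rinv_0_lt_compat.
Qed.

(** * Embeddedness *)

Lemma segment_bound (h : C -> R) (F : C -> C) (z w : C) (B : R) :
  (forall t, 0 <= t <= 1 -> rdiff h (line z (w - z)%C t) (Re (F (line z (w - z)%C t)))
     (- Im (F (line z (w - z)%C t)))) ->
  (forall t, 0 <= t <= 1 -> Cmod (F (line z (w - z)%C t)) <= B) ->
  Rabs (h w - h z) <= B * Cmod (w - z)%C.
Proof.
  intros HD HB.
  destruct (MVT_cor2 (fun t => h (line z (w - z)%C t))
    (fun t => Re (F (line z (w - z)%C t) * (w - z))%C) 0 1 Rlt_0_1) as [t [E Ht]].
  - intros t Ht. apply is_derive_Reals.
    replace (Re (F (line z (w - z)%C t) * (w - z))%C) with
      (Re (F (line z (w - z)%C t)) * Re (w - z)%C + - Im (F (line z (w - z)%C t)) * Im (w - z)%C)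
      by (Csimp; ring).
    apply (rdiff_comp h (line z (w - z)%C)); [now apply HD|apply pdiff_line].
  - replace (line z (w - z)%C 1) with w in E by (unfold line; ring).
    rewrite line_0 in E. rewrite E, Rminus_0_r, Rmult_1_r.
    eapply Rle_trans; [apply re_le_Cmod|]. rewrite Cmod_mult.
    apply Rmult_le_compat_r; [apply Cmod_ge_0|]. apply HB. lra.
Qed.

Lemma line_convex (z w : C) (t : R) : 0 <= t <= 1 -> Cmod w <= Cmod z ->
  Cmod z - Cmod (w - z)%C <= Cmod (line z (w - z)%C t) <= Cmod z.
Proof.
  intros Ht Hw. unfold line. split.
  - assert (T := Cmod_rev_triangle z (- (RtoC t * (w - z)))%C).
    replace (z - - (RtoC t * (w - z)))%C with (z + RtoC t * (w - z))%C in T by ring.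
    rewrite Cmod_opp, Cmod_mult, Cmod_R, Rabs_pos_eq in T by lra.
    assert (P := Cmod_ge_0 (w - z)%C). nra.
  - replace (z + RtoC t * (w - z))%C with (RtoC (1 - t) * z + RtoC t * w)%C
      by (rewrite RtoC_minus; ring).
    eapply Rle_trans; [apply Cmod_triangle|].
    rewrite !Cmod_mult, !Cmod_R, !Rabs_pos_eq by lra.
    assert (P := Cmod_ge_0 w). nra.
Qed.

(* Write [k] for the difference between the horizontal coordinate and its pole [A / z].
   Far apart points are separated because [k = o(1/z)], close ones because
   [dk = o(1/z^2)]; the segment between close points stays away from the puncture. *)
Lemma pole_separation (R0 : R) (X : C -> vec) (a b : vec) (A : C) : 0 < R0 -> A <> 0 ->
  harm (punctured_disk R0) (fun z => dot (X z) a) (hgrad X a) ->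
  harm (punctured_disk R0) (fun z => dot (X z) b) (hgrad X b) ->
  limC (fun z => z * hcoord X a b z)%C 0 A ->
  exists d m, 0 < d < R0 /\ 0 < m /\ forall z w, punctured_disk d z -> punctured_disk d w ->
    m * Cmod (z - w)%C <= Cmod (hcoord X a b z - hcoord X a b w)%C.
Proof.
  intros HR HA Ha Hb HL.
  destruct (pole_gradients R0 X a b A HR Ha Hb HL) as [Ga Gb].
  pose (h1 := fun z => 1 * dot (X z) a + -1 * Re (A / z)%C).
  pose (h2 := fun z => 1 * dot (X z) b + -1 * Re (Ci * A / z)%C).
  pose (F1 := fun z => (RtoC 1 * hgrad X a z + RtoC (-1) * (- A / (z * z)))%C).
  pose (F2 := fun z => (RtoC 1 * hgrad X b z + RtoC (-1) * (- (Ci * A) / (z * z)))%C).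
  assert (H1 : harm (punctured_disk R0) h1 F1) by exact (harm_lin _ _ _ _ _ 1 (-1) Ha (harm_Re_inv R0 A)).
  assert (H2 : harm (punctured_disk R0) h2 F2)
    by exact (harm_lin _ _ _ _ _ 1 (-1) Hb (harm_Re_inv R0 (Ci * A)%C)).
  pose (k := fun z => (hcoord X a b z - A / z)%C).
  assert (RM : RtoC (-1) = (- RtoC 1)%C) by (apply C_eq; Csimp; ring).
  assert (L1 : limC (fun z => z * z * F1 z)%C 0 0).
  { apply limC_0_minus in Ga. refine (limC_ext_0 _ _ _ 1 Rlt_0_1 _ Ga). intros z Hz. unfold F1.
    rewrite RM. field. apply Cmod_gt_0. lra. }
  assert (L2 : limC (fun z => z * z * F2 z)%C 0 0).
  { apply limC_0_minus in Gb. refine (limC_ext_0 _ _ _ 1 Rlt_0_1 _ Gb). intros z Hz. unfold F2.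
    rewrite RM. field. apply Cmod_gt_0. lra. }
  assert (Lk : limC (fun z => z * k z)%C 0 0).
  { apply limC_0_minus in HL. refine (limC_ext_0 _ _ _ 1 Rlt_0_1 _ HL). intros z Hz. unfold k.
    field. apply Cmod_gt_0. lra. }
  assert (PA : 0 < Cmod A) by now apply Cmod_gt_0.
  (* Then [8 e = |A| / 4]: the perturbation [k] costs at most a quarter of the separation
     [|A| |z - w| / (|z| |w|)] due to the pole, and half of it is claimed. *)
  set (e := Cmod A / 32). assert (He : 0 < e) by (unfold e; lra).
  destruct (limC_0_elim _ e L1 He) as [d1 [Hd1 B1]].
  destruct (limC_0_elim _ e L2 He) as [d2 [Hd2 B2]].
  destruct (limC_0_elim _ e Lk He) as [d3 [Hd3 B3]].
  set (d := Rmin (R0 / 2) (Rmin d1 (Rmin d2 d3))).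
  assert (Q0 : d <= R0 / 2) by apply Rmin_l.
  assert (Q1 : d <= d1) by (eapply Rle_trans; [apply Rmin_r|apply Rmin_l]).
  assert (Q2 : d <= d2)
    by (eapply Rle_trans; [apply Rmin_r|eapply Rle_trans; [apply Rmin_r|apply Rmin_l]]).
  assert (Q3 : d <= d3)
    by (eapply Rle_trans; [apply Rmin_r|eapply Rle_trans; [apply Rmin_r|apply Rmin_r]]).
  assert (Hd : 0 < d) by (repeat apply Rmin_pos; lra).
  assert (KEY : forall z w, punctured_disk d z -> punctured_disk d w -> Cmod w <= Cmod z ->
    Cmod (k w - k z)%C <= 8 * e * (Cmod (w - z)%C / (Cmod z * Cmod w))).
  { intros z w [Z1 Z2] [W1 W2] Hzw.
    assert (P := Cmod_ge_0 (w - z)%C).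
    (* Below this threshold the segment keeps modulus at least [|z| / 2], so the gradient bound
       along it loses only a factor 4. *)
    destruct (Rle_lt_dec (Cmod z / 2) (Cmod (w - z)%C)) as [Hfar|Hnear].
    - assert (Kz := B3 z ltac:(lra)). assert (Kw := B3 w ltac:(lra)).
      rewrite Cmod_mult in Kz, Kw.
      assert (T : Cmod (k w - k z)%C <= Cmod (k w) + Cmod (k z)).
      { eapply Rle_trans; [apply Cmod_triangle|]. rewrite Cmod_opp. lra. }
      apply Rmult_le_reg_r with (Cmod z * Cmod w); [nra|].
      replace (8 * e * (Cmod (w - z)%C / (Cmod z * Cmod w)) * (Cmod z * Cmod w))
        with (8 * e * Cmod (w - z)%C) by (field; lra).
      assert (P1 := Cmod_ge_0 (k z)). assert (P2 := Cmod_ge_0 (k w)).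
      apply Rle_trans with ((Cmod (k w) + Cmod (k z)) * (Cmod z * Cmod w));
        [apply Rmult_le_compat_r; [nra|exact T]|].
      assert (X1 : Cmod w * Cmod (k w) * Cmod z <= e * Cmod z)
        by (apply Rmult_le_compat_r; lra).
      assert (X2 : Cmod z * Cmod (k z) * Cmod w <= e * Cmod w)
        by (apply Rmult_le_compat_r; lra).
      assert (X3 : e * Cmod w <= e * Cmod z) by (apply Rmult_le_compat_l; lra).
      assert (X4 : e * (Cmod z / 2) <= e * Cmod (w - z)%C) by (apply Rmult_le_compat_l; lra).
      assert (X5 : 0 <= e * Cmod (w - z)%C) by (apply Rmult_le_pos; lra).
      lra.
    - assert (SEG : forall t, 0 <= t <= 1 -> punctured_disk d (line z (w - z)%C t) /\
        Cmod z / 2 <= Cmod (line z (w - z)%C t)).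
      { intros t Ht. assert (S := line_convex z w t Ht Hzw). split; [split|]; lra. }
      assert (SB : forall (F : C -> C), (forall v, 0 < Cmod v < d -> Cmod (v * v * F v)%C < e) ->
        forall t, 0 <= t <= 1 -> Cmod (F (line z (w - z)%C t)) <= 4 * e / (Cmod z * Cmod z)).
      { intros F HF t Ht. destruct (SEG t Ht) as [S1 S2].
        specialize (HF _ S1). rewrite !Cmod_mult in HF.
        set (v := Cmod (line z (w - z)%C t)) in *. set (q := Cmod (F _)) in *.
        assert (Pq : 0 <= q) by apply Cmod_ge_0.
        apply Rmult_le_reg_r with (Cmod z * Cmod z); [nra|].
        replace (4 * e / (Cmod z * Cmod z) * (Cmod z * Cmod z)) with (4 * e) by (field; lra).
        assert (Cmod z * Cmod z <= 4 * (v * v)) by nra. nra. }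
      assert (D1 : Rabs (h1 w - h1 z) <= 4 * e / (Cmod z * Cmod z) * Cmod (w - z)%C).
      { apply (segment_bound h1 F1).
        - intros t Ht. apply (proj2 H1). destruct (SEG t Ht) as [[S1 S2] _]. split; lra.
        - apply SB. intros v Hv. apply B1. lra. }
      assert (D2 : Rabs (h2 w - h2 z) <= 4 * e / (Cmod z * Cmod z) * Cmod (w - z)%C).
      { apply (segment_bound h2 F2).
        - intros t Ht. apply (proj2 H2). destruct (SEG t Ht) as [[S1 S2] _]. split; lra.
        - apply SB. intros v Hv. apply B2. lra. }
      assert (KP : forall v, k v = (h1 v, - h2 v)).
      { intros v. unfold k, h1, h2, hcoord, hvec, Cdiv. rewrite <- Cmult_assoc.
        generalize (A * / v)%C. intros q. apply C_eq; Csimp; ring. }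
      rewrite !KP.
      eapply Rle_trans; [apply Cmod_le_Re_Im|]. Csimp.
      replace (- h2 w - - h2 z) with (- (h2 w - h2 z)) by ring. rewrite Rabs_Ropp.
      apply Rle_trans with (8 * e * (Cmod (w - z)%C / (Cmod z * Cmod z))).
      + replace (8 * e * (Cmod (w - z)%C / (Cmod z * Cmod z))) with
          (4 * e / (Cmod z * Cmod z) * Cmod (w - z)%C + 4 * e / (Cmod z * Cmod z) * Cmod (w - z)%C)
          by (field; lra). lra.
      + apply Rmult_le_compat_l; [lra|]. apply Rmult_le_compat_l; [exact P|].
        apply Rinv_le_contravar; nra. }
  assert (KEY2 : forall z w, punctured_disk d z -> punctured_disk d w ->
    Cmod (k z - k w)%C <= 8 * e * (Cmod (z - w)%C / (Cmod z * Cmod w))).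
  { intros z w Hz Hw. destruct (Rle_lt_dec (Cmod w) (Cmod z)) as [H|H].
    - rewrite (Cmod_minus_sym (k z)), (Cmod_minus_sym z). now apply KEY.
    - rewrite (Rmult_comm (Cmod z)). apply KEY; auto. lra. }
  exists d, (Cmod A / (2 * (d * d))). split; [lra|].
  split; [apply Rdiv_lt_0_compat; nra|]. intros z w Hz Hw.
  specialize (KEY2 z w Hz Hw). destruct Hz as [Z1 Z2], Hw as [W1 W2].
  assert (Nz : z <> 0) by now apply Cmod_gt_0. assert (Nw : w <> 0) by now apply Cmod_gt_0.
  set (D := Cmod (z - w)%C / (Cmod z * Cmod w)) in *.
  assert (EA : Cmod (A / z - A / w)%C = Cmod A * D).
  { replace (A / z - A / w)%C with (A * ((w - z) / (z * w)))%C by (field; now split).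
    rewrite Cmod_mult, Cmod_div, (Cmod_mult z w), (Cmod_minus_sym w z); [reflexivity|].
    now apply Cmult_neq_0. }
  assert (T : Cmod (A / z - A / w)%C - Cmod (k z - k w)%C <=
    Cmod (hcoord X a b z - hcoord X a b w)%C).
  { assert (T := Cmod_rev_triangle (A / z - A / w)%C (- (k z - k w))%C).
    rewrite Cmod_opp in T. eapply Rle_trans; [exact T|]. right. f_equal. unfold k. ring. }
  assert (PD : Cmod (z - w)%C / (d * d) <= D).
  { unfold D. apply Rmult_le_compat_l; [apply Cmod_ge_0|]. apply Rinv_le_contravar; nra. }
  replace (Cmod A / (2 * (d * d)) * Cmod (z - w)%C) with
    (Cmod A / 2 * (Cmod (z - w)%C / (d * d))) by (field; lra).
  assert (PD0 : 0 <= D).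
  { unfold D. apply Rdiv_le_0_compat; [apply Cmod_ge_0|nra]. }
  apply Rle_trans with (Cmod A / 2 * D); [apply Rmult_le_compat_l; lra|].
  unfold e in KEY2. nra.
Qed.

(** Separation makes the inverse Lipschitz, whence injectivity and continuity of the inverse at
    once. *)
Lemma embedded_of_pole (R0 : R) (X : C -> vec) (a b n : vec) (A : C) : 0 < R0 -> A <> 0 ->
  oframe a b n 1 ->
  harm (punctured_disk R0) (fun z => dot (X z) a) (hgrad X a) ->
  harm (punctured_disk R0) (fun z => dot (X z) b) (hgrad X b) ->
  limC (fun z => z * hcoord X a b z)%C 0 A ->
  embedded_near_0 R0 X.
Proof.
  intros HR HA F Ha Hb HL.
  destruct (pole_separation R0 X a b A HR HA Ha Hb HL) as [d [m [Hd [Hm SEP]]]].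
  assert (SEP' : forall z w, punctured_disk d z -> punctured_disk d w ->
    m * Cmod (z - w)%C <= 2 * norm3 (minus (X z) (X w))).
  { intros z w Hz Hw. eapply Rle_trans; [apply (SEP z w Hz Hw)|].
    eapply Rle_trans; [apply Cmod_le_Re_Im|].
    unfold hcoord, hvec. Csimp.
    replace (- dot (X z) b - - dot (X w) b) with (- (dot (X z) b - dot (X w) b)) by ring.
    rewrite Rabs_Ropp, <- !dot_minus_l.
    destruct (frame_norm_ge a b n (minus (X z) (X w)) F) as [N1 [N2 _]]. lra. }
  exists d. split; [exact Hd|]. split.
  - intros z w Hz Hw E. specialize (SEP' z w Hz Hw). rewrite E in SEP'.
    replace (norm3 (minus (X w) (X w))) with 0 in SEP'.
    + apply Cmod_minus_eq_0. assert (P := Cmod_ge_0 (z - w)%C). nra.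
    + unfold norm3. replace (dot _ _) with 0; [now rewrite sqrt_0|].
      autorewrite with dots. ring.
  - intros z Hz e He. exists (m * e / 2). split; [nra|]. intros w Hw HN.
    specialize (SEP' w z Hw Hz). apply Rmult_lt_reg_l with m; [exact Hm|]. lra.
Qed.

(** * Completeness *)

Lemma log_unbounded (X : C -> vec) (n : vec) (s l M : R) : s <> 0 ->
  limC (fun z => RtoC (dot (X z) n - s * ln (Cmod z))) 0 (RtoC l) ->
  exists d, 0 < d /\ forall z, 0 < Cmod z < d -> M < Rabs (dot (X z) n).
Proof.
  intros Hs HL. destruct (limC_bounded _ _ _ HL) as [d [Hd B]].
  set (K := (Rabs M + Cmod (RtoC l) + 1) / Rabs s).
  assert (Ps : 0 < Rabs s) by now apply Rabs_pos_lt.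
  exists (Rmin d (exp (- K))). split; [apply Rmin_pos; [exact Hd|apply exp_pos]|].
  intros z Hz. assert (Q1 := Rmin_l d (exp (- K))). assert (Q2 := Rmin_r d (exp (- K))).
  specialize (B z). rewrite Cminus_0, Cmod_R in B. specialize (B ltac:(lra)).
  assert (L : ln (Cmod z) < - K).
  { rewrite <- (ln_exp (- K)). apply ln_increasing; lra. }
  assert (S : Rabs M + Cmod (RtoC l) + 1 < Rabs (s * ln (Cmod z))).
  { rewrite Rabs_mult. apply Rlt_le_trans with (Rabs s * - ln (Cmod z)).
    - replace (Rabs M + Cmod (RtoC l) + 1) with (Rabs s * K) by (unfold K; field; lra).
      apply Rmult_lt_compat_l; lra.
    - apply Rmult_le_compat_l; [lra|]. rewrite <- Rabs_Ropp. apply Rle_abs. }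
  assert (T := Rabs_triang_inv (s * ln (Cmod z)) (dot (X z) n)).
  rewrite Rabs_minus_sym in T. assert (Q := Rle_abs M). lra.
Qed.

Lemma norm3_pow (p : vec) : norm3 p = sqrt (x1 p ^ 2 + x2 p ^ 2 + x3 p ^ 2).
Proof. unfold norm3, dot. f_equal. ring. Qed.

(** The length of a path dominates the variation of the height [<X, n>], which diverges
    logarithmically at the puncture. *)
Lemma complete_of_log (eps : R) (X : C -> vec) (a b n : vec) (s l : R) :
  vsmooth_on (punctured_disk eps) X -> oframe a b n 1 -> s <> 0 ->
  limC (fun z => RtoC (dot (X z) n - s * ln (Cmod z))) 0 (RtoC l) ->
  complete_at_0 eps X.
Proof.
  intros HX F Hs HL gam [G1 G2] Hin Hlim.
  assert (HU := open_punctured eps).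
  pose (vd := fun (f : C -> R) t => pd1 f (gam t) * Derive (fun s => Re (gam s)) t +
     pd2 f (gam t) * Derive (fun s => Im (gam s)) t).
  assert (Dg : forall t, 0 <= t -> pdiff gam t (path_derive gam t)).
  { intros t Ht. split; apply Derive_correct; [apply G1|apply G2]; exact Ht. }
  assert (Cg : forall t, 0 <= t -> continuous gam t).
  { intros t Ht. apply (continuous_ext (fun t => (Re (gam t), Im (gam t)))).
    { intros s'. apply C_eq; reflexivity. }
    apply (continuous_comp_2 (fun t => Re (gam t)) (fun t => Im (gam t)) (fun x y => (x, y))).
    - apply (ex_derive_continuous (V := R_NormedModule)). apply G1. exact Ht.
    - apply (ex_derive_continuous (V := R_NormedModule)). apply G2. exact Ht.
    - apply (continuous_ext (fun p => p)); [intros [x y]; reflexivity|apply continuous_id]. }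
  assert (Cf : forall (f : C -> R) t, smooth_on (punctured_disk eps) f -> 0 <= t ->
    continuous (fun t => f (gam t)) t).
  { intros f t Hf Ht. apply (continuous_comp gam f); [now apply Cg|].
    assert (Q := smooth_continuity _ f (gam t) Hf (Hin t Ht)).
    apply continuity_2d_pt_filterlim in Q.
    apply (continuous_ext (fun p : C => f (fst p, snd p))); [intros [x y]; reflexivity|].
    exact Q. }
  assert (Df : forall (f : C -> R) t, smooth_on (punctured_disk eps) f -> 0 <= t ->
    is_derive (fun t => f (gam t)) t (vd f t)).
  { intros f t Hf Ht.
    exact (rdiff_comp f gam t _ _ _ (smooth_rdiff _ f (gam t) HU Hf (Hin t Ht)) (Dg t Ht)). }
  assert (Cvd : forall (f : C -> R) t, smooth_on (punctured_disk eps) f -> 0 <= t ->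
    continuous (vd f) t).
  { intros f t Hf Ht. apply (continuous_plus (V := R_NormedModule));
    apply (continuous_mult (K := R_AbsRing)).
    - apply (Cf (pd1 f)); [now apply smooth_pd1|exact Ht].
    - apply G1. exact Ht.
    - apply (Cf (pd2 f)); [now apply smooth_pd2|exact Ht].
    - apply G2. exact Ht. }
  destruct HX as [S1 [S2 S3]].
  pose (v := fun t => (vd (fun w => x1 (X w)) t, vd (fun w => x2 (X w)) t,
     vd (fun w => x3 (X w)) t) : vec).
  assert (SP : forall t, 0 <= t -> path_speed (fun s => X (gam s)) t = norm3 (v t)).
  { intros t Ht. rewrite norm3_pow. unfold path_speed, v. autorewrite with vecs.
    f_equal. f_equal; [f_equal|]; f_equal; apply is_derive_unique.
    - exact (Df _ t S1 Ht).
    - exact (Df _ t S2 Ht).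
    - exact (Df _ t S3 Ht). }
  pose (hd := fun t => x1 n * vd (fun w => x1 (X w)) t + x2 n * vd (fun w => x2 (X w)) t
    + x3 n * vd (fun w => x3 (X w)) t).
  assert (Hhd : forall t, 0 <= t -> is_derive (fun t => dot (X (gam t)) n) t (hd t)).
  { intros t Ht. unfold hd.
    apply (is_derive_ext (fun t => x1 n * x1 (X (gam t)) + x2 n * x2 (X (gam t))
      + x3 n * x3 (X (gam t)))).
    { intros s'. unfold dot. apply Rminus_diag_uniq. ring. }
    apply (is_derive_plus (V := R_NormedModule)); [apply (is_derive_plus (V := R_NormedModule))|];
    apply is_derive_scal.
    - exact (Df _ t S1 Ht).
    - exact (Df _ t S2 Ht).
    - exact (Df _ t S3 Ht). }
  assert (Chd : forall t, 0 <= t -> continuous hd t).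
  { intros t Ht. unfold hd.
    apply (continuous_plus (V := R_NormedModule)); [apply (continuous_plus (V := R_NormedModule))|];
    apply (continuous_scal_r (V := R_NormedModule)); now apply Cvd. }
  assert (Cv : forall t, 0 <= t -> continuous (fun t => norm3 (v t)) t).
  { intros t Ht. apply (continuous_ext (fun t => sqrt (vd (fun w => x1 (X w)) t *
      vd (fun w => x1 (X w)) t + vd (fun w => x2 (X w)) t * vd (fun w => x2 (X w)) t +
      vd (fun w => x3 (X w)) t * vd (fun w => x3 (X w)) t))).
    { intros s'. reflexivity. }
    apply (continuous_comp _ sqrt); [|apply continuous_sqrt].
    apply (continuous_plus (V := R_NormedModule)); [apply (continuous_plus (V := R_NormedModule))|];
    apply (continuous_mult (K := R_AbsRing)); now apply Cvd. }
  assert (LEN : forall t, 0 <= t -> Rabs (dot (X (gam t)) n - dot (X (gam 0)) n) <=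
    RInt (path_speed (fun s => X (gam s))) 0 t).
  { intros t Ht.
    assert (I1 : is_RInt hd 0 t (dot (X (gam t)) n - dot (X (gam 0)) n)).
    { apply (is_RInt_derive (V := R_CompleteNormedModule) (fun t => dot (X (gam t)) n));
      intros s'; rewrite Rmin_left by exact Ht; intros Hs'; [apply Hhd|apply Chd]; lra. }
    rewrite <- (is_RInt_unique _ _ _ _ I1).
    rewrite (RInt_ext (path_speed (fun s => X (gam s))) (fun t => norm3 (v t))).
    2:{ intros s'. rewrite Rmin_left by exact Ht. intros Hs'. apply SP. lra. }
    eapply Rle_trans; [apply (abs_RInt_le hd 0 t Ht); eexists; exact I1|].
    apply RInt_le; [exact Ht| | |].
    - apply (ex_RInt_continuous (V := R_CompleteNormedModule)). intros s'.
      rewrite Rmin_left by exact Ht. intros Hs'.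
      apply (continuous_comp hd Rabs); [apply Chd; lra|apply continuous_Rabs].
    - apply (ex_RInt_continuous (V := R_CompleteNormedModule)). intros s'.
      rewrite Rmin_left by exact Ht. intros Hs'. apply Cv. lra.
    - intros s' Hs'. destruct (frame_norm_ge a b n (v s') F) as [_ [_ N]].
      replace (hd s') with (dot (v s') n); [exact N|]. unfold dot, hd, v.
      autorewrite with vecs. ring. }
  intros P [M HP].
  destruct (log_unbounded X n s l (Rabs M + Rabs (dot (X (gam 0)) n)) Hs HL) as [d [Hd HB]].
  assert (Ev : Rbar_locally p_infty (fun t => Cmod (gam t) < d)).
  { apply (Hlim (fun w => Cmod w < d)). apply locally_C_iff. exists d. split; auto. }
  destruct Ev as [T HT]. exists (Rmax 0 T). intros t Ht.
  assert (T0 := Rmax_l 0 T). assert (T1 := Rmax_r 0 T).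
  apply HP. specialize (HT t ltac:(lra)).
  assert (Q := HB (gam t) (conj (proj1 (Hin t ltac:(lra))) HT)).
  assert (Q2 := LEN t ltac:(lra)).
  assert (Q3 := Rabs_triang_inv (dot (X (gam t)) n) (dot (X (gam 0)) n)).
  assert (Q4 := Rle_abs M). lra.
Qed.

(** * Total curvature *)

(** Makes the inner integral in polar coordinates a continuous function of the radius, so that the
    outer one exists. *)
Lemma RInt_param_continuous (f : R -> R -> R) (r0 : R) :
  (forall t, 0 <= t <= 2 * PI -> continuity_2d_pt f r0 t) ->
  locally r0 (fun r => ex_RInt (f r) 0 (2 * PI)) ->
  continuous (fun r => RInt (f r) 0 (2 * PI)) r0.
Proof.
  intros Hf Hex. assert (P := two_PI_pos). apply filterlim_locally. intros e.
  assert (He : 0 < e / (2 * (2 * PI))) by (apply Rdiv_lt_0_compat; [apply cond_pos|lra]).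
  destruct (uniform_continuity_2d_1d' f 0 (2 * PI) r0 Hf (mkposreal _ He)) as [d Hd].
  assert (HL : locally r0 (fun r => Rabs (r - r0) < d)).
  { exists d. intros r Hr. exact Hr. }
  eapply filter_imp; [|apply (filter_and _ _ HL Hex)].
  intros r [H1 H2]. change (Rabs (RInt (f r) 0 (2 * PI) - RInt (f r0) 0 (2 * PI)) < e).
  assert (E0 : ex_RInt (f r0) 0 (2 * PI)) by exact (locally_singleton _ _ Hex).
  assert (EM := ex_RInt_minus (V := R_NormedModule) _ _ _ _ H2 E0).
  assert (RM := RInt_minus (V := R_CompleteNormedModule) _ _ _ _ H2 E0).
  replace (RInt (f r) 0 (2 * PI) - RInt (f r0) 0 (2 * PI)) with
    (RInt (fun x => minus (f r x) (f r0 x)) 0 (2 * PI)) by exact RM.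
  apply Rle_lt_trans with ((2 * PI - 0) * (e / (2 * (2 * PI)))).
  - apply abs_RInt_le_const; [lra|exact EM|]. intros t Ht. left.
    apply Rabs_def2 in H1.
    apply (Hd t r0 t r); try lra. unfold Rminus. rewrite Rplus_opp_r, Rabs_R0. apply cond_pos.
  - replace ((2 * PI - 0) * (e / (2 * (2 * PI)))) with (e / 2) by (field; lra).
    assert (Q := cond_pos e). lra.
Qed.

(** A bounded density has finite integral over a disk; the point is a bound independent of the inner
    radius [s]. *)
Lemma polar_bounded (eps d M : R) (h : C -> R) : 0 < d < eps ->
  (forall z, punctured_disk eps z -> contC (fun w => RtoC (h w)) z) ->
  (forall z, 0 < Cmod z <= d -> Rabs (h z) <= M) ->
  forall s, 0 < s < d ->
    RInt (fun r => RInt (fun t => h (RtoC r * cis t)%C * r) 0 (2 * PI)) s d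
    <= d * (2 * PI * (M * d)).
Proof.
  intros Hd Hc HM s Hs. assert (P := two_PI_pos).
  assert (M0 : 0 <= M).
  { eapply Rle_trans; [apply Rabs_pos|apply (HM (RtoC d))]. rewrite Cmod_R, Rabs_pos_eq; lra. }
  assert (IN : forall r t, 0 < r < eps -> punctured_disk eps (RtoC r * cis t)%C).
  { intros r t Hr. unfold punctured_disk. rewrite Cmod_mult, Cmod_cis, Cmod_R, Rabs_pos_eq; lra. }
  pose (f := fun r t => h (RtoC r * cis t)%C * r).
  assert (C2 : forall r t, 0 < r < eps -> continuity_2d_pt f r t).
  { intros r t Hr.
    assert (J : contC (fun p => RtoC (h (RtoC (Re p) * cis (Im p))%C) * RtoC (Re p))%C (r, t)).
    { apply contC_mult; [|apply contC_fst_param].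
      apply (contC_comp (fun w => RtoC (h w)) (fun p => RtoC (Re p) * cis (Im p))%C).
      - apply contC_mult; [apply contC_fst_param|apply contC_cis].
      - apply Hc. exact (IN r t Hr). }
    apply contC_2d in J. destruct J as [J _].
    eapply continuity_2d_pt_ext; [|exact J]. intros x y. unfold f. Csimp. ring. }
  assert (EX : forall r, 0 < r < eps -> ex_RInt (f r) 0 (2 * PI)).
  { intros r Hr. apply (ex_RInt_continuous (V := R_CompleteNormedModule)).
    intros t _. apply continuity_2d_section. now apply C2. }
  assert (BD : forall r, 0 < r <= d -> Rabs (RInt (f r) 0 (2 * PI)) <= 2 * PI * (M * d)).
  { intros r Hr. replace (2 * PI * (M * d)) with ((2 * PI - 0) * (M * d)) by ring.
    apply abs_RInt_le_const; [lra|apply EX; lra|]. intros t _. unfold f.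
    rewrite Rabs_mult, (Rabs_pos_eq r) by lra.
    apply Rmult_le_compat; [apply Rabs_pos|lra| |lra].
    apply HM. rewrite Cmod_mult, Cmod_cis, Cmod_R, Rabs_pos_eq; lra. }
  eapply Rle_trans; [apply Rle_abs|].
  apply Rle_trans with ((d - s) * (2 * PI * (M * d))).
  - apply abs_RInt_le_const; [lra| |].
    + apply (ex_RInt_continuous (V := R_CompleteNormedModule)). intros r Hr.
      rewrite Rmin_left, Rmax_right in Hr by lra.
      apply (RInt_param_continuous f).
      * intros t _. apply C2. lra.
      * assert (HL : locally r (fun u => 0 < u < eps)).
        { apply (locally_interval _ r 0 eps); simpl; try tauto; lra. }
        eapply filter_imp; [|exact HL]. intros u Hu. now apply EX.
    + intros r Hr. apply BD. lra.
  - apply Rmult_le_compat_r; [|lra]. apply Rmult_le_pos; [lra|]. nra.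
Qed.

Lemma contC_real_mult (f g : C -> R) (z : C) :
  contC (fun w => RtoC (f w)) z -> contC (fun w => RtoC (g w)) z ->
  contC (fun w => RtoC (f w * g w)) z.
Proof.
  intros H1 H2. apply (contC_ext (fun w => RtoC (f w) * RtoC (g w))%C _ z 1 Rlt_0_1).
  - intros w _. now rewrite RtoC_mult.
  - now apply contC_mult.
Qed.

Lemma contC_real_inv (f : C -> R) (z : C) (d : R) : 0 < d ->
  (forall w, Cmod (w - z)%C < d -> f w <> 0) ->
  contC (fun w => RtoC (f w)) z -> contC (fun w => RtoC (/ f w)) z.
Proof.
  intros Hd Hf H1. apply (contC_ext (fun w => / RtoC (f w))%C _ z d Hd).
  - intros w Hw. rewrite RtoC_inv; [reflexivity|now apply Hf].
  - apply contC_inv; [exact H1|]. apply RtoC_neq_0, Hf.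
    replace (z - z)%C with (RtoC 0) by ring. now rewrite Cmod_0.
Qed.

Lemma contC_dot_self (Y : C -> vec) (z : C) :
  (forall p, contC (fun w => RtoC (dot (Y w) p)) z) ->
  contC (fun w => RtoC (dot (Y w) (Y w))) z.
Proof.
  intros H.
  assert (H1 := H (1, 0, 0)). assert (H2 := H (0, 1, 0)). assert (H3 := H (0, 0, 1)).
  apply (contC_ext (fun w => RtoC (dot (Y w) (1, 0, 0) * dot (Y w) (1, 0, 0))
    + RtoC (dot (Y w) (0, 1, 0) * dot (Y w) (0, 1, 0))
    + RtoC (dot (Y w) (0, 0, 1) * dot (Y w) (0, 0, 1)))%C _ z 1 Rlt_0_1).
  - intros w _. rewrite <- !RtoC_plus. f_equal. vsimp. ring.
  - repeat apply contC_plus; now apply contC_real_mult.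
Qed.

Lemma hvec_norm (a b n p : vec) : oframe a b n 1 ->
  Cmod (hvec a b p) <= norm3 p.
Proof.
  intros F. assert (Q := of_parseval _ _ _ _ p p F).
  apply Rsqr_incr_0_var; [|apply sqrt_pos]. unfold Rsqr. rewrite norm3_sq, Cmod_sq.
  unfold hvec. Csimp. nra.
Qed.

(** Orders at the puncture balance: the conformal factor [|f|^2 (1 + |g|^2)^2 / 4] is [O(|z|^-4)],
    and [|V|] is at least of order [1 / |z|] through its horizontal part, so [|V|^4] compensates. *)
Lemma rib_curvature_bound (dl c : R) (Z Zt : C -> vec) (a b n : vec) (f g dg : C -> C)
    (mf p0 : C) : 0 < dl ->
  immersion_on (punctured_disk dl) Z -> conformal_on (punctured_disk dl) Z ->
  oframe a b n 1 -> weierstrass dl Z a b n f g dg -> rib_pair (punctured_disk dl) c Z Zt ->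
  limC (fun z => z * z * f z)%C 0 mf -> limC g 0 0 -> p0 <> 0 ->
  limC (fun z => z * hvec a b (rib_vec c Z Zt z))%C 0 p0 ->
  exists d M, 0 < d <= dl /\ forall z, 0 < Cmod z < d ->
    4 * (c * c) * first_form Z z e1 e1 / dot (rib_vec c Z Zt z) (rib_vec c Z Zt z) ^ 2 <= M.
Proof.
  intros Hdl HX HC F W RP Lf Lg Np Lp.
  destruct (limC_bounded _ _ _ Lf) as [d1 [Hd1 B1]].
  destruct (limC_0_elim _ 1 Lg Rlt_0_1) as [d2 [Hd2 B2]].
  destruct (limC_apart _ _ _ Lp Np) as [d3 [Hd3 B3]].
  set (d := Rmin dl (Rmin d1 (Rmin d2 d3))).
  assert (Q0 : d <= dl) by apply Rmin_l.
  assert (Q1 : d <= d1) by (eapply Rle_trans; [apply Rmin_r|apply Rmin_l]).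
  assert (Q2 : d <= d2)
    by (eapply Rle_trans; [apply Rmin_r|eapply Rle_trans; [apply Rmin_r|apply Rmin_l]]).
  assert (Q3 : d <= d3)
    by (eapply Rle_trans; [apply Rmin_r|eapply Rle_trans; [apply Rmin_r|apply Rmin_r]]).
  assert (Hd : 0 < d) by (repeat apply Rmin_pos; lra).
  set (k0 := Cmod p0 / 2).
  assert (Pk : 0 < k0) by (unfold k0; apply Cmod_gt_0 in Np; lra).
  set (Bf := Cmod mf + 1).
  exists d, (4 * (c * c) * (Bf * Bf) / (k0 * k0 * (k0 * k0))). split; [lra|]. intros z Hz.
  assert (Uz : punctured_disk dl z) by (split; lra).
  destruct (weierstrass_gauss dl Z a b n f g dg z HX HC F W Uz) as [HE _].
  cbv zeta in HE. rewrite <- !Cmod_sq in HE. rewrite HE.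
  specialize (B1 z). specialize (B2 z ltac:(lra)). specialize (B3 z).
  rewrite Cminus_0 in B1, B3. specialize (B1 ltac:(lra)). specialize (B3 ltac:(lra)).
  rewrite !Cmod_mult in B1. rewrite Cmod_mult in B3. fold k0 in B3. fold Bf in B1.
  assert (PV := rp_neq_0 _ _ _ _ RP z Uz).
  assert (HV := hvec_norm a b n (rib_vec c Z Zt z) F).
  assert (NV := norm3_sq (rib_vec c Z Zt z)).
  set (q := dot (rib_vec c Z Zt z) (rib_vec c Z Zt z)) in *.
  set (m := Cmod z) in *. set (ff := Cmod (f z)) in *. set (gg := Cmod (g z)) in *.
  set (h := norm3 (rib_vec c Z Zt z)) in *. set (hv := Cmod (hvec _ _ _)) in *.
  assert (Pf : 0 <= ff) by apply Cmod_ge_0. assert (Pg : 0 <= gg) by apply Cmod_ge_0.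
  assert (Phv : 0 <= hv) by apply Cmod_ge_0.
  assert (S1 : k0 < m * h) by (assert (m * hv <= m * h) by (apply Rmult_le_compat_l; lra); lra).
  assert (Pc : 0 <= c * c) by nra.
  assert (T1 : ff * ff * (m * m * (m * m)) <= Bf * Bf).
  { assert (A1 : 0 <= m * m * ff) by (apply Rmult_le_pos; nra).
    replace (ff * ff * (m * m * (m * m))) with ((m * m * ff) * (m * m * ff)) by ring.
    apply Rmult_le_compat; lra. }
  assert (T2 : k0 * k0 * (k0 * k0) <= m * m * (m * m) * (q * q)).
  { replace (m * m * (m * m) * (q * q)) with ((m * h) * (m * h) * ((m * h) * (m * h)))
      by (rewrite <- NV; ring).
    assert (k0 * k0 <= (m * h) * (m * h)) by (apply Rmult_le_compat; lra).
    apply Rmult_le_compat; nra. }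
  assert (T3 : (1 + gg * gg) * (1 + gg * gg) <= 4).
  { assert (gg * gg <= 1) by nra. nra. }
  set (S2 := (1 + gg * gg) * (1 + gg * gg)) in *.
  assert (P2 : 0 <= S2) by (unfold S2; nra).
  assert (Pk2 : 0 < k0 * k0) by (apply Rmult_lt_0_compat; exact Pk).
  assert (Pk4 : 0 < k0 * k0 * (k0 * k0)) by (apply Rmult_lt_0_compat; exact Pk2).
  apply Rmult_le_reg_r with (q * q * (k0 * k0 * (k0 * k0)));
    [apply Rmult_lt_0_compat; [now apply Rmult_lt_0_compat|exact Pk4]|].
  replace (4 * (c * c) * (ff * ff * S2 / 4) / q ^ 2 * (q * q * (k0 * k0 * (k0 * k0))))
    with (c * c * (ff * ff * S2 * (k0 * k0 * (k0 * k0)))) by (field; lra).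
  replace (4 * (c * c) * (Bf * Bf) / (k0 * k0 * (k0 * k0)) * (q * q * (k0 * k0 * (k0 * k0))))
    with (c * c * (4 * (Bf * Bf) * (q * q))) by (field; lra).
  apply Rmult_le_compat_l; [exact Pc|].
  apply Rle_trans with (ff * ff * S2 * (m * m * (m * m) * (q * q))).
  - apply Rmult_le_compat_l; [|exact T2]. apply Rmult_le_pos; nra.
  - replace (ff * ff * S2 * (m * m * (m * m) * (q * q))) with
      (ff * ff * (m * m * (m * m)) * S2 * (q * q)) by ring.
    apply Rmult_le_compat_r; [nra|].
    rewrite (Rmult_comm 4). apply Rmult_le_compat; try assumption.
    apply Rmult_le_pos; nra.
Qed.

Lemma rib_finite_curvature (eps c d M : R) (Z Zt : C -> vec) : 0 < d <= eps ->
  minimal_immersion_on (punctured_disk eps) Z -> conformal_on (punctured_disk eps) Z ->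
  immersion_on (punctured_disk eps) Zt -> rib_pair (punctured_disk eps) c Z Zt ->
  (forall z, 0 < Cmod z < d ->
    4 * (c * c) * first_form Z z e1 e1 / dot (rib_vec c Z Zt z) (rib_vec c Z Zt z) ^ 2 <= M) ->
  finite_total_curvature_at_0 eps Zt.
Proof.
  intros Hd HZ HC HZt RP HM.
  assert (HU := open_punctured eps).
  (* This form of the curvature density is manifestly continuous on the whole punctured disk. *)
  pose (h := fun z => 4 * (c * c) * first_form Z z e1 e1
     * / (dot (rib_vec c Z Zt z) (rib_vec c Z Zt z) * dot (rib_vec c Z Zt z) (rib_vec c Z Zt z))).
  assert (Hh : forall z, punctured_disk eps z -> h z =
    4 * (c * c) * first_form Z z e1 e1 / dot (rib_vec c Z Zt z) (rib_vec c Z Zt z) ^ 2).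
  { intros z Hz. assert (Q := rp_neq_0 _ _ _ _ RP z Hz). unfold h. field. lra. }
  assert (Ph : forall z, punctured_disk eps z -> 0 <= h z).
  { intros z Hz. assert (Q := rp_neq_0 _ _ _ _ RP z Hz). unfold h.
    apply Rmult_le_pos; [|left; apply Rinv_0_lt_compat; nra].
    apply Rmult_le_pos; [nra|apply dot_pos]. }
  assert (Ch : forall z, punctured_disk eps z -> contC (fun w => RtoC (h w)) z).
  { intros z Hz. destruct (HU z Hz) as [d0 [Hd0 HB]].
    assert (A1 : axis e1) by now left.
    assert (Cq : contC (fun w => RtoC (dot (rib_vec c Z Zt w) (rib_vec c Z Zt w))) z).
    { apply contC_dot_self. intros p.
      exact (contC_rib_dot _ c Z Zt p z (proj1 (proj1 HZ)) (proj1 HZt) Hz). }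
    unfold h. apply contC_real_mult; [apply contC_real_mult; [apply contC_const|]|].
    - apply (contC_dot_self (fun w => vdiff Z w e1)). intros p.
      exact (contC_dot _ _ p z (vsmooth_vdiff _ Z e1 A1 (proj1 (proj1 HZ))) Hz).
    - apply (contC_real_inv _ z d0 Hd0); [|now apply contC_real_mult].
      intros w Hw. assert (Q := rp_neq_0 _ _ _ _ RP w (HB w Hw)). nra. }
  (* Halving turns the bound on [Cmod z < d] into one up to the boundary circle, and gives
     [d' < eps]. *)
  set (d' := d / 2).
  assert (Bd : forall z, 0 < Cmod z <= d' -> Rabs (h z) <= M).
  { intros z Hz. assert (Uz : punctured_disk eps z) by (unfold d' in *; split; lra).
    rewrite Rabs_pos_eq by now apply Ph. rewrite (Hh z Uz). apply HM. unfold d' in *; lra. }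
  assert (Hd' : 0 < d' < eps) by (unfold d'; lra).
  exists d', (d' * (2 * PI * (M * d'))). split; [exact Hd'|]. intros s Hs.
  eapply Rle_trans; [right|exact (polar_bounded eps d' M h Hd' Ch Bd s Hs)].
  apply RInt_ext. intros r. rewrite Rmin_left, Rmax_right by lra. intros Hr.
  apply RInt_ext. intros t _. cbv zeta.
  replace (r * cos t, r * sin t) with (RtoC r * cis t)%C
    by (unfold cis; apply C_eq; Csimp; ring).
  assert (Uz : punctured_disk eps (RtoC r * cis t)%C).
  { unfold punctured_disk. rewrite Cmod_mult, Cmod_cis, Cmod_R, Rabs_pos_eq; lra. }
  rewrite (rib_curvature _ c Z Zt _ HU HZ HC HZt RP Uz), (Hh _ Uz). reflexivity.
Qed.

(** * Gauss maps *)

Lemma coordinate_le_norm3 (p : vec) :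
  Rabs (x1 p) <= norm3 p /\ Rabs (x2 p) <= norm3 p /\ Rabs (x3 p) <= norm3 p.
Proof.
  assert (H : forall x, x * x <= dot p p -> Rabs x <= norm3 p).
  { intros x Hx. apply Rsqr_incr_0_var; [|apply sqrt_pos]. unfold Rsqr. rewrite norm3_sq.
    rewrite <- Rabs_mult, Rabs_pos_eq; nra. }
  unfold dot in H. repeat split; apply H; nra.
Qed.

(** The stereographic projection is taken from [n], so [g = 0] corresponds to [- n]; convergence is
    tested on the frame. *)
Lemma gauss_limit_of_frame (X : C -> vec) (a b n : vec) : oframe a b n 1 ->
  limC (fun z => RtoC (dot (gauss_map X z) a)) 0 0 ->
  limC (fun z => RtoC (dot (gauss_map X z) b)) 0 0 ->
  limC (fun z => RtoC (dot (gauss_map X z) n)) 0 (RtoC (-1)) ->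
  gauss_limit X (scal (-1) n).
Proof.
  intros F La Lb Ln. apply limC_0_minus in Ln.
  destruct (of_n _ _ _ _ F) as [N1 [N2 N3]].
  intros P [e HP]. assert (He := cond_pos e).
  destruct (limC_0_elim _ (e / 3) La ltac:(lra)) as [d1 [Hd1 B1]].
  destruct (limC_0_elim _ (e / 3) Lb ltac:(lra)) as [d2 [Hd2 B2]].
  destruct (limC_0_elim _ (e / 3) Ln ltac:(lra)) as [d3 [Hd3 B3]].
  apply locally'_iff. exists (Rmin d1 (Rmin d2 d3)).
  assert (Q1 : Rmin d1 (Rmin d2 d3) <= d1) by apply Rmin_l.
  assert (Q2 : Rmin d1 (Rmin d2 d3) <= d2) by (eapply Rle_trans; [apply Rmin_r|apply Rmin_l]).
  assert (Q3 : Rmin d1 (Rmin d2 d3) <= d3) by (eapply Rle_trans; [apply Rmin_r|apply Rmin_r]).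
  split; [repeat apply Rmin_pos; assumption|]. intros z Hz.
  specialize (B1 z ltac:(lra)). specialize (B2 z ltac:(lra)). specialize (B3 z ltac:(lra)).
  cbv beta in B1, B2, B3. rewrite <- RtoC_minus, Cmod_R in B3. rewrite Cmod_R in B1, B2.
  set (N := gauss_map X z) in *.
  assert (ND : norm3 (minus N (scal (-1) n)) < e).
  { eapply Rle_lt_trans; [apply (frame_norm a b n _ F)|].
    autorewrite with dots. rewrite N1, N2, N3.
    replace (dot N a - -1 * 0) with (dot N a) by ring.
    replace (dot N b - -1 * 0) with (dot N b) by ring.
    replace (dot N n - -1 * 1) with (dot N n - -1) by ring. lra. }
  destruct (coordinate_le_norm3 (minus N (scal (-1) n))) as [C1 [C2 C3]].
  apply HP. split; [split|].
  - change (Rabs (x1 (minus N (scal (-1) n))) < e). lra.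
  - change (Rabs (x2 (minus N (scal (-1) n))) < e). lra.
  - change (Rabs (x3 (minus N (scal (-1) n))) < e). lra.
Qed.

Lemma weierstrass_gauss_limits (dl : R) (X : C -> vec) (a b n : vec) (f g dg : C -> C) :
  0 < dl -> immersion_on (punctured_disk dl) X -> conformal_on (punctured_disk dl) X ->
  oframe a b n 1 -> weierstrass dl X a b n f g dg -> limC g 0 0 ->
  limC (fun z => RtoC (dot (gauss_map X z) a)) 0 0 /\
  limC (fun z => RtoC (dot (gauss_map X z) b)) 0 0 /\
  limC (fun z => RtoC (dot (gauss_map X z) n)) 0 (RtoC (-1)).
Proof.
  intros Hdl HX HC F W Lg.
  assert (LS := limC_plus _ _ _ _ _ (limC_const 1 0) (limC_mult _ _ _ _ _ Lg (limC_conj _ _ _ Lg))).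
  cbv beta in LS. replace (1 + 0 * Cconj 0)%C with (RtoC 1) in LS by ring.
  assert (N1 : RtoC 1 <> 0) by (apply RtoC_neq_0; lra).
  assert (Lh := limC_div _ _ _ _ _ (limC_mult _ _ _ _ _ (limC_const 2 0) (limC_conj _ _ _ Lg)) LS N1).
  assert (L3 := limC_minus _ _ _ _ _ (limC_const 1 0)
    (limC_div _ _ _ _ _ (limC_const 2 0) LS N1)). cbv beta in Lh, L3.
  rewrite conj_RtoC in Lh. replace (2 * 0 / 1)%C with (RtoC 0) in Lh by field.
  assert (Lh' : limC (fun z => hvec a b (gauss_map X z)) 0 0).
  { refine (limC_ext_0 _ _ _ dl Hdl _ Lh). intros z Hz. symmetry.
    exact (proj1 (weierstrass_normal dl X a b n f g dg z HX HC F W Hz)). }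
  split; [|split].
  - exact (limC_Re _ _ _ Lh').
  - apply (limC_Cmod_le _ (fun z => hvec a b (gauss_map X z)) 0 1 1 Rlt_0_1); [|exact Lh'].
    intros z _. rewrite Cmod_R, Rmult_1_l, <- Rabs_Ropp.
    exact (im_le_Cmod (hvec a b (gauss_map X z))).
  - replace (RtoC (-1)) with (1 - 2 / 1)%C.
    + refine (limC_ext_0 _ _ _ dl Hdl _ L3). intros z Hz. symmetry.
      exact (proj2 (weierstrass_normal dl X a b n f g dg z HX HC F W Hz)).
    + replace (2 / 1)%C with (RtoC 2) by field. apply C_eq; Csimp; ring.
Qed.

(** The two normals differ by [2 V / |V|^2], of norm [2 / |V|], which is [O(z)] because of the pole
    of [V]. *)
Lemma rib_gauss_limit (dl c : R) (Z Zt : C -> vec) (a b n e : vec) (l p0 : C) : 0 < dl ->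
  oframe a b n 1 -> rib_pair (punctured_disk dl) c Z Zt -> p0 <> 0 ->
  limC (fun z => z * hvec a b (rib_vec c Z Zt z))%C 0 p0 ->
  (forall p, Rabs (dot p e) <= norm3 p) ->
  limC (fun z => RtoC (dot (gauss_map Z z) e)) 0 l ->
  limC (fun z => RtoC (dot (gauss_map Zt z) e)) 0 l.
Proof.
  intros Hdl F RP Np Lp He HL.
  destruct (limC_apart _ _ _ Lp Np) as [d1 [Hd1 B1]].
  set (k0 := Cmod p0 / 2) in *.
  assert (Pk : 0 < k0) by (unfold k0; apply Cmod_gt_0 in Np; lra).
  pose (T := fun z => RtoC (2 / dot (rib_vec c Z Zt z) (rib_vec c Z Zt z) *
    dot (rib_vec c Z Zt z) e)).
  assert (LT : limC T 0 0).
  { apply (limC_Cmod_le _ (fun z => z) 0 (Rmin dl d1) (2 / k0));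
      [now apply Rmin_pos| |apply limC_id].
    intros z. rewrite Cminus_0. intros Hz.
    assert (Q1 := Rmin_l dl d1). assert (Q2 := Rmin_r dl d1).
    assert (PV := rp_neq_0 _ _ _ _ RP z ltac:(split; lra)).
    specialize (B1 z). rewrite Cminus_0, Cmod_mult in B1. specialize (B1 ltac:(lra)).
    assert (HV := hvec_norm a b n (rib_vec c Z Zt z) F).
    assert (NV := norm3_sq (rib_vec c Z Zt z)).
    unfold T. rewrite Cmod_R, Rabs_mult.
    specialize (He (rib_vec c Z Zt z)).
    set (q := dot (rib_vec c Z Zt z) (rib_vec c Z Zt z)) in *.
    set (h := norm3 (rib_vec c Z Zt z)) in *.
    set (hv := Cmod (hvec _ _ _)) in *. set (m := Cmod z) in *.
    assert (Ph : 0 <= h) by apply sqrt_pos.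
    assert (Ph' : 0 < h) by nra.
    rewrite Rabs_pos_eq by (apply Rdiv_le_0_compat; lra).
    apply Rle_trans with (2 / q * h).
    - apply Rmult_le_compat_l; [apply Rdiv_le_0_compat; lra|exact He].
    - apply Rmult_le_reg_r with (h * k0); [now apply Rmult_lt_0_compat|].
      rewrite <- NV. replace (2 / (h * h) * h * (h * k0)) with (2 * k0) by (field; lra).
      replace (2 / k0 * m * (h * k0)) with (2 * (m * h)) by (field; lra).
      assert (m * hv <= m * h) by (apply Rmult_le_compat_l; lra). lra. }
  assert (L := limC_plus _ _ _ _ _ HL LT). replace (l + 0)%C with l in L by ring.
  refine (limC_ext_0 _ _ _ dl Hdl _ L). intros z Hz. cbv beta.
  rewrite (rp_gauss _ _ _ _ RP z Hz). autorewrite with dots.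
  unfold T. rewrite <- RtoC_plus. reflexivity.
Qed.

(** * Restriction to a smaller disk and assembly of the end *)

Lemma rib_pair_sub (U W : C -> Prop) (c : R) (Z Zt : C -> vec) :
  (forall z, W z -> U z) -> rib_pair U c Z Zt -> rib_pair W c Z Zt.
Proof. intros H [H1 H2 H3 H4 H5]. constructor; auto. Qed.

Lemma immersion_sub (U W : C -> Prop) (X : C -> vec) :
  (forall z, W z -> U z) -> immersion_on U X -> immersion_on W X.
Proof.
  intros H [[H1 [H2 H3]] HD]. split; [split; [|split]|auto]; intros m z Hz; auto.
Qed.

Theorem theorem3p7 (eps : R) (Z Zt : C -> vec)
  (heps : 0 < eps)
  (hZ : catenoid_type_end eps Z)
  (humb : forall z, punctured_disk eps z -> ~ umbilic Z z)
  (hZt : minimal_immersion_on (punctured_disk eps) Zt)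
  (hrib : ribaucour_integrable (punctured_disk eps) Z Zt) :
  catenoid_type_end eps Zt /\
  exists nu : vec, gauss_limit Z nu /\ gauss_limit Zt nu.
Proof.
  assert (HU := open_punctured eps).
  assert (HZ := cte_minimal _ _ hZ). assert (HC := cte_conformal _ _ hZ).
  destruct hrib as [_ [[tau [_ [_ [c [rho [phi [RD _]]]]]]] _]].
  assert (RP := rib_pair_of_data _ Z Zt c rho phi HU HZ HC (proj1 (proj1 hZt)) RD).
  assert (Hc := rp_c _ _ _ _ RP).
  assert (HCt := rib_conformal _ c Z Zt HU HZ HC RP).
  destruct (end_asymptotics Z (cte_asymptotic _ _ hZ))
    as [be [a [b [n [sg [r [w [al [HT [F [Hsg [Hr [Hw [Hal [Lw [LH L3]]]]]]]]]]]]]]]].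
  destruct (end_weierstrass eps Z be a b n sg r w al heps HZ HC F Hr Hal Lw LH L3)
    as [LzH [L3' [dl [f [g [dg [Hdl [W [Lf Lg]]]]]]]]].
  assert (SUB := punctured_disk_sub dl eps (proj2 Hdl)).
  assert (HZd := immersion_sub _ _ _ SUB (proj1 HZ)).
  assert (HZtd := immersion_sub _ _ _ SUB (proj1 hZt)).
  assert (HCd : conformal_on (punctured_disk dl) Z) by (intros z Hz; apply HC, SUB, Hz).
  assert (RPd := rib_pair_sub _ _ _ _ _ SUB RP).
  set (u := rib_u c Z Zt a b n g).
  assert (Hu := rib_u_hol dl c Z Zt a b n f g dg HZd HCd (proj1 HZtd) F W RPd).
  cbv zeta in Hu. fold u in Hu.
  assert (HV : forall z, punctured_disk dl z ->
    hvec a b (rib_vec c Z Zt z) =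
      (u z - Cconj (g z) - Cconj (g z) * Cconj (g z) * Cconj (u z))%C /\
    RtoC (dot (rib_vec c Z Zt z) n) = (1 + g z * u z + Cconj (g z) * Cconj (u z))%C).
  { intros z Hz. exact (rib_u_vec dl c Z Zt a b n f g dg z HZd HCd F W RPd Hz). }
  destruct (rib_u_limit dl c r sg al f g u dg (proj1 Hdl) Hc Hr Hsg Hal
    (we_g _ _ _ _ _ _ _ _ W) Hu Lf Lg) as [p0 [Lp [Np Nk]]].
  assert (LV := rib_vec_pole dl (rib_vec c Z Zt) a b g u _ p0 (proj1 Hdl)
    (fun z Hz => proj1 (HV z Hz)) Lg Lp).
  destruct (gauss_u_limits g u _ p0 Lg Lp) as [Lg0 [Lgu _]].
  assert (Hat := minimal_harm _ Zt a HU hZt HCt). assert (Hbt := minimal_harm _ Zt b HU hZt HCt).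
  assert (Nc := RtoC_neq_0 c Hc). assert (Nr := RtoC_neq_0 r (Rgt_not_eq _ _ Hr)).
  assert (Nsr : sg * r <> 0).
  { apply Rmult_integral_contrapositive. split; [intros E; rewrite E in Hsg|]; lra. }
  (* The pole coefficient of [Zt]: that of [Z] plus that of [V / c]. Up to the factor [r / (2 al)]
     it is the quantity shown nonzero in [rib_u_limit]. *)
  set (A := (RtoC (r / 2) / al + RtoC (/ c) * p0)%C).
  assert (NA : A <> 0).
  { intros E. apply Nk.
    transitivity (A * (RtoC (2 / r) * al))%C; [|rewrite E; ring].
    unfold A, Rdiv. rewrite !RtoC_mult, !RtoC_inv, !RtoC_mult
      by (first [exact Hc|lra|apply Rmult_integral_contrapositive; split; lra]).
    field. repeat split; try assumption; apply C2_neq_0. }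
  assert (LA : limC (fun z => z * hcoord Zt a b z)%C 0 A).
  { refine (limC_ext_0 _ _ _ 1 Rlt_0_1 _ (limC_plus _ _ _ _ _ LzH
      (limC_mult _ _ _ _ _ (limC_const (RtoC (/ c)) 0) LV))).
    intros z _. cbv beta. rewrite (proj1 (rib_coordinates c Z Zt a b n z Hc)). ring. }
  (* The height of [Zt] has the logarithmic coefficient of [Z], since the axial component of [V]
     converges to [1 + 2 Re (l p0)] with [l = - sg al]. *)
  assert (L3t : limC (fun z => RtoC (dot (Zt z) n - sg * r * ln (Cmod z))) 0
    (RtoC (dot be n + sg * r * ln (Cmod al) + / c * (1 + 2 * Re (- (RtoC sg * al) * p0)%C)))).
  { assert (L := limC_plus _ _ _ _ _ L3' (limC_mult _ _ _ _ _ (limC_const (RtoC (/ c)) 0)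
      (limC_plus _ _ _ _ _ (limC_plus _ _ _ _ _ (limC_const 1 0) Lgu) (limC_conj _ _ _ Lgu)))).
    cbv beta in L.
    replace (1 + - (RtoC sg * al) * p0 + Cconj (- (RtoC sg * al) * p0))%C
      with (RtoC (1 + 2 * Re (- (RtoC sg * al) * p0)%C)) in L by (apply C_eq; Csimp; ring).
    rewrite <- RtoC_mult, <- RtoC_plus in L.
    refine (limC_ext_0 _ _ _ dl (proj1 Hdl) _ L). intros z Hz. cbv beta.
    rewrite (proj2 (rib_coordinates c Z Zt a b n z Hc)).
    replace (1 + g z * u z + Cconj (g z * u z))%C with (RtoC (dot (rib_vec c Z Zt z) n))
      by (rewrite (proj2 (HV z Hz)), Cmult_conj; reflexivity).
    rewrite <- RtoC_mult, <- RtoC_plus. f_equal. ring. }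
  destruct (rib_curvature_bound dl c Z Zt a b n f g dg _ p0 (proj1 Hdl) HZd HCd F W RPd Lf Lg0 Np LV)
    as [d [M [Hd BM]]].
  destruct (weierstrass_gauss_limits dl Z a b n f g dg (proj1 Hdl) HZd HCd F W Lg0)
    as [G1 [G2 G3]].
  split.
  - constructor.
    + exact hZt.
    + exact HCt.
    + exact (complete_of_log eps Zt a b n _ _ (proj1 (proj1 hZt)) F Nsr L3t).
    + exact (rib_finite_curvature eps c d M Z Zt (conj (proj1 Hd) (Rle_trans _ _ _ (proj2 Hd)
        (proj2 Hdl))) HZ HC (proj1 hZt) RP BM).
    + exact (embedded_of_pole eps Zt a b n A heps NA F Hat Hbt LA).
    + exact (rib_asymptotic dl c r sg Z Zt be a b n w g u _ al _ p0 (proj1 Hdl) Hc HT F Hr Hw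
        Hal Lw LH L3 Hu HV Lg Lp Nk).
  (* The common limit is the axis direction [- n], at which [g] vanishes. *)
  - exists (scal (-1) n). split; apply (gauss_limit_of_frame _ a b n F); auto.
    + exact (rib_gauss_limit dl c Z Zt a b n a _ p0 (proj1 Hdl) F RPd Np LV
        (fun p => proj1 (frame_norm_ge a b n p F)) G1).
    + exact (rib_gauss_limit dl c Z Zt a b n b _ p0 (proj1 Hdl) F RPd Np LV
        (fun p => proj1 (proj2 (frame_norm_ge a b n p F))) G2).
    + exact (rib_gauss_limit dl c Z Zt a b n n _ p0 (proj1 Hdl) F RPd Np LV
        (fun p => proj2 (proj2 (frame_norm_ge a b n p F))) G3).
Qed.
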